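(* Let $k$ be a field of characteristic $3$. Then the Lie superalgebra $\mathfrak{g}(S_{1,2},S_{1,2})$ is isomorphic to the Tits-Kantor-Koecher Lie superalgebra of the Kac superalgebra $K_9$.
   Context: In signs, $(-1)^{xy}$ is $-1$ if the homogeneous elements $x,y$ are both odd and $1$ otherwise. Indices $i=0,1,2$ are taken modulo $3$. $\mathrm{char}\,k=3$. The superalgebra $S_{1,2}$. Let $V$ be a two dimensional vector space with a nonzero alternating bilinear form $\langle\cdot|\cdot\rangle$. $B(1,2)$ is the superalgebra with even part $k1$, odd part $V$, unity $1$, and $uv=\langle u|v\rangle1$ for $u,v\in V$, with norm $q=(q_{\bar 0},\mathrm{b})$: $q_{\bar 0}$ is the quadratic form on $k1$ with $q_{\bar 0}(1)=1$, and $\mathrm{b}$ is the supersymmetric even bilinear form with $\mathrm{b}(1,1)=2$ and $\mathrm{b}(u,v)=\langle u|v\rangle$ for $u,v\in V$. It is a unital composition superalgebra with standard involution $\bar x=\mathrm{b}(x,1)1-x$. $S_{1,2}$ is the attached para-Hurwitz superalgebra: same superspace and norm, with product $x\bullet y=\bar x\bar y$; it is a symmetric composition superalgebra ($\mathrm{b}(x\bullet y,z)=\mathrm{b}(x,y\bullet z)$). Triality. For a symmetric composition superalgebra $S$ (with product $\bullet$ and norm $q=(q_{\bar 0},\mathrm{b})$), $\mathfrak{tri}(S)_{\bar i}=\{(d_0,d_1,d_2)\in\mathfrak{osp}(S,q)_{\bar i}^3: d_0(x\bullet y)=d_1(x)\bullet y+(-1)^{ix}x\bullet d_2(y)\ \forall\text{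 homogeneous }x,y\in S\}$, $\mathfrak{tri}(S)=\mathfrak{tri}(S)_{\bar 0}\oplus\mathfrak{tri}(S)_{\bar 1}$ with componentwise bracket; $\mathfrak{osp}(S,q)$ is the orthosymplectic Lie superalgebra of $\mathrm{b}$. Put $\theta(d_0,d_1,d_2)=(d_2,d_0,d_1)$, $l_x(y)=x\bullet y$, $r_x(y)=(-1)^{xy}y\bullet x$, $\sigma_{x,y}(z)=(-1)^{yz}\mathrm{b}(x,z)y-(-1)^{x(y+z)}\mathrm{b}(y,z)x$ and $t_{x,y}=(\sigma_{x,y},\frac12\mathrm{b}(x,y)1-r_xl_y,\frac12\mathrm{b}(x,y)1-l_xr_y)\in\mathfrak{tri}(S)$. The Lie superalgebra $\mathfrak{g}(S,S')$. For symmetric composition superalgebras $S,S'$, $\mathfrak{g}(S,S')=\mathfrak{tri}(S)\oplus\mathfrak{tri}(S')\oplus\bigl(\oplus_{i=0}^2\iota_i(S\otimes S')\bigr)$, where $\iota_i(S\otimes S')$ is a copy of $S\otimes S'$; $\mathfrak{tri}(S)\oplus\mathfrak{tri}(S')$ is a subsuperalgebra with its direct sum bracket, and for homogeneous elements: $[(d_0,d_1,d_2),\iota_i(x\otimes x')]=\iota_i(d_i(x)\otimes x')$; $[(d_0',d_1',d_2'),\iota_i(x\otimes x')]=(-1)^{d_i'x}\iota_i(x\otimes d_i'(x'))$; $[\iota_i(x\otimes x'),\iota_{i+1}(y\otimes y')]=(-1)^{x'y}\iota_{i+2}((x\bullet y)\otimes(x'\bullet y'))$; $[\iota_i(x\otimes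 x'),\iota_i(y\otimes y')]=(-1)^{xx'+xy'+yy'}\mathrm{b}'(x',y')\theta^i(t_{x,y})+(-1)^{yx'}\mathrm{b}(x,y)\theta'^i(t'_{x',y'})$ (primes denote the analogous objects for $S'$). The Kac superalgebra $K_9$. The tiny Kaplansky superalgebra $K_3$ is the Jordan superalgebra with even part $ke$, odd part $kx+ky$ and product $e^2=e$, $ex=xe=\frac12x$, $ey=ye=\frac12y$, $xy=e=-yx$, $x^2=y^2=0$. In characteristic $3$ the ten dimensional Kac Jordan superalgebra $K_{10}$ has a nine dimensional simple ideal $K_9$, which is the tensor product of superalgebras $K_9=K_3\otimes K_3$, with product $(x\otimes x')(y\otimes y')=(-1)^{x'y}xy\otimes x'y'$. Tits-Kantor-Koecher construction. For a Jordan superalgebra $H$, let $L_x$ be left multiplication by $x$, $d_{x,y}=[L_x,L_y]$ (supercommutator, a derivation of $H$) and $\mathfrak{der}\,H$ the Lie superalgebra of derivations. With $Q=\mathrm{Mat}_2(k)$, $Q^0$ its trace zero elements and $\mathrm{b}_q$ the polar form of $\det$, the Tits-Kantor-Koecher Lie superalgebra of $H$ is $\mathcal{T}(Q,H)=(Q^0\otimes H)\oplus\mathfrak{der}\,H$, where $\mathfrak{der}\,H$ is a subsuperalgebra, $[d,a\otimes x]=a\otimes d(x)$, and $[a\otimes x,b\otimes y]=[a,b]\otimes xy-2\mathrm{b}_q(a,b)d_{x,y}$ for $a,b\in Q^0$, $x,y\in H$, $d\in\mathfrak{der}\,H$ (elements of $Q^0$ are even). *)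

(* Defs.v *)
From HB Require Import structures.
From mathcomp Require Import all_boot all_order all_algebra.
From mathcomp Require Import boolp ring.

Set Implicit Arguments.
Unset Strict Implicit.
Unset Printing Implicit Defensive.

Import GRing.Theory.
Local Open Scope ring_scope.

(* A finite dimensional superspace: the decomposition into even (false) and  *)
(* odd (true) part is given by the two projections.                          *)
Record superspace (k : fieldType) := Superspace {
  svect :> vectType k;
  hc : bool -> svect -> svect;
  hc_linear : forall i, linear (hc i);
  hc_sum : forall x, hc false x + hc true x = x;
  hcK : forall i j x, hc i (hc j x) = if i == j then hc j x else 0 }.

Definition homog (k : fieldType) (V : superspace k) (i : bool) (x : V) : Prop :=
  hc i x = x.

(* The product is only required to be bilinear: that it respects the grading *)
(* is not part of the record, so that the brackets below can be defined      *)
(* before the inclusions they rely on are proved.                            *)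
Record superalgebra (k : fieldType) := Superalgebra {
  sspace :> superspace k;
  smul : sspace -> sspace -> sspace;
  smul_bilinear : bilinear_for *:%R *:%R smul }.

Definition superalgebra_iso (k : fieldType) (A B : superalgebra k) : Prop :=
  exists f : A -> B,
    [/\ linear f, bijective f,
        forall i x, f (hc i x) = hc i (f x) &
        forall x y, f (smul x y) = smul (f x) (f y)].

(* An algebra with a norm q = (q_0, b); the value of [qnorm] matters on even *)
(* elements only.                                                            *)
Record normed_superalgebra (k : fieldType) := NormedSuperalgebra {
  nalg :> superalgebra k;
  qnorm : nalg -> k;
  bform : nalg -> nalg -> k;
  bform_bilinear : bilinear_for *%R *%R bform }.

Section Subspaces.
Variables (k : fieldType).

Definition is_subspace (V : vectType k) (P : V -> Prop) : Prop :=
  P 0 /\ forall a x y, P x -> P y -> P (a *: x + y).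

Fact subspace_exists (V : vectType k) (P : V -> Prop) :
  exists U : {vspace V}, is_subspace P -> forall v, v \in U <-> P v.
Proof.
have [[P0 PL]|nP] := pselect (is_subspace P); last by exists 0%VS.
pose inP (U : {vspace V}) := forall v, v \in U -> P v.
pose Q n := `[< exists U, inP U /\ \dim U = n >].
have exQ : exists n, Q n.
  by exists 0; apply/asboolP; exists 0%VS; rewrite dimv0; split=> // v /[!memv0] /eqP->.
have ubQ n : Q n -> (n <= \dim {:V})%N.
  by move=> /asboolP [U [_ <-]]; apply/dimvS/subvf.
case: (ex_maxnP exQ ubQ) => n /asboolP[U [PU dU]] maxn.
exists U => _ v; split=> [/PU//|Pv].
have PUv : inP (U + <[v]>)%VS.
  move=> w /memv_addP[u uU [w' /vlineP[a ->] ->]].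
  by rewrite addrC; apply: PL => //; apply: PU.
have le : (\dim (U + <[v]>) <= \dim U)%N.
  by rewrite dU; apply: maxn; apply/asboolP; exists (U + <[v]>)%VS.
have : (U == U + <[v]>)%VS by rewrite eqEdim addvSl.
by move/eqP->; apply: (subvP (addvSr U <[v]>)); apply: memv_line.
Qed.

(* The subspace {v | P v} when P is stable under linear combinations.        *)
Definition subspace (V : vectType k) (P : V -> Prop) : {vspace V} :=
  projT1 (cid (subspace_exists P)).

Lemma mem_subspace (V : vectType k) (P : V -> Prop) (v : V) :
  is_subspace P -> v \in subspace P <-> P v.
Proof. by move=> PP; apply: (projT2 (cid (subspace_exists P)) PP). Qed.

Lemma hc0 (V : superspace k) i : hc i (0 : V) = 0.
Proof. by have := hc_linear i 1 (0 : V) 0; rewrite !scale1r addr0 -{1}[hc i 0]addr0 => /addrI. Qed.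

Section SubSuperspace.
Variables (W : superspace k) (P : bool -> W -> Prop).
Hypothesis PP : forall i, is_subspace (P i).

Definition sub_vspace : {vspace W} := subspace (fun w => forall i, P i (hc i w)).

Lemma sub_vspaceP w : w \in sub_vspace <-> forall i, P i (hc i w).
Proof.
apply: mem_subspace; split=> [i|a x y Px Py i].
  by rewrite hc0; apply: (PP i).1.
by rewrite hc_linear; apply: (PP i).2.
Qed.

Lemma sub_vspace_hc i w : w \in sub_vspace -> hc i w \in sub_vspace.
Proof.
move=> /sub_vspaceP Pw; apply/sub_vspaceP => j; rewrite hcK.
by case: eqP => [<-|_]; [apply: Pw | apply: (PP j).1].
Qed.

Definition sub_hc i (x : subvs_of sub_vspace) : subvs_of sub_vspace :=
  vsproj sub_vspace (hc i (vsval x)).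

Lemma val_sub_hc i x : vsval (sub_hc i x) = hc i (vsval x).
Proof. by rewrite vsprojK // sub_vspace_hc // subvsP. Qed.

Fact sub_hc_linear i : linear (sub_hc i).
Proof. by move=> a x y; apply: subvs_inj; rewrite val_sub_hc !linearP /= hc_linear !val_sub_hc. Qed.
Fact sub_hc_sum x : sub_hc false x + sub_hc true x = x.
Proof. by apply: subvs_inj; rewrite linearD /= !val_sub_hc hc_sum. Qed.
Fact sub_hcK i j x : sub_hc i (sub_hc j x) = if i == j then sub_hc j x else 0.
Proof. by apply: subvs_inj; rewrite !val_sub_hc hcK; case: ifP; rewrite ?val_sub_hc ?linear0. Qed.

(* The subsuperspace whose part of degree i is {w in W_i | P i w}.           *)
Definition sub_superspace : superspace k :=
  Superspace sub_hc_linear sub_hc_sum sub_hcK.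

End SubSuperspace.
End Subspaces.

Section Constructions.
Variable k : fieldType.

Section Even.
Variable V : vectType k.
Definition even_hc (i : bool) (x : V) : V := if i then 0 else x.
Fact even_hc_linear i : linear (even_hc i).
Proof. by case: i => a x y //=; rewrite scaler0 addr0. Qed.
Fact even_hc_sum x : even_hc false x + even_hc true x = x.
Proof. exact: addr0. Qed.
Fact even_hcK i j x : even_hc i (even_hc j x) = if i == j then even_hc j x else 0.
Proof. by case: i; case: j. Qed.
Definition even_superspace := Superspace even_hc_linear even_hc_sum even_hcK.
End Even.

Section OddEven.
Variables V0 V1 : vectType k.
Definition oe_hc (i : bool) (x : V0 * V1) : V0 * V1 :=
  if i then (0, x.2) else (x.1, 0).
Fact oe_hc_linear i : linear (oe_hc i).
Proof. by case: i => a [x0 x1] [y0 y1]; congr (_, _); rewrite /= ?scaler0 ?addr0. Qed.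
Fact oe_hc_sum x : oe_hc false x + oe_hc true x = x.
Proof. by case: x => x0 x1; congr (_, _); rewrite /= ?addr0 ?add0r. Qed.
Fact oe_hcK i j x : oe_hc i (oe_hc j x) = if i == j then oe_hc j x else 0.
Proof. by case: i; case: j. Qed.
(* V0 x V1, with V0 even and V1 odd.                                         *)
Definition oe_superspace := Superspace oe_hc_linear oe_hc_sum oe_hcK.
End OddEven.

Section Prod.
Variables V W : superspace k.
Definition prod_hc i (x : V * W) : V * W := (hc i x.1, hc i x.2).
Fact prod_hc_linear i : linear (prod_hc i).
Proof. by move=> a [x0 x1] [y0 y1]; congr (_, _); rewrite /= hc_linear. Qed.
Fact prod_hc_sum x : prod_hc false x + prod_hc true x = x.
Proof. by case: x => x0 x1; congr (_, _); rewrite /= hc_sum. Qed.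
Fact prod_hcK i j x : prod_hc i (prod_hc j x) = if i == j then prod_hc j x else 0.
Proof. by rewrite /prod_hc /= !hcK; case: ifP. Qed.
Definition prod_superspace := Superspace prod_hc_linear prod_hc_sum prod_hcK.
End Prod.

Section Pow3.
Variable V : superspace k.
Definition pow3_hc i (x : {ffun 'Z_3 -> V}) : {ffun 'Z_3 -> V} := [ffun j => hc i (x j)].
Fact pow3_hc_linear i : linear (pow3_hc i).
Proof. by move=> a x y; apply/ffunP => j; rewrite !ffunE hc_linear. Qed.
Fact pow3_hc_sum x : pow3_hc false x + pow3_hc true x = x.
Proof. by apply/ffunP => j; rewrite !ffunE hc_sum. Qed.
Fact pow3_hcK i j x : pow3_hc i (pow3_hc j x) = if i == j then pow3_hc j x else 0.
Proof. by apply/ffunP => l; rewrite !ffunE hcK; case: ifP; rewrite !ffunE. Qed.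
Definition pow3_superspace :=
  Superspace pow3_hc_linear pow3_hc_sum pow3_hcK.
End Pow3.

Section End.
Variable V : superspace k.
Lemma linfunE_lin (U W : vectType k) (f : U -> W) : linear f -> linfun f =1 f.
Proof.
move=> fL; pose fM := GRing.isLinear.Build _ _ _ _ f fL.
pose F : {linear U -> W} := HB.pack f fM.
exact: (lfunE F).
Qed.
Definition end_hc i (f : 'End(V)) : 'End(V) :=
  linfun (fun x => \sum_(a : bool) hc (a (+) i) (f (hc a x))).
Lemma sum_bool (U : zmodType) (F : bool -> U) : \sum_(a : bool) F a = F false + F true.
Proof. by rewrite (bigD1 false) //= (bigD1 true) //= big1 ?addr0 // => -[]. Qed.
Lemma hcD i : {morph @hc k V i : x y / x + y}.
Proof. by move=> x y; have := hc_linear i 1 x y; rewrite !scale1r. Qed.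
Lemma end_hcE i f x : end_hc i f x = \sum_(a : bool) hc (a (+) i) (f (hc a x)).
Proof.
rewrite linfunE_lin // => c u v; rewrite scaler_sumr -big_split /=.
by apply: eq_bigr => a _; rewrite hc_linear linearP hc_linear.
Qed.
Fact end_hc_linear i : linear (end_hc i).
Proof.
move=> c f g; apply/lfunP => x; rewrite add_lfunE scale_lfunE !end_hcE.
rewrite scaler_sumr -big_split /=.
by apply: eq_bigr => a _; rewrite add_lfunE scale_lfunE hc_linear.
Qed.
Fact end_hc_sum f : end_hc false f + end_hc true f = f.
Proof.
apply/lfunP => x; rewrite add_lfunE !end_hcE !sum_bool /=.
by rewrite addrACA hc_sum [hc true _ + _]addrC hc_sum -linearD hc_sum.
Qed.
Fact end_hcK i j f : end_hc i (end_hc j f) = if i == j then end_hc j f else 0.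
Proof.
apply/lfunP => x; rewrite end_hcE sum_bool !end_hcE !sum_bool.
by case: i; case: j; rewrite ?zero_lfunE ?end_hcE ?sum_bool /= !hcD ?hcK /= ?linear0
  ?hc0 ?addr0 ?add0r ?hcK /= ?addr0.
Qed.
Definition end_superspace := Superspace end_hc_linear end_hc_sum end_hcK.
End End.

(* The tensor product of finite dimensional spaces, as matrices of           *)
(* coordinates in the bases [vbasis fullv]; the lemmas [tlift_tens] and      *)
(* [tens_ext] are its universal property.                                    *)
Section Tensor.
Variables V W : vectType k.

Definition tensor := 'M[k]_(\dim {:V}, \dim {:W}).

Definition tens (x : V) (y : W) : tensor :=
  \matrix_(i, j) (coord (vbasis {:V}) i x * coord (vbasis {:W}) j y).

Definition tlift (U : vectType k) (f : V -> W -> U) (m : tensor) : U :=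
  \sum_i \sum_j m i j *: f (vbasis {:V})`_i (vbasis {:W})`_j.

Lemma tens_bilinear : bilinear_for *:%R *:%R tens.
Proof.
by split=> z a x y; apply/matrixP => i j; rewrite !mxE linearP /=; ring.
Qed.

Lemma tlift_linear (U : vectType k) (f : V -> W -> U) : linear (tlift f).
Proof.
move=> a m n; rewrite scaler_sumr -big_split; apply: eq_bigr => i _ /=.
rewrite scaler_sumr -big_split; apply: eq_bigr => j _ /=.
by rewrite !mxE scalerDl scalerA.
Qed.

Lemma lin_sum (U U' : lmodType k) (f : U -> U') (I : finType) (F : I -> k) (G : I -> U) :
  linear f -> f (\sum_i F i *: G i) = \sum_i F i *: f (G i).
Proof.
move=> fL; pose fM := GRing.isLinear.Build _ _ _ _ f fL.
pose h : {linear U -> U'} := HB.pack f fM.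
by rewrite -[LHS]/(h _) linear_sum; apply: eq_bigr => i _; rewrite linearZ.
Qed.

Lemma tlift_tens (U : vectType k) (f : V -> W -> U) x y :
  bilinear_for *:%R *:%R f -> tlift f (tens x y) = f x y.
Proof.
case=> fl fr.
rewrite {2}(coord_vbasis (memvf x)) (lin_sum _ _ (fl y)); apply: eq_bigr => i _.
rewrite {2}(coord_vbasis (memvf y)) (lin_sum _ _ (fr _)) scaler_sumr.
by apply: eq_bigr => j _; rewrite mxE scalerA.
Qed.

Lemma tens_decomp (m : tensor) : m = tlift tens m.
Proof.
have bV := basis_free (vbasisP {:V}); have bW := basis_free (vbasisP {:W}).
apply/matrixP => i j; rewrite summxE (bigD1 i) //= summxE (bigD1 j) //= !mxE.
rewrite !coord_free // !eqxx !mulr1 !big1 ?addr0 //.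
- move=> i' ne; rewrite summxE big1 // => j' _.
  by rewrite !mxE !coord_free // (negbTE ne) mul0r mulr0.
- by move=> j' ne; rewrite !mxE !coord_free // (negbTE ne) !mulr0.
Qed.

Lemma tens_ext (U : vectType k) (f g : tensor -> U) : linear f -> linear g ->
  (forall x y, f (tens x y) = g (tens x y)) -> f =1 g.
Proof.
move=> fL gL fg m; rewrite (tens_decomp m) /tlift.
pose h u := f u - g u; have hL : linear h.
  by move=> a x y; rewrite /h fL gL scalerBr opprD addrACA.
apply/eqP; rewrite -subr_eq0 -/(h _); apply/eqP.
have h0 : h 0 = 0 by have := hL 1 0 0; rewrite !scale1r addr0 -{1}[h 0]addr0 => /addrI.
have hD x y : h (x + y) = h x + h y by have := hL 1 x y; rewrite !scale1r.
rewrite (big_morph h hD h0) big1 // => i _.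
rewrite (lin_sum _ _ hL) big1 // => j _.
by rewrite /h fg subrr scaler0.
Qed.
End Tensor.

Section TensorSuper.
Variables V W : superspace k.
Definition tensor_hc i : tensor V W -> tensor V W :=
  tlift (fun x y => \sum_(a : bool) tens (hc a x) (hc (a (+) i) y)).
Lemma tensor_hc_tens i x y :
  tensor_hc i (tens x y) = \sum_(a : bool) tens (hc a x) (hc (a (+) i) y).
Proof.
rewrite /tensor_hc tlift_tens //; split=> z c u v /=.
all: rewrite scaler_sumr -big_split; apply: eq_bigr => a _ /=; rewrite hc_linear.
  exact: (tens_bilinear V W).1.
exact: (tens_bilinear V W).2.
Qed.
Fact tensor_hc_linear i : linear (tensor_hc i).
Proof. exact: tlift_linear. Qed.
Lemma tens0r (x : V) : tens x (0 : W) = 0.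
Proof. by apply/matrixP => i j; rewrite !mxE linear0 mulr0. Qed.
Lemma tens0l (x : W) : tens (0 : V) x = 0.
Proof. by apply/matrixP => i j; rewrite !mxE linear0 mul0r. Qed.
Lemma tensDr (x : V) (y z : W) : tens x (y + z) = tens x y + tens x z.
Proof. by apply/matrixP => i j; rewrite !mxE linearD mulrDr. Qed.
Lemma tensDl (x y : V) (z : W) : tens (x + y) z = tens x z + tens y z.
Proof. by apply/matrixP => i j; rewrite !mxE linearD mulrDl. Qed.
Fact tensor_hc_sum x : tensor_hc false x + tensor_hc true x = x.
Proof.
move: x; apply: tens_ext => [a m n|a m n|x y] //.
  by rewrite !tensor_hc_linear scalerDr addrACA.
rewrite !tensor_hc_tens !sum_bool /=.
by rewrite addrACA -!tensDr hc_sum [hc true y + _]addrC hc_sum -tensDl hc_sum.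
Qed.
Fact tensor_hcK i j x : tensor_hc i (tensor_hc j x) = if i == j then tensor_hc j x else 0.
Proof.
move: x; apply: tens_ext => [a m n|a m n|x y].
- by rewrite !tensor_hc_linear.
- by case: ifP => _; rewrite ?tensor_hc_linear // scaler0 addr0.
have hD l : {morph tensor_hc l : u v / u + v}.
  by move=> u v; have := tensor_hc_linear l 1 u v; rewrite !scale1r.
rewrite !tensor_hc_tens !sum_bool hD !tensor_hc_tens !sum_bool /=.
by case: i; case: j; rewrite /= !hcK /= ?tens0r ?tens0l ?addr0 ?add0r.
Qed.
Definition tensor_superspace :=
  Superspace tensor_hc_linear tensor_hc_sum tensor_hcK.
End TensorSuper.
End Constructions.

Section Algebras.
Variable k : fieldType.

Section Lifts.
Lemma tlift_fun (V W U : vectType k) (f g h : V -> W -> U) c m :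
  (forall x y, f x y = c *: g x y + h x y) ->
  tlift f m = c *: tlift g m + tlift h m.
Proof.
move=> fE; rewrite scaler_sumr -big_split; apply: eq_bigr => i _ /=.
rewrite scaler_sumr -big_split; apply: eq_bigr => j _ /=.
by rewrite fE scalerDr !scalerA mulrC.
Qed.

(* The bilinear map sending (x (x) x', y (x) y') to F x x' y y'.             *)
Definition tlift2 (V W V' W' U : vectType k) (F : V -> W -> V' -> W' -> U)
    (m : tensor V W) (n : tensor V' W') : U :=
  tlift (fun x x' => tlift (F x x') n) m.

Lemma tlift2_bilinear (V W V' W' U : vectType k) (F : V -> W -> V' -> W' -> U) :
  bilinear_for *:%R *:%R (tlift2 F).
Proof.
split=> [n|m] a u v; first exact: tlift_linear.
by apply: tlift_fun => x y; rewrite tlift_linear.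
Qed.

(* (y, x) |-> (-1)^(xy) f(x, y), extended bilinearly from homogeneous x, y   *)
Definition sflip (V W : superspace k) (U : vectType k) (f : V -> W -> U)
    (y : W) (x : V) : U :=
  \sum_(a : bool) \sum_(b : bool) (-1) ^+ (a && b) *: f (hc a x) (hc b y).

Lemma sflip_bilinear (V W : superspace k) (U : vectType k) (f : V -> W -> U) :
  bilinear_for *:%R *:%R f -> bilinear_for *:%R *:%R (sflip f).
Proof.
move=> [fl fr]; split=> z c x y /=.
all: rewrite scaler_sumr -big_split; apply: eq_bigr => a _ /=.
all: rewrite scaler_sumr -big_split; apply: eq_bigr => b _ /=.
  by rewrite hc_linear fr scalerDr !scalerA mulrC.
by rewrite hc_linear fl scalerDr !scalerA mulrC.
Qed.
End Lifts.

Section TensorAlgebra.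
Variables A B : superalgebra k.
Definition tensor_mul : tensor A B -> tensor A B -> tensor A B :=
  tlift2 (fun x x' y y' => \sum_(a : bool) \sum_(b : bool)
    (-1) ^+ (a && b) *: tens (smul x (hc b y)) (smul (hc a x') y')).
Definition tensor_superalgebra : superalgebra k :=
  @Superalgebra k (tensor_superspace A B) tensor_mul (tlift2_bilinear _).
End TensorAlgebra.

Section EndBracket.
Variable V : superspace k.
(* The supercommutator of End(V).                                            *)
Definition scomm (f g : end_superspace V) : end_superspace V :=
  \sum_(a : bool) \sum_(b : bool)
    ((hc a f \o hc b g)%VF - (-1) ^+ (a && b) *: (hc b g \o hc a f)%VF).

Lemma scomm_bilinear : bilinear_for *:%R *:%R scomm.
Proof.
split=> z c x y /=.
all: rewrite scaler_sumr -big_split; apply: eq_bigr => a _ /=.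
all: rewrite scaler_sumr -big_split; apply: eq_bigr => b _ /=.
all: apply/lfunP => w; rewrite ?hc_linear ?end_hc_linear.
all: rewrite !(add_lfunE, opp_lfunE, scale_lfunE, comp_lfunE) linearP.
all: by rewrite scalerBr scalerDr opprD addrACA !scalerA mulrC.
Qed.
End EndBracket.

Definition lmul (A : superalgebra k) (x : A) : 'End(A) := linfun (smul x).

Section ParaHurwitz.
Variables (B : normed_superalgebra k) (e : B).
Definition bconj (x : B) : B := bform x e *: e - x.
Definition para_mul (x y : B) : B := smul (bconj x) (bconj y).
Fact para_bilinear : bilinear_for *:%R *:%R para_mul.
Proof.
have cL : linear bconj.
  move=> a x y; rewrite /bconj (bform_bilinear B).1 scalerBr scalerDl scalerA.
  by rewrite opprD addrACA.
split=> z a x y; rewrite /para_mul /= cL.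
  exact: (smul_bilinear B).1.
exact: (smul_bilinear B).2.
Qed.
(* The para-Hurwitz superalgebra attached to B, with unity e.                *)
Definition para_hurwitz : normed_superalgebra k :=
  @NormedSuperalgebra k (Superalgebra para_bilinear) (@qnorm k B) _ (@bform_bilinear k B).
End ParaHurwitz.

Section S12.
Variables (V : vectType k) (form : {biscalar V}).
Definition B12_mul (x y : k^o * V) : k^o * V :=
  (x.1 * y.1 + form x.2 y.2, x.1 *: y.2 + y.1 *: x.2).
Definition B12_qnorm (x : k^o * V) : k := x.1 ^+ 2.
Definition B12_bform (x y : k^o * V) : k := 2 * x.1 * y.1 + form x.2 y.2.
Fact B12_mul_bilinear : bilinear_for *:%R *:%R B12_mul.
Proof.
split=> -[z0 z1] a [x0 x1] [y0 y1]; congr (_, _); rewrite /= ?linearPl ?linearPr /=.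
- by rewrite /GRing.scale /=; ring.
- by rewrite !scalerDl !scalerDr !scalerA addrACA [a * z0]mulrC.
- by rewrite /GRing.scale /=; ring.
- by rewrite !scalerDl !scalerDr !scalerA addrACA [a * z0]mulrC.
Qed.
Fact B12_bform_bilinear : bilinear_for *%R *%R B12_bform.
Proof.
by split=> -[z0 z1] a [x0 x1] [y0 y1]; rewrite /B12_bform /= ?linearPl ?linearPr
  /GRing.scale /=; ring.
Qed.
Definition B12 : normed_superalgebra k :=
  @NormedSuperalgebra k (@Superalgebra k (oe_superspace _ _) _ B12_mul_bilinear)
    B12_qnorm _ B12_bform_bilinear.
Definition S12 : normed_superalgebra k := @para_hurwitz B12 (1, 0).
End S12.

Section Triality.
Variable S : normed_superalgebra k.
Local Notation "x • y" := (@smul k S x y) (at level 40).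
Local Notation b := (@bform k S).

(* d is in osp(S, q)_i                                                       *)
Definition osp (i : bool) (d : end_superspace S) : Prop :=
  homog i d /\ forall (a c : bool) (x y : S), homog a x -> homog c y ->
    b (d x) y + (-1) ^+ (i && a) * b x (d y) = 0.

(* d is in tri(S)_i                                                          *)
Definition in_tri (i : bool) (d : {ffun 'Z_3 -> 'End(S)}) : Prop :=
  (forall j, osp i (d j)) /\
  forall (a c : bool) (x y : S), homog a x -> homog c y ->
    d 0 (x • y) = d 1 x • y + (-1) ^+ (i && a) *: (x • d 2 y).

Fact in_tri_subspace i : @is_subspace k (pow3_superspace (end_superspace S)) (in_tri i).
Proof.
have [bl br] := bform_bilinear S; have [ml mr] := smul_bilinear S.
have b0l x : b 0 x = 0
  by have := bl x 1 0 0; rewrite /= scale1r mul1r addr0 -{1}[b 0 x]addr0 => /addrI.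
have b0r x : b x 0 = 0
  by have := br x 1 0 0; rewrite /= scale1r mul1r addr0 -{1}[b x 0]addr0 => /addrI.
have m0l x : 0 • x = 0.
  by have := ml x 1 0 0; rewrite /= !scale1r addr0 -{1}[0 • x]addr0 => /addrI.
have m0r x : x • 0 = 0.
  by have := mr x 1 0 0; rewrite /= !scale1r addr0 -{1}[x • 0]addr0 => /addrI.
split=> [|a d d' [od td] [od' td']]; split=> [j|u v x y hx hy].
- rewrite ffunE; split=> [|u v x y _ _]; first exact: hc0.
  by rewrite !zero_lfunE b0l b0r mulr0 addr0.
- by rewrite !ffunE !zero_lfunE m0l m0r scaler0 addr0.
- have [[hd o] [hd' o']] := (od j, od' j); rewrite !ffunE; split=> [|u v x y hx hy].
    by rewrite /homog hc_linear hd hd'.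
  rewrite !add_lfunE !scale_lfunE bl br.
  have e := o _ _ _ _ hx hy; have e' := o' _ _ _ _ hx hy.
  by rewrite mulrDr [_ * (a * _)]mulrCA addrACA -mulrDr e e' mulr0 addr0.
- rewrite !ffunE !add_lfunE !scale_lfunE ml mr.
  rewrite (td _ _ _ _ hx hy) (td' _ _ _ _ hx hy).
  by rewrite !scalerDr !scalerA [a * _]mulrC addrACA.
Qed.

Definition tri : superspace k := sub_superspace in_tri_subspace.
Definition tri_fun (d : tri) (j : 'Z_3) : 'End(S) :=
  (vsval d : {ffun 'Z_3 -> 'End(S)}) j.
(* [vsproj] only changes the type of elements of tri(S): it is applied to    *)
(* brackets of elements of tri(S) and to the t_{x,y}, which lie in tri(S)    *)
(* when S is a symmetric composition superalgebra.                           *)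
Definition tri_proj (d : {ffun 'Z_3 -> 'End(S)}) : tri :=
  vsproj (@sub_vspace k (pow3_superspace (end_superspace S)) in_tri) d.

Definition tri_bracket (d d' : tri) : tri :=
  tri_proj [ffun j => scomm (tri_fun d j) (tri_fun d' j)].

Lemma tri_fun_linear j : linear (fun d => tri_fun d j).
Proof.
move=> a d d'; rewrite /tri_fun (linearP (@vsval _ _ _) a d d').
by rewrite ffunE [X in X + _]ffunE.
Qed.

Lemma tri_proj_linear : linear tri_proj.
Proof. by move=> a x y; rewrite /tri_proj linearP. Qed.

Fact tri_bracket_bilinear : bilinear_for *:%R *:%R tri_bracket.
Proof.
split=> d a u v; rewrite /tri_bracket -tri_proj_linear; congr tri_proj.
all: apply/ffunP => j; rewrite !ffunE tri_fun_linear.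
  exact: (scomm_bilinear S).1.
exact: (scomm_bilinear S).2.
Qed.

Definition triple (d0 d1 d2 : 'End(S)) : {ffun 'Z_3 -> 'End(S)} :=
  [ffun j => nth 0 [:: d0; d1; d2] (val j)].
Definition theta (d : {ffun 'Z_3 -> 'End(S)}) := triple (d 2) (d 0) (d 1).

Definition rmul (x : S) : 'End(S) := linfun (sflip (@smul k S) x).
Definition sigma (x y : S) : 'End(S) :=
  linfun (fun z : S => \sum_(a : bool) \sum_(c : bool) \sum_(d : bool)
    ((-1) ^+ (c && d) * b (hc a x) (hc d z) *: hc c y
     - (-1) ^+ (a && (c (+) d)) * b (hc c y) (hc d z) *: hc a x)).
Definition tri_t (x y : S) : {ffun 'Z_3 -> 'End(S)} :=
  triple (sigma x y)
         ((2^-1 * b x y) *: \1%VF - (rmul x \o @lmul S y)%VF)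
         ((2^-1 * b x y) *: \1%VF - (@lmul S x \o rmul y)%VF).

End Triality.

Section G.
Variables S S' : normed_superalgebra k.
Local Notation b := (@bform k S).
Local Notation b' := (@bform k S').

Definition g_superspace : superspace k :=
  prod_superspace (prod_superspace (tri S) (tri S'))
                  (pow3_superspace (tensor_superspace S S')).

(* The action of f (resp. f') on S (x) S' through the first (second) factor. *)
Definition actl (f : 'End(S)) (m : tensor S S') : tensor S S' :=
  tlift (fun x x' => tens (f x) x') m.
Definition actr (f : end_superspace S') (m : tensor S S') : tensor S S' :=
  tlift (fun x x' => \sum_(a : bool) \sum_(c : bool)
    (-1) ^+ (a && c) *: tens (hc c x) ((hc a f : 'End(S')) x')) m.

(* The components in tri(S) and tri(S') of [iota_i(m), iota_i(n)] for i = 0. *)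
Definition iota_tri (m n : tensor S S') : {ffun 'Z_3 -> 'End(S)} :=
  tlift2 (fun x x' y y' =>
    \sum_(a : bool) \sum_(a' : bool) \sum_(c : bool) \sum_(c' : bool)
      ((-1) ^+ (a && a') * (-1) ^+ (a && c') * (-1) ^+ (c && c') *
       b' (hc a' x') (hc c' y')) *: tri_t (hc a x) (hc c y)) m n.
Definition iota_tri' (m n : tensor S S') : {ffun 'Z_3 -> 'End(S')} :=
  tlift2 (fun x x' y y' =>
    \sum_(a : bool) \sum_(a' : bool) \sum_(c : bool) \sum_(c' : bool)
      ((-1) ^+ (c && a') * b (hc a x) (hc c y)) *: tri_t (hc a' x') (hc c' y')) m n.

(* The components in the iota_i of the brackets of tri(S) + tri(S') with the *)
(* iota_i, and of the brackets [iota_i(m), iota_{i+1}(n)], in this order; by *)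
(* super anticommutativity these determine the components of all brackets.   *)
Definition g_cross (X Y : g_superspace) : pow3_superspace (tensor_superspace S S') :=
  [ffun i : 'Z_3 => actl (tri_fun X.1.1 i) (Y.2 i) + actr (tri_fun X.1.2 i) (Y.2 i)
     + tensor_mul (X.2 (i - 2)) (Y.2 (i - 1))].

Definition g_bracket (X Y : g_superspace) : g_superspace :=
  ((tri_bracket X.1.1 Y.1.1
      + \sum_(i : 'Z_3) tri_proj (iter i (@theta S) (iota_tri (X.2 i) (Y.2 i))),
    tri_bracket X.1.2 Y.1.2
      + \sum_(i : 'Z_3) tri_proj (iter i (@theta S') (iota_tri' (X.2 i) (Y.2 i)))),
   g_cross X Y - sflip g_cross X Y).

Lemma theta_linear (T : normed_superalgebra k) n : linear (iter n (@theta T)).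
Proof.
elim: n => // n IHn a x y; rewrite /= IHn; apply/ffunP => j; rewrite !ffunE.
by case: j => -[|[|[|]]] //= lt3; rewrite !ffunE.
Qed.

Lemma actl_linear m : linear (fun f => actl f m).
Proof.
move=> a f h; apply: tlift_fun => x y.
by rewrite add_lfunE scale_lfunE (tens_bilinear S S').1.
Qed.

Lemma actr_linear m : linear (fun f => actr f m).
Proof.
move=> z f h; apply: tlift_fun => x y.
rewrite scaler_sumr -big_split; apply: eq_bigr => a _ /=.
rewrite scaler_sumr -big_split; apply: eq_bigr => c _ /=.
rewrite end_hc_linear add_lfunE scale_lfunE (tens_bilinear S S').2.
by rewrite scalerDr !scalerA mulrC.
Qed.

Fact g_cross_bilinear : bilinear_for *:%R *:%R g_cross.
Proof.
have add3 (a : k) (p q r p' q' r' : tensor S S') :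
  a *: p + p' + (a *: q + q') + (a *: r + r') = a *: (p + q + r) + (p' + q' + r').
  by rewrite !scalerDr [a *: p + p' + _]addrACA [LHS]addrACA.
split=> Z a X Y; apply/ffunP => i; rewrite ffunE [RHS]ffunE [X in _ = X + _]ffunE.
all: rewrite [X in _ = _ *: X + _]ffunE [X in _ = _ + X]ffunE.
all: have E1 := tri_fun_linear i a X.1.1 Y.1.1.
all: have E2 := tri_fun_linear i a X.1.2 Y.1.2.
all: have E3 j : (a *: X + Y).2 j = a *: X.2 j + Y.2 j by rewrite ffunE [X in X + _]ffunE.
  by rewrite [tri_fun _.1.1 i]E1 [tri_fun _.1.2 i]E2 E3 actl_linear actr_linear
    /tensor_mul (tlift2_bilinear _).1 add3.
by rewrite !E3 /actl /actr !tlift_linear /tensor_mul (tlift2_bilinear _).2 add3.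
Qed.

Fact g_bracket_bilinear : bilinear_for *:%R *:%R g_bracket.
Proof.
have [fl fr] := sflip_bilinear g_cross_bilinear.
have [cl cr] := g_cross_bilinear.
have [tl tr] := tri_bracket_bilinear S; have [tl' tr'] := tri_bracket_bilinear S'.
have add2 (U : lmodType k) (a : k) (p q p' q' : U) :
  a *: p + p' + (a *: q + q') = a *: (p + q) + (p' + q').
  by rewrite scalerDr addrACA.
have sub2 (U : lmodType k) (a : k) (p q p' q' : U) :
  a *: p + p' - (a *: q + q') = a *: (p - q) + (p' - q').
  by rewrite scalerBr opprD addrACA.
have sumP (U : lmodType k) a (F G : 'Z_3 -> U) :
  \sum_i (a *: F i + G i) = a *: (\sum_i F i) + \sum_i G i.
  by rewrite big_split -scaler_sumr.
split=> Z a X Y; congr ((_, _), _).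
all: have E3 j : (a *: X + Y).2 j = a *: X.2 j + Y.2 j by rewrite ffunE [X in X + _]ffunE.
- rewrite [tri_bracket _ _](tl _ a X.1.1 Y.1.1) -add2 -sumP; congr (_ + _).
  apply: eq_bigr => i _.
  by rewrite E3 /iota_tri /iota_tri' (tlift2_bilinear _).1 theta_linear tri_proj_linear.
- rewrite [tri_bracket _ _](tl' _ a X.1.2 Y.1.2) -add2 -sumP; congr (_ + _).
  apply: eq_bigr => i _.
  by rewrite E3 /iota_tri /iota_tri' (tlift2_bilinear _).1 theta_linear tri_proj_linear.
- by rewrite cl fl sub2.
- rewrite [tri_bracket _ _](tr _ a X.1.1 Y.1.1) -add2 -sumP; congr (_ + _).
  apply: eq_bigr => i _.
  by rewrite E3 /iota_tri /iota_tri' (tlift2_bilinear _).2 theta_linear tri_proj_linear.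
- rewrite [tri_bracket _ _](tr' _ a X.1.2 Y.1.2) -add2 -sumP; congr (_ + _).
  apply: eq_bigr => i _.
  by rewrite E3 /iota_tri /iota_tri' (tlift2_bilinear _).2 theta_linear tri_proj_linear.
- by rewrite cr fr sub2.
Qed.

Definition g_superalgebra : superalgebra k := @Superalgebra k g_superspace g_bracket g_bracket_bilinear.

End G.

(* k e + k x + k y, in coordinates (a, (b, c)) for a e + b x + c y.          *)
Section K3.
Definition K3_mul (u v : k^o * (k^o * k^o)) : k^o * (k^o * k^o) :=
  (u.1 * v.1 + (u.2.1 * v.2.2 - u.2.2 * v.2.1),
   (2^-1 * (u.1 * v.2.1 + u.2.1 * v.1), 2^-1 * (u.1 * v.2.2 + u.2.2 * v.1))).
Fact K3_mul_bilinear : bilinear_for *:%R *:%R K3_mul.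
Proof.
by split=> -[z0 [z1 z2]] a [x0 [x1 x2]] [y0 [y1 y2]]; congr (_, (_, _));
  rewrite /= /GRing.scale /=; ring.
Qed.
Definition K3 : superalgebra k :=
  @Superalgebra k (oe_superspace _ _) K3_mul K3_mul_bilinear.
Definition K9 : superalgebra k := tensor_superalgebra K3 K3.
End K3.

Section TKK.
Variable H : superalgebra k.

Definition Q0 : {vspace 'M[k]_2} := subspace (fun a : 'M[k]_2 => \tr a = 0).
Definition Q0_bracket (a b : subvs_of Q0) : subvs_of Q0 :=
  vsproj Q0 (vsval a *m vsval b - vsval b *m vsval a).
Definition polar_det (a b : 'M[k]_2) : k := \det (a + b) - \det a - \det b.

(* d is a derivation of degree i                                             *)
Definition in_der (i : bool) (d : end_superspace H) : Prop :=
  homog i d /\ forall (a c : bool) (x y : H), homog a x -> homog c y ->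
    d (smul x y) = smul (d x) y + (-1) ^+ (i && a) *: smul x (d y).

Fact in_der_subspace i : is_subspace (in_der i).
Proof.
have [ml mr] := smul_bilinear H.
have m0l x : smul (0 : H) x = 0.
  by have := ml x 1 0 0; rewrite /= !scale1r addr0 -{1}[smul 0 x]addr0 => /addrI.
have m0r x : smul x (0 : H) = 0.
  by have := mr x 1 0 0; rewrite /= !scale1r addr0 -{1}[smul x 0]addr0 => /addrI.
split=> [|z d d' [hd td] [hd' td']]; split=> [|u v x y hx hy].
- exact: hc0.
- by rewrite !zero_lfunE m0l m0r scaler0 addr0.
- by rewrite /homog hc_linear hd hd'.
rewrite !add_lfunE !scale_lfunE ml mr (td _ _ _ _ hx hy) (td' _ _ _ _ hx hy).
by rewrite !scalerDr !scalerA [z * _]mulrC addrACA.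
Qed.

Definition der : superspace k := sub_superspace in_der_subspace.
Definition der_fun (d : der) : 'End(H) := vsval d.
(* As for [tri_proj]: it is applied to brackets of derivations and to the    *)
(* d_{x,y}, which are derivations when H is a Jordan superalgebra.           *)
Definition der_proj (d : end_superspace H) : der := vsproj (sub_vspace in_der) d.
Definition der_bracket (d d' : der) : der := der_proj (scomm (der_fun d) (der_fun d')).

(* d_{x,y}                                                                   *)
Definition inner_der (x y : H) : end_superspace H := scomm (lmul x) (lmul y).

Local Notation Q0H := (tensor_superspace (even_superspace (subvs_of Q0)) H).
Definition tkk_superspace : superspace k := prod_superspace Q0H der.

Definition der_act (d : der) (m : Q0H) : Q0H :=
  tlift (fun a x => tens a (der_fun d x)) m.

(* The components of the bracket of Q0 (x) H in Q0 (x) H and in der H.       *)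
Definition tkk_mul : Q0H -> Q0H -> Q0H :=
  tlift2 (fun a x b y => tens (Q0_bracket a b) (smul x y)).
Definition tkk_der : Q0H -> Q0H -> end_superspace H :=
  tlift2 (fun (a : subvs_of Q0) x (b : subvs_of Q0) y =>
    - (2 * polar_det (vsval a) (vsval b)) *: inner_der x y).

Definition tkk_bracket (X Y : tkk_superspace) : tkk_superspace :=
  (tkk_mul X.1 Y.1 + (der_act X.2 Y.1 - sflip der_act X.1 Y.2),
   der_proj (tkk_der X.1 Y.1) + der_bracket X.2 Y.2).

Fact tkk_bracket_bilinear : bilinear_for *:%R *:%R tkk_bracket.
Proof.
have funL : linear der_fun by move=> a x y; rewrite /der_fun (linearP (@vsval _ _ _)).
have actB : bilinear_for *:%R *:%R der_act.
  split=> z a x y; last exact: tlift_linear.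
  apply: tlift_fun => u v; rewrite funL add_lfunE scale_lfunE.
  exact: (tens_bilinear _ _).2.
have [ml mr] : bilinear_for *:%R *:%R tkk_mul by exact: tlift2_bilinear.
have [dl dr] : bilinear_for *:%R *:%R tkk_der by exact: tlift2_bilinear.
have [al ar] := actB; have [fl fr] := sflip_bilinear actB.
have projL : linear der_proj by move=> a x y; rewrite /der_proj linearP.
have add2 (U : lmodType k) (a : k) (p q p' q' : U) :
  a *: p + p' + (a *: q + q') = a *: (p + q) + (p' + q').
  by rewrite scalerDr addrACA.
have sub2 (U : lmodType k) (a : k) (p q p' q' : U) :
  a *: p + p' - (a *: q + q') = a *: (p - q) + (p' - q').
  by rewrite scalerBr opprD addrACA.
have add3 (U : lmodType k) (a : k) (p q r p' q' r' : U) :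
  a *: p + p' + (a *: q + q' - (a *: r + r')) = a *: (p + (q - r)) + (p' + (q' - r')).
  by rewrite sub2 addrACA -scalerDr.
split=> Z a X Y; congr (_, _).
- by rewrite ml al fl add3.
- by rewrite dl /der_bracket funL (scomm_bilinear H).1 !projL add2.
- by rewrite mr ar fr add3.
- by rewrite dr /der_bracket funL (scomm_bilinear H).2 !projL add2.
Qed.

Definition tkk_superalgebra : superalgebra k :=
  @Superalgebra k tkk_superspace tkk_bracket tkk_bracket_bilinear.
End TKK.
End Algebras.

(* Main.v *)
Require Import Defs.
From mathcomp Require Import all_boot all_order all_algebra.
From mathcomp Require Import boolp ring.

Set Implicit Arguments.
Unset Strict Implicit.
Unset Printing Implicit Defensive.

Import GRing.Theory.
Local Open Scope ring_scope.

(** In characteristic 3 the para-Hurwitz superalgebra S = S_{1,2} is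
    supercommutative and 1/2 = -1.  The composition identity says that left
    multiplications are Clifford operators, L_x L_y + (-1)^{xy} L_y L_x = b(x,y),
    and three things follow.

    - All components of t_{x,y} are equal to sigma_{x,y} = [L_x, L_y], which is a
      derivation; in fact tri(S) = {(d,d,d) : d in der S} (S12_tri_diagonal).  So the
      action of tri(S) + tri(S) on each of the three copies of S (x) S is that of
      der S + der S on the superalgebra A = S (x) S.

    - For z in S put B = b(x,y) z and T = [L_x, L_y] z.  Then x(yz) and
      (-1)^{xy} y(xz) are -(B + T) and -(B - T), so that in A the commutator
      [L_{x(x)x'}, L_{y(x)y'}] sends z (x) z' to a combination of B (x) T' and
      T (x) B' alone.  It is, up to sign, the bracket
      [iota_i(x(x)x'), iota_i(y(x)y')] of g(S,S) (inner_iota).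

    - 1 is not a unit of S but 1 (x) 1 acts on A as the parity operator.  Hence an odd
      derivation D of A is the inner one given by D(1(x)1) and 1(x)1, an even one
      kills 1(x)1 and preserves S (x) 1 and 1 (x) S, and der A = der S + der S
      (S12_der_surj, S12_der_inj).

    On the other side, the trace zero 2 by 2 matrices have a basis of quaternion
    units a_0, a_1, a_2.  As -2 = 1, they satisfy [a_i, a_{i+1}] = a_{i+2}, and they are
    orthogonal with b_q(a_i, a_i) = 2, so that -2 b_q(a_i, a_i) = -1.  Therefore
    sending iota_i(m) to a_i (x) m, and (d, d') to d (x) 1 + 1 (x) d', is an
    isomorphism from g(S,S) onto the Tits-Kantor-Koecher superalgebra of A
    (g_tkk_iso).  Finally S is K_3, with 1 for e and a symplectic basis of V
    for x, y (S12_K3): A is K_9, and the Tits-Kantor-Koecher construction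
    respects isomorphisms (tkk_iso). *)

(** * Linear maps, degrees and tensors *)

Section LinearMaps.
Variable k : fieldType.

Section Lin.
Variables (U W : lmodType k) (f : U -> W).
Hypothesis fL : linear f.
Lemma lin_add x y : f (x + y) = f x + f y.
Proof. by have := fL 1 x y; rewrite !scale1r. Qed.
Lemma lin_zero : f 0 = 0.
Proof. by have := lin_add 0 0; rewrite addr0 -{1}[f 0]addr0 => /addrI. Qed.
Lemma lin_scale a x : f (a *: x) = a *: f x.
Proof. by have := fL a x 0; rewrite !addr0 lin_zero addr0. Qed.
Lemma lin_opp x : f (- x) = - f x.
Proof. by rewrite -scaleN1r lin_scale scaleN1r. Qed.
Lemma lin_bigsum (I : finType) (F : I -> U) : f (\sum_i F i) = \sum_i f (F i).
Proof. exact: (big_morph f lin_add lin_zero). Qed.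
End Lin.

Lemma lin_lfun (U V : vectType k) (f : 'Hom(U, V)) : linear f.
Proof. by move=> a x y; rewrite linearP. Qed.
Lemma lin_addf (U V : lmodType k) (f g : U -> V) :
  linear f -> linear g -> linear (fun x => f x + g x).
Proof. by move=> fL gL a x y; rewrite fL gL scalerDr addrACA. Qed.
Lemma lin_scalef (U V : lmodType k) c (f : U -> V) :
  linear f -> linear (fun x => c *: f x).
Proof. by move=> fL a x y; rewrite fL scalerDr !scalerA mulrC. Qed.
Lemma lin_sumf (U V : lmodType k) (I : finType) (F : I -> U -> V) :
  (forall i, linear (F i)) -> linear (fun x => \sum_i F i x).
Proof.
by move=> fL a x y; rewrite scaler_sumr -big_split; apply: eq_bigr => i _; apply: fL.
Qed.

(** Through coordinates, an identity between vectors becomes one between scalars,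
    which [ring] can decide. *)
Lemma coord_eq (V : vectType k) (x y : V) :
  (forall i, coord (vbasis {:V}) i x = coord (vbasis {:V}) i y) -> x = y.
Proof.
move=> e; rewrite (coord_vbasis (memvf x)) (coord_vbasis (memvf y)).
by apply: eq_bigr => i _; rewrite e.
Qed.

Lemma lin_surj_bij (U V : lmodType k) (f : U -> V) : linear f ->
  (forall x, f x = 0 -> x = 0) -> (forall y, exists x, f x = y) -> bijective f.
Proof.
move=> fL f0 fS.
have finj : injective f.
  by move=> x y e; apply/subr0_eq/f0; rewrite lin_add // lin_opp // e subrr.
exists (fun y => projT1 (cid (fS y))) => [x|y]; last exact: projT2 (cid (fS y)).
by apply: finj; apply: projT2 (cid (fS (f x))).
Qed.

End LinearMaps.

Section Homogeneous.
Variable k : fieldType.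
Implicit Types V W : superspace k.

Lemma homog_hc V a (x : V) : homog a (hc a x).
Proof. by rewrite /homog hcK eqxx. Qed.

Lemma hc_homog V p a (x : V) : homog p x -> hc a x = if a == p then x else 0.
Proof. by move=> <-; rewrite hcK; case: eqP => // ->. Qed.

Lemma homog0 V a : homog a (0 : V).
Proof. exact: hc0. Qed.

Lemma homogP V a c (x y : V) : homog a x -> homog a y -> homog a (c *: x + y).
Proof. by rewrite /homog hc_linear => -> ->. Qed.

Lemma homogZ V a c (x : V) : homog a x -> homog a (c *: x).
Proof. by move=> hx; rewrite -[c *: x]addr0; apply: homogP => //; apply: homog0. Qed.

Lemma homog_ext V (U : lmodType k) (f g : V -> U) : linear f -> linear g ->
  (forall a x, homog a x -> f x = g x) -> f =1 g.
Proof.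
move=> fL gL e x; rewrite -(hc_sum x) (lin_add fL) (lin_add gL).
by rewrite !(e _ _ (homog_hc _ _)).
Qed.

(** The degree of an endomorphism is defined by a projection of End(V); this is the
    usual description as the shift of degrees. *)
Lemma endhomogP V i (f : end_superspace V) :
  homog i f <-> forall a x, homog a x -> homog (a (+) i) ((f : 'End(V)) x).
Proof.
split=> [<- a x hx|h].
  rewrite [hc i f x]end_hcE sum_bool !(hc_homog _ hx).
  by case: a {hx} => /=; rewrite !linear0 hc0 ?addr0 ?add0r; apply: homog_hc.
apply/lfunP; apply: homog_ext => [||a x hx]; try exact: lin_lfun.
rewrite [hc i f x]end_hcE sum_bool !(hc_homog _ hx).
by case: a hx => hx /=; rewrite !linear0 hc0 ?addr0 ?add0r; exact: (h _ _ hx).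
Qed.

Lemma scomm_homog V a b (f g : end_superspace V) : homog a f -> homog b g ->
  scomm f g = ((f : 'End(V)) \o g)%VF - (-1) ^+ (a && b) *: ((g : 'End(V)) \o f)%VF.
Proof.
move=> hf hg; rewrite /scomm !sum_bool !(hc_homog _ hf) !(hc_homog _ hg).
case: a hf => hf; case: b hg => hg /=;
  by rewrite ?comp_lfun0l ?comp_lfun0r ?scaler0 ?subr0 ?addr0 ?add0r.
Qed.

Lemma scommE V a b (f g : end_superspace V) x : homog a f -> homog b g ->
  (scomm f g : 'End(V)) x =
    (f : 'End(V)) ((g : 'End(V)) x) - (-1) ^+ (a && b) *: (g : 'End(V)) ((f : 'End(V)) x).
Proof.
move=> hf hg; rewrite (scomm_homog hf hg).
by rewrite add_lfunE opp_lfunE scale_lfunE !comp_lfunE.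
Qed.

Lemma sflip_homog V W (U : vectType k) (f : V -> W -> U) a b x y :
  bilinear_for *:%R *:%R f -> homog a x -> homog b y ->
  sflip f y x = (-1) ^+ (a && b) *: f x y.
Proof.
move=> [fl fr] hx hy; rewrite /sflip !sum_bool !(hc_homog _ hx) !(hc_homog _ hy).
have f0r z : f z 0 = 0 := lin_zero (fr z).
have f0l z : f 0 z = 0 := lin_zero (fl z).
case: a hx => hx; case: b hy => hy /=;
  by rewrite ?f0r ?f0l ?scaler0 ?subr0 ?addr0 ?add0r.
Qed.

Lemma bilin_homog_ext (V W : superspace k) (U : vectType k) (F G : V -> W -> U) :
  bilinear_for *:%R *:%R F -> bilinear_for *:%R *:%R G ->
  (forall a b x y, homog a x -> homog b y -> F x y = G x y) ->
  forall x y, F x y = G x y.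
Proof.
move=> [Fl Fr] [Gl Gr] e x y.
apply: (homog_ext (f := F^~ y) (g := G^~ y)); [exact: Fl | exact: Gl |].
move=> a {}x hx; apply: (homog_ext (f := F x) (g := G x)); [exact: Fr | exact: Gr |].
by move=> b {}y hy; apply: e hx hy.
Qed.

(** Two linear maps which agree on the pure tensors of degree [a] agree on every
    tensor of degree [a]: a homogeneous tensor is a sum of pure homogeneous ones. *)
Lemma tens_homog_ext V W (U : vectType k) a (f g : tensor V W -> U) : linear f -> linear g ->
  (forall p q x y, homog p x -> homog q y -> p (+) q = a -> f (tens x y) = g (tens x y)) ->
  forall m : tensor_superspace V W, homog a m -> f m = g m.
Proof.
move=> fL gL e m <-.
move: m; apply: (@tens_ext _ _ _ _ (fun m => f (hc a (m : tensor_superspace V W)))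
                  (fun m => g (hc a (m : tensor_superspace V W)))).
- by move=> c x y; rewrite hc_linear fL.
- by move=> c x y; rewrite hc_linear gL.
move=> x y; rewrite [hc a _]tensor_hc_tens sum_bool (lin_add fL) (lin_add gL).
by congr (_ + _); apply: (e _ _ _ _ (homog_hc _ _) (homog_hc _ _)); case: (a).
Qed.

Lemma tens_ext_homog V W (U : vectType k) (f g : tensor V W -> U) : linear f -> linear g ->
  (forall p q x y, homog p x -> homog q y -> f (tens x y) = g (tens x y)) -> f =1 g.
Proof.
move=> fL gL e; apply: (@homog_ext (tensor_superspace V W)) => // a.
by apply: tens_homog_ext => // p q x y hx hy _; apply: e hx hy.
Qed.

(** Membership in a subspace is the linear equation v = proj v, so that it too can be
    checked on pure homogeneous tensors. *)
Lemma tens_mem (V W : superspace k) (U : vectType k) (X : {vspace U})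
    (f : tensor V W -> U) : linear f ->
  (forall p q x y, homog p x -> homog q y -> f (tens x y) \in X) ->
  forall m, f m \in X.
Proof.
move=> fL fX m.
have -> : f m = vsval (vsproj X (f m)) by
  apply: (tens_ext_homog (f := f) (g := fun m => vsval (vsproj X (f m)))) => // [a u v|p q x y hx hy];
  [rewrite fL !linearP | rewrite vsprojK //; apply: (fX p q)].
exact: subvsP.
Qed.

Lemma homog_tens V W p q (x : V) (y : W) : homog p x -> homog q y ->
  homog (V := tensor_superspace V W) (p (+) q) (tens x y).
Proof.
move=> hx hy; rewrite /homog [hc _ _]tensor_hc_tens sum_bool !(hc_homog _ hx) !(hc_homog _ hy).
by case: p hx => hx; case: q hy => hy /=; rewrite ?tens0l ?tens0r ?addr0 ?add0r.
Qed.

End Homogeneous.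

Section BilinearMaps.
Variable k : fieldType.
Lemma tensZl (V W : vectType k) c (x : V) (y : W) : tens (c *: x) y = c *: tens x y.
Proof. exact: (lin_scale ((tens_bilinear V W).1 y)). Qed.
Lemma tensZr (V W : vectType k) c (x : V) (y : W) : tens x (c *: y) = c *: tens x y.
Proof. exact: (lin_scale ((tens_bilinear V W).2 x)). Qed.
Lemma tensNl (V W : vectType k) (x : V) (y : W) : tens (- x) y = - tens x y.
Proof. exact: (lin_opp ((tens_bilinear V W).1 y)). Qed.
Lemma tensNr (V W : vectType k) (x : V) (y : W) : tens x (- y) = - tens x y.
Proof. exact: (lin_opp ((tens_bilinear V W).2 x)). Qed.
Lemma lin_tensl (V W : vectType k) (y : W) : linear (fun x : V => tens x y).
Proof. exact: (tens_bilinear V W).1. Qed.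
Lemma lin_tensr (V W : vectType k) (x : V) : linear (fun y : W => tens x y).
Proof. exact: (tens_bilinear V W).2. Qed.

Lemma tlift2_tens (V W V' W' U : vectType k) (F : V -> W -> V' -> W' -> U) x x' y y' :
  (forall y y', bilinear_for *:%R *:%R (fun x x' => F x x' y y')) ->
  (forall x x', bilinear_for *:%R *:%R (F x x')) ->
  tlift2 F (tens x x') (tens y y') = F x x' y y'.
Proof.
move=> F1 F2; rewrite /tlift2 tlift_tens; first exact: tlift_tens.
split=> z c u v /=; apply: tlift_fun => w w'; first exact: (F1 w w').1.
exact: (F1 w w').2.
Qed.

Lemma bilin_sum (V W U : vectType k) (I : finType) (F : I -> V -> W -> U) :
  (forall i, bilinear_for *:%R *:%R (F i)) ->
  bilinear_for *:%R *:%R (fun x y => \sum_i F i x y).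
Proof.
move=> h; split=> z; apply: lin_sumf => i; [exact: (h i).1 | exact: (h i).2].
Qed.
Lemma bilin_scale (V W U : vectType k) c (F : V -> W -> U) :
  bilinear_for *:%R *:%R F -> bilinear_for *:%R *:%R (fun x y => c *: F x y).
Proof. by move=> [l r]; split=> z; apply: lin_scalef; [exact: l | exact: r]. Qed.
Lemma bilin_comp (V W V' W' U : vectType k) (F : V -> W -> U) (g : V' -> V) (h : W' -> W) :
  bilinear_for *:%R *:%R F -> linear g -> linear h ->
  bilinear_for *:%R *:%R (fun x y => F (g x) (h y)).
Proof. by move=> [l r] gL hL; split=> z a x y; rewrite /= ?gL ?hL; [exact: l | exact: r]. Qed.
Lemma bilin_post (V W U U' : vectType k) (F : V -> W -> U) (g : U -> U') :
  bilinear_for *:%R *:%R F -> linear g ->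
  bilinear_for *:%R *:%R (fun x y => g (F x y)).
Proof. by move=> [l r] gL; split=> z a x y; rewrite /= -gL; congr g; [exact: l | exact: r]. Qed.
Lemma bilin_scalel (V W U : vectType k) s (f : V -> k) (T : W -> U) :
  linear (f : V -> k^o) -> linear T ->
  bilinear_for *:%R *:%R (fun x y => (s * f x) *: T y).
Proof.
move=> fL TL; split=> z c x y /=; apply: coord_eq => l.
  by rewrite fL !linearE /= /GRing.scale /=; ring.
by rewrite TL !linearE /=; ring.
Qed.

Lemma bilin_scaler (V W U : vectType k) s (f : W -> k) (T : V -> U) :
  linear (f : W -> k^o) -> linear T ->
  bilinear_for *:%R *:%R (fun x y => (s * f y) *: T x).
Proof. by move=> fL TL; have [l r] := bilin_scalel s fL TL; split. Qed.

End BilinearMaps.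

(** * Derivations of a tensor product *)

Section Derivations.
Variables (k : fieldType) (A : superalgebra k).

Lemma lin_mull (y : A) : linear (fun x : A => smul x y).
Proof. exact: (smul_bilinear A).1. Qed.
Lemma lin_mulr (x : A) : linear (smul x).
Proof. exact: (smul_bilinear A).2. Qed.
Lemma mul0s (y : A) : smul 0 y = 0. Proof. exact: lin_zero (lin_mull y). Qed.
Lemma muls0 (x : A) : smul x 0 = 0. Proof. exact: lin_zero (lin_mulr x). Qed.
Lemma mulDs (x y z : A) : smul (x + y) z = smul x z + smul y z.
Proof. exact: (lin_add (lin_mull z)). Qed.
Lemma mulsD (x y z : A) : smul x (y + z) = smul x y + smul x z.
Proof. exact: (lin_add (lin_mulr x)). Qed.
Lemma mulZs c (x y : A) : smul (c *: x) y = c *: smul x y.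
Proof. exact: (lin_scale (lin_mull y)). Qed.
Lemma mulsZ c (x y : A) : smul x (c *: y) = c *: smul x y.
Proof. exact: (lin_scale (lin_mulr x)). Qed.
Lemma mulNs (x y : A) : smul (- x) y = - smul x y.
Proof. exact: (lin_opp (lin_mull y)). Qed.
Lemma mulsN (x y : A) : smul x (- y) = - smul x y.
Proof. exact: (lin_opp (lin_mulr x)). Qed.

Definition graded := forall a c (x y : A),
  homog a x -> homog c y -> homog (a (+) c) (smul x y).

Definition supercomm := forall a c (x y : A),
  homog a x -> homog c y -> smul x y = (-1) ^+ (a && c) *: smul y x.

(** The operators underlying [der A], as a subspace of End(A): computations there do
    not meet the projections that define the brackets of [der A]. *)
Definition derv := sub_vspace (@in_der k A).

Lemma dervP (D : end_superspace A) : D \in derv <-> forall i, in_der i (hc i D).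
Proof. exact: (sub_vspaceP (@in_der_subspace k A)). Qed.

Lemma in_der_derv i (D : end_superspace A) : in_der i D -> (D : 'End(A)) \in derv.
Proof.
move=> h; apply/dervP => j; rewrite (hc_homog _ h.1).
by case: eqP => [->|_] //; apply: (in_der_subspace _ _).1.
Qed.

Lemma derv_hc i (D : end_superspace A) : (D : 'End(A)) \in derv -> in_der i (hc i D).
Proof. by move=> dD; apply: (dervP D).1. Qed.

Lemma in_der_scomm i j (f g : end_superspace A) :
  in_der i f -> in_der j g -> in_der (i (+) j) (scomm f g).
Proof.
move=> [hf df] [hg dg]; split.
  apply/endhomogP => a x hx; rewrite !(scommE _ hf hg).
  rewrite addrC -scaleNr; apply: homogP.
    by rewrite addbA; apply: (endhomogP j g).1 => //; apply: (endhomogP i f).1.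
  by rewrite [i (+) j]addbC addbA; apply: (endhomogP i f).1 => //; apply: (endhomogP j g).1.
move=> a c x y hx hy.
rewrite !(scommE _ hf hg).
have hfx := (endhomogP i f).1 hf _ _ hx; have hgx := (endhomogP j g).1 hg _ _ hx.
rewrite (dg _ _ _ _ hx hy) (df _ _ _ _ hx hy) !linearD !linearZ /=.
rewrite (df _ _ _ _ hgx hy) (df _ _ _ _ hx ((endhomogP j g).1 hg _ _ hy)).
rewrite (dg _ _ _ _ hfx hy) (dg _ _ _ _ hx ((endhomogP i f).1 hf _ _ hy)).
rewrite !(mulDs, mulsD, mulNs, mulsN, mulZs, mulsZ).
apply: coord_eq => l; rewrite !linearE /=.
by case: i {hf df hfx}; case: j {hg dg hgx}; case: a {hx} => /=; ring.
Qed.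

Lemma scomm_derv (f g : end_superspace A) : (f : 'End(A)) \in derv ->
  (g : 'End(A)) \in derv -> (scomm f g : 'End(A)) \in derv.
Proof.
move=> df dg; rewrite -(hc_sum f) -(hc_sum g).
rewrite (lin_add ((scomm_bilinear A).1 _)) !(lin_add ((scomm_bilinear A).2 _)).
by rewrite !memvD //; apply: in_der_derv; apply: in_der_scomm; apply: derv_hc.
Qed.

Lemma der_funK (D : 'End(A)) : D \in derv -> der_fun (der_proj (D : end_superspace A)) = D.
Proof. by move=> hD; rewrite /der_fun vsprojK. Qed.

Lemma der_fun_derv (d : der A) : der_fun d \in derv.
Proof. exact: subvsP. Qed.

Lemma lmulE (x y : A) : lmul x y = smul x y.
Proof. by rewrite /lmul linfunE_lin //; exact: lin_mulr. Qed.

Lemma lmul_homog a (x : A) : graded -> homog a x -> homog (V := end_superspace A) a (lmul x).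
Proof.
move=> gA hx; apply/endhomogP => q u hu; rewrite lmulE addbC; exact: gA.
Qed.

Lemma innerE a c (x y z : A) : graded -> homog a x -> homog c y ->
  (inner_der x y : 'End(A)) z = smul x (smul y z) - (-1) ^+ (a && c) *: smul y (smul x z).
Proof.
by move=> gA hx hy; rewrite (scommE _ (lmul_homog gA hx) (lmul_homog gA hy)) !lmulE.
Qed.

Lemma inner_homog a c (x y : A) : graded -> homog a x -> homog c y ->
  homog (a (+) c) (inner_der x y).
Proof.
move=> gA hx hy; apply/endhomogP => p z hz; rewrite (innerE _ gA hx hy) addrC -scaleNr.
apply: homogP.
  by rewrite addbC -addbA addbCA; apply: (gA) => //; apply: gA.
by rewrite addbC -addbA; apply: (gA) => //; apply: gA.
Qed.

End Derivations.

Section TensorAlgebra.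
Variables (k : fieldType) (S S' : superalgebra k).
Local Notation A := (tensor_superalgebra S S').

Lemma tensor_mulE a b (x y : S) (x' y' : S') : homog a x' -> homog b y ->
  smul (tens x x' : A) (tens y y') = (-1) ^+ (a && b) *: tens (smul x y) (smul x' y').
Proof.
move=> hx hy; rewrite /= /tensor_mul tlift2_tens.
- rewrite !sum_bool !(hc_homog _ hx) !(hc_homog _ hy).
  by case: a {hx}; case: b {hy} => /=;
    rewrite ?muls0 ?mul0s ?tens0l ?tens0r ?scaler0 ?addr0 ?add0r.
- move=> v v'; apply: bilin_sum => p; apply: bilin_sum => q; apply: bilin_scale.
  apply: (@bilin_comp k S S' S S' _ (@tens k S S') (fun u => smul u (hc q v))
    (fun u => smul (hc p u) v')); first exact: tens_bilinear.
  + exact: lin_mull.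
  + by move=> c u w; rewrite hc_linear lin_mull.
- move=> u u'; apply: bilin_sum => p; apply: bilin_sum => q; apply: bilin_scale.
  apply: (@bilin_comp k S S' S S' _ (@tens k S S') (fun v => smul u (hc q v))
    (fun v => smul (hc p u') v)); first exact: tens_bilinear.
  + by move=> c v w; rewrite hc_linear lin_mulr.
  + exact: lin_mulr.
Qed.

Lemma tensor_graded : graded S -> graded S' -> graded A.
Proof.
move=> gS gS' a c X Y hX hY; rewrite /homog.
move: X hX; apply: (tens_homog_ext (f := fun X => hc (a (+) c) (smul (X : A) Y))
  (g := fun X => smul (X : A) Y)).
- by move=> z u v; rewrite lin_mull hc_linear.
- exact: (@lin_mull k A).
move=> p p' x x' hx hx' <-; move: Y hY.
apply: (tens_homog_ext (f := fun Y => hc _ (smul (tens x x' : A) Y))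
  (g := fun Y => smul (tens x x' : A) Y)).
- by move=> z u v; rewrite lin_mulr hc_linear.
- exact: (@lin_mulr k A).
move=> q q' y y' hy hy' <-; rewrite (tensor_mulE _ _ hx' hy) addbACA.
by apply/(@homogZ _ A)/homog_tens; [apply: gS | apply: gS'].
Qed.

Lemma tensor_supercomm : supercomm S -> supercomm S' -> supercomm A.
Proof.
move=> cS cS' a c X Y hX hY.
move: X hX; apply: (tens_homog_ext (f := fun X => (smul (X : A) Y))
  (g := fun X => _ *: smul Y (X : A))).
- exact: (@lin_mull k A).
- by apply: lin_scalef; apply: (@lin_mulr k A).
move=> p p' x x' hx hx' <-; move: Y hY.
apply: (tens_homog_ext (f := fun Y => (smul (tens x x' : A) Y))
  (g := fun Y => (-1) ^+ ((p (+) p') && c) *: smul (Y : A) (tens x x'))).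
- exact: (@lin_mulr k A).
- by apply: lin_scalef; apply: (@lin_mull k A).
move=> q q' y y' hy hy' <-; rewrite (tensor_mulE _ _ hx' hy) (tensor_mulE _ _ hy' hx).
rewrite (cS _ _ _ _ hx hy) (cS' _ _ _ _ hx' hy') tensZl tensZr !scalerA; congr (_ *: _).
by case: p {hx}; case: p' {hx'}; case: q {hy}; case: q' {hy'} => /=; ring.
Qed.

(** The Leibniz rule is linear in each factor once the degree of the first one, which
    governs the sign, is fixed. *)
Lemma in_der_tensor i (D : end_superspace A) : homog i D ->
  (forall p p' q q' (x : S) (x' : S') y y', homog p x -> homog p' x' -> homog q y -> homog q' y' ->
    (D : 'End(A)) (smul (tens x x' : A) (tens y y')) =
      smul ((D : 'End(A)) (tens x x') : A) (tens y y') +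
      (-1) ^+ (i && (p (+) p')) *: smul (tens x x' : A) ((D : 'End(A)) (tens y y'))) ->
  in_der i D.
Proof.
move=> hD dD; split=> // a c X Y hX hY.
move: X hX; apply: (tens_homog_ext (f := fun X => (D : 'End(A)) (smul (X : A) Y))
  (g := fun X => smul ((D : 'End(A)) X : A) Y + _ *: smul (X : A) ((D : 'End(A)) Y))).
- by move=> z u v; rewrite lin_mull linearP.
- apply: lin_addf; first by move=> z u v; rewrite linearP lin_mull.
  by apply: lin_scalef; apply: (@lin_mull k A).
move=> p p' x x' hx hx' <-; move: Y hY.
apply: (tens_homog_ext (f := fun Y => (D : 'End(A)) (smul (tens x x' : A) Y))
  (g := fun Y => smul ((D : 'End(A)) (tens x x') : A) Y
           + _ *: smul (tens x x' : A) ((D : 'End(A)) Y))).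
- by move=> z u v; rewrite lin_mulr linearP.
- apply: lin_addf; first exact: (@lin_mulr k A).
  by apply: lin_scalef => z u v; rewrite linearP lin_mulr.
by move=> q q' y y' hy hy' _; apply: (dD _ _ q q').
Qed.

End TensorAlgebra.

Section TensorDerivations.
Variables (k : fieldType) (S S' : normed_superalgebra k).
Local Notation A := (tensor_superalgebra S S').

(** The operators f (x) 1 and 1 (x) f on S (x) S', the second one with the sign rule. *)
Definition Actl (f : 'End(S)) : 'End(A) := linfun (actl f : A -> A).
Definition Actr (f : 'End(S')) : 'End(A) :=
  linfun (actr (f : end_superspace S') : A -> A).

Lemma ActlE f x x' : Actl f (tens x x') = tens (f x) x'.
Proof.
rewrite /Actl linfunE_lin; last exact: tlift_linear.
rewrite /actl tlift_tens //; apply: (bilin_comp (h := id) (g := f)) => //.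
  exact: tens_bilinear.
exact: lin_lfun.
Qed.

Lemma ActrE a c (f : end_superspace S') (x : S) x' : homog a f -> homog c x ->
  Actr f (tens x x') = (-1) ^+ (a && c) *: tens x ((f : 'End(S')) x').
Proof.
move=> hf hx; rewrite /Actr linfunE_lin; last exact: tlift_linear.
rewrite /actr tlift_tens.
  rewrite !sum_bool !(hc_homog _ hf) !(hc_homog _ hx).
  by case: a {hf}; case: c {hx} => /=;
    rewrite ?tens0l ?zero_lfunE ?tens0r ?scaler0 ?addr0 ?add0r.
apply: bilin_sum => p; apply: bilin_sum => q; apply: bilin_scale.
apply: (@bilin_comp k S S' S S' _ (@tens k S S')); first exact: tens_bilinear.
  exact: hc_linear.
exact: lin_lfun.
Qed.

Lemma Actl_linear : linear Actl.
Proof.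
move=> a f g; apply/lfunP => x; rewrite add_lfunE scale_lfunE /Actl !linfunE_lin //;
  try exact: tlift_linear.
exact: actl_linear.
Qed.

Lemma Actr_linear : linear Actr.
Proof.
move=> a f g; apply/lfunP => x; rewrite add_lfunE scale_lfunE /Actr !linfunE_lin //;
  try exact: tlift_linear.
exact: actr_linear.
Qed.

Lemma Actl_homog i (f : end_superspace S) : homog i f ->
  homog (V := end_superspace A) i (Actl f).
Proof.
move=> hf; apply/endhomogP => a m; rewrite /homog.
apply: (tens_homog_ext (f := fun m => hc _ (Actl f m : A)) (g := fun m => Actl f m)).
- by move=> c u v; rewrite linearP hc_linear.
- exact: lin_lfun.
move=> p q x y hx hy <-; rewrite ActlE -addbA [q (+) i]addbC addbA.
by apply: homog_tens hy; apply: (endhomogP i f).1.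
Qed.

Lemma Actr_homog i (f : end_superspace S') : homog i f ->
  homog (V := end_superspace A) i (Actr f).
Proof.
move=> hf; apply/endhomogP => a m; rewrite /homog.
apply: (tens_homog_ext (f := fun m => hc _ (Actr f m : A)) (g := fun m => Actr f m)).
- by move=> c u v; rewrite linearP hc_linear.
- exact: lin_lfun.
move=> p q x y hx hy <-; rewrite (ActrE _ hf hx) -addbA.
by apply/(@homogZ _ A)/homog_tens => //; apply: (endhomogP i f).1.
Qed.

Lemma Actl_hc i (f : end_superspace S) :
  hc i (Actl f : end_superspace A) = Actl (hc i f).
Proof.
rewrite -{1}(hc_sum f) (lin_add Actl_linear) hcD.
rewrite !(hc_homog _ (Actl_homog (homog_hc _ _))).
by case: i; rewrite ?addr0 ?add0r.
Qed.

Lemma Actr_hc i (f : end_superspace S') :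
  hc i (Actr f : end_superspace A) = Actr (hc i f).
Proof.
rewrite -{1}(hc_sum f) (lin_add Actr_linear) hcD.
rewrite !(hc_homog _ (Actr_homog (homog_hc _ _))).
by case: i; rewrite ?addr0 ?add0r.
Qed.

Lemma Actl_in_der i (f : end_superspace S) : graded S -> in_der i f ->
  in_der (H := A) i (Actl f).
Proof.
move=> gS [hf df]; apply: in_der_tensor; first exact: Actl_homog.
move=> p p' q q' x x' y y' hx hx' hy hy'.
have hfy := (endhomogP i f).1 hf _ _ hy.
rewrite (tensor_mulE _ _ hx' hy) (lin_scale (lin_lfun _)) !ActlE (tensor_mulE _ _ hx' hy).
rewrite (tensor_mulE _ _ hx' hfy) (df _ _ _ _ hx hy) tensDl tensZl scalerDr !scalerA.
congr (_ + _ *: _).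
by case: p {hx}; case: i {hf df hfy}; case: p' {hx'}; case: q {hy} => /=; ring.
Qed.

Lemma Actr_in_der i (f : end_superspace S') : graded S -> in_der i f ->
  in_der (H := A) i (Actr f).
Proof.
move=> gS [hf df]; apply: in_der_tensor; first exact: Actr_homog.
move=> p p' q q' x x' y y' hx hx' hy hy'.
have hfx := (endhomogP i f).1 hf _ _ hx'.
rewrite (tensor_mulE _ _ hx' hy) (lin_scale (lin_lfun _)) (ActrE _ hf (gS _ _ _ _ hx hy)).
rewrite (ActrE _ hf hx) (ActrE _ hf hy) mulZs mulsZ.
rewrite (tensor_mulE _ _ hx' hy) (tensor_mulE _ _ hfx hy) (df _ _ _ _ hx' hy').
rewrite tensDr tensZr !scalerDr !scalerA; congr (_ *: _ + _ *: _).
  by case: i {hf df hfx}; case: p {hx}; case: p' {hx'}; case: q {hy} => /=; ring.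
by case: i {hf df hfx}; case: p {hx}; case: p' {hx'}; case: q {hy} => /=; ring.
Qed.

Lemma Actl_derv (f : 'End(S)) : graded S -> f \in derv S -> Actl f \in derv A.
Proof.
move=> gS df; apply/dervP => i; rewrite Actl_hc.
by apply: Actl_in_der gS (derv_hc i df).
Qed.

Lemma Actr_derv (f : 'End(S')) : graded S -> f \in derv S' -> Actr f \in derv A.
Proof.
move=> gS df; apply/dervP => i; rewrite Actr_hc.
by apply: Actr_in_der gS (derv_hc i df).
Qed.

Lemma Actl_comp (f g : 'End(S)) : Actl (f \o g)%VF = (Actl f \o Actl g)%VF.
Proof.
apply/lfunP; apply: tens_ext => [||x y]; try exact: lin_lfun.
by rewrite lfunE /= !ActlE lfunE.
Qed.

Lemma Actr_comp a b (f g : end_superspace S') : homog a f -> homog b g ->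
  Actr ((f : 'End(S')) \o g)%VF = (Actr f \o Actr g)%VF.
Proof.
move=> hf hg; apply/lfunP.
apply: tens_ext_homog => [||p q x y hx hy]; try exact: lin_lfun.
have hfg : homog (V := end_superspace S') (a (+) b) ((f : 'End(S')) \o g)%VF.
  apply/endhomogP => c z hz; rewrite lfunE /= [a (+) b]addbC addbA.
  by apply: (endhomogP _ _).1 hf _ _ _; apply: (endhomogP _ _).1 hg _ _ _.
rewrite lfunE /= (ActrE _ hfg hx) (ActrE _ hg hx) linearZ /= (ActrE _ hf hx) lfunE scalerA.
congr (_ *: _).
by case: p {hx}; case: a {hf hfg}; case: b {hg} => /=; ring.
Qed.

Lemma scomm_Actl (f g : end_superspace S) :
  scomm (Actl f : end_superspace A) (Actl g) = Actl (scomm f g).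
Proof.
apply: (@bilin_homog_ext k (end_superspace S) (end_superspace S) _ (fun f g => scomm (Actl f : end_superspace A) (Actl g))
   (fun f g => Actl (scomm (f : end_superspace S) g))).
- apply: (bilin_comp (g := Actl) (h := Actl)); [exact: scomm_bilinear | exact: Actl_linear..].
- apply: (bilin_post (g := Actl)); [exact: scomm_bilinear | exact: Actl_linear].
move=> a b {}f {}g hf hg.
rewrite (scomm_homog hf hg) (scomm_homog (Actl_homog hf) (Actl_homog hg)) -!Actl_comp.
by rewrite -!scaleNr addrC -[in RHS]addrC Actl_linear.
Qed.

Lemma scomm_Actr (f g : end_superspace S') :
  scomm (Actr f : end_superspace A) (Actr g) = Actr (scomm f g).
Proof.
apply: (@bilin_homog_ext k (end_superspace S') (end_superspace S') _ (fun f g => scomm (Actr f : end_superspace A) (Actr g))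
   (fun f g => Actr (scomm (f : end_superspace S') g))).
- apply: (bilin_comp (g := Actr) (h := Actr)); [exact: scomm_bilinear | exact: Actr_linear..].
- apply: (bilin_post (g := Actr)); [exact: scomm_bilinear | exact: Actr_linear].
move=> a b {}f {}g hf hg.
rewrite (scomm_homog hf hg) (scomm_homog (Actr_homog hf) (Actr_homog hg)).
rewrite -(Actr_comp hf hg) -(Actr_comp hg hf).
by rewrite -!scaleNr addrC -[in RHS]addrC Actr_linear.
Qed.

(** The sign in 1 (x) g exactly compensates that of the supercommutator. *)
Lemma scomm_Actlr (f : end_superspace S) (g : end_superspace S') :
  scomm (Actl f : end_superspace A) (Actr g) = 0.
Proof.
apply: (@bilin_homog_ext k (end_superspace S) (end_superspace S') _ (fun f g => scomm (Actl f : end_superspace A) (Actr g))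
   (fun f g => 0)).
- apply: (bilin_comp (g := Actl) (h := Actr)); [exact: scomm_bilinear | exact: Actl_linear |].
  exact: Actr_linear.
- by split=> z c x y; rewrite /= scaler0 addr0.
move=> a b {}f {}g hf hg.
apply/lfunP; apply: tens_ext_homog => [||p q x y hx hy]; try exact: lin_lfun.
rewrite (scommE _ (Actl_homog hf) (Actr_homog hg)) zero_lfunE !ActlE (ActrE _ hg hx).
rewrite (ActrE _ hg ((endhomogP _ _).1 hf _ _ hx)) linearZ /= ActlE.
apply: coord_eq => l; rewrite !linearE /=.
by case: p {hx}; case: a {hf}; case: b {hg} => /=; ring.
Qed.

Lemma scomm_Actrl (f : end_superspace S') (g : end_superspace S) :
  scomm (Actr f : end_superspace A) (Actl g) = 0.
Proof.
apply: (@bilin_homog_ext k (end_superspace S') (end_superspace S) _ (fun f g => scomm (Actr f : end_superspace A) (Actl g))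
   (fun f g => 0)).
- apply: (bilin_comp (g := Actr) (h := Actl)); [exact: scomm_bilinear | exact: Actr_linear |].
  exact: Actl_linear.
- by split=> z c x y; rewrite /= scaler0 addr0.
move=> a b {}f {}g hf hg.
have := scomm_Actlr g f.
rewrite (scomm_homog (Actl_homog hg) (Actr_homog hf)).
rewrite (scomm_homog (Actr_homog hf) (Actl_homog hg)) => /eqP; rewrite subr_eq0 => /eqP ->.
rewrite scalerA andbC -expr2 sqrr_sign scale1r subrr //.
Qed.

End TensorDerivations.

(** * Supercommutative composition superalgebras in characteristic 3 *)

Section Char3.
Variables (k : fieldType) (char3 : 3%N \in [pchar k]).

Lemma three0 : 3 = 0 :> k. Proof. exact: pcharf0 char3. Qed.

(** [ring] does not know the characteristic: the multiple of 3 by which the two sides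
    differ in characteristic 0 is supplied as [t]. *)
Lemma eq_mod3 (t x y : k) : x = y + 3 * t -> x = y.
Proof. by move=> ->; rewrite three0 mul0r addr0. Qed.

Lemma two_char3 : 2 = -1 :> k.
Proof. by apply: (eq_mod3 (t := 1)); ring. Qed.

Lemma half_char3 : 2^-1 = -1 :> k.
Proof. by rewrite two_char3 invrN invr1. Qed.

Lemma double_char3 (V : lmodType k) (x : V) : x + x = - x.
Proof. by rewrite -mulr2n -scaler_nat two_char3 scaleN1r. Qed.

Lemma neg_char3 (V : lmodType k) (x : V) : x = - x -> x = 0.
Proof. by move=> e; have := double_char3 x; rewrite {1}e addNr => /eqP; rewrite eq_sym oppr_eq0 => /eqP. Qed.

(** For a supercommutative product the composition identity
    (x y) z + (-1)^{xy+yz+zx} (z y) x = (-1)^{yz} b(x,z) y takes the form of the Clifford relation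
    [cc_clifford] between left multiplications. *)
Record comm_composition (S : normed_superalgebra k) : Prop := CommComposition {
  cc_graded : graded S;
  cc_comm : supercomm S;
  cc_clifford : forall a c (x y z : S), homog a x -> homog c y ->
    smul x (smul y z) + (-1) ^+ (a && c) *: smul y (smul x z) = bform x y *: z;
  cc_even : forall a c (x y : S), homog a x -> homog c y -> a != c -> bform x y = 0 }.

Section Composition.
Variables (S : normed_superalgebra k) (CS : comm_composition S).

Lemma bform_linl (y : S) : linear (fun x => bform x y : k^o).
Proof. exact: (bform_bilinear S).1. Qed.
Lemma bform_linr (x : S) : linear (fun y => bform x y : k^o).
Proof. exact: (bform_bilinear S).2. Qed.
Lemma bform0l (y : S) : bform 0 y = 0. Proof. exact: lin_zero (bform_linl y). Qed.
Lemma bform0r (x : S) : bform x 0 = 0. Proof. exact: lin_zero (bform_linr x). Qed.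

Lemma lmul_linear (A : superalgebra k) : linear (@lmul k A).
Proof.
move=> c x y; apply/lfunP => z; rewrite add_lfunE scale_lfunE !lmulE.
exact: lin_mull.
Qed.

Lemma inner_bilinear (A : superalgebra k) : bilinear_for *:%R *:%R (@inner_der k A).
Proof.
apply: (@bilin_comp _ _ _ _ _ _ (@scomm k A) (@lmul k A) (@lmul k A));
  [exact: scomm_bilinear | exact: lmul_linear..].
Qed.

Lemma rmul_lmul (x : S) : rmul x = lmul x.
Proof.
have fl := sflip_bilinear (smul_bilinear S).
apply/lfunP => y; rewrite lmulE /rmul linfunE_lin; last exact: fl.2.
apply: (bilin_homog_ext (F := sflip (@smul k S)) (G := @smul k S)) => //.
  exact: smul_bilinear.
move=> a c {}x {}y hx hy; rewrite (sflip_homog (smul_bilinear S) hy hx) andbC.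
by rewrite -(cc_comm CS hx hy).
Qed.

Lemma sigma_sum (x y z : S) : sigma x y z =
  \sum_(a : bool) \sum_(c : bool) \sum_(d : bool)
    ((-1) ^+ (c && d) * bform (hc a x) (hc d z) *: hc c y
     - (-1) ^+ (a && (c (+) d)) * bform (hc c y) (hc d z) *: hc a x).
Proof.
rewrite /sigma linfunE_lin // => t u v.
rewrite scaler_sumr -big_split; apply: eq_bigr => a _.
rewrite scaler_sumr -big_split; apply: eq_bigr => c _.
rewrite scaler_sumr -big_split; apply: eq_bigr => d _ /=.
rewrite hc_linear !(bform_bilinear S).2; apply: coord_eq => l; rewrite !linearE /=; ring.
Qed.

Lemma sigma_bilinear : bilinear_for *:%R *:%R (@sigma k S).
Proof.
split=> w t u v /=; apply/lfunP => z; rewrite add_lfunE scale_lfunE !sigma_sum;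
  rewrite scaler_sumr -big_split; apply: eq_bigr => a _;
  rewrite scaler_sumr -big_split; apply: eq_bigr => c _;
  rewrite scaler_sumr -big_split; apply: eq_bigr => d _ /=;
  rewrite !hc_linear ?(bform_bilinear S).1; apply: coord_eq => l; rewrite !linearE /=; ring.
Qed.

Lemma sigmaE a c d (x y z : S) : homog a x -> homog c y -> homog d z ->
  sigma x y z = (-1) ^+ (c && d) * bform x z *: y - (-1) ^+ (a && (c (+) d)) * bform y z *: x.
Proof.
move=> hx hy hz; rewrite sigma_sum !sum_bool !(hc_homog _ hx) !(hc_homog _ hy) !(hc_homog _ hz).
case: a {hx}; case: c {hy}; case: d {hz} => /=;
  by rewrite ?bform0l ?bform0r ?mulr0 ?scaler0 ?scale0r ?subr0 ?addr0 ?add0r.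
Qed.

Lemma inner_ccE a c (x y z : S) : homog a x -> homog c y ->
  (inner_der x y : 'End(S)) z = smul x (smul y z) - (-1) ^+ (a && c) *: smul y (smul x z).
Proof. exact: innerE (cc_graded CS). Qed.

Lemma cliffordE a c (x y z : S) : homog a x -> homog c y ->
  smul x (smul y z) = bform x y *: z - (-1) ^+ (a && c) *: smul y (smul x z).
Proof. by move=> hx hy; rewrite -(cc_clifford CS z hx hy) addrK. Qed.

(** Moving z to the front in x(yz) and in y(xz), the Clifford relation produces the terms
    b(x,z)y and b(y,z)x, and the remaining terms z(xy) and z(yx) cancel by commutativity. *)
Lemma sigma_inner : @sigma k S = @inner_der k S.
Proof.
apply/funext => x; apply/funext => y.
apply: (@bilin_homog_ext k S S _ (@sigma k S) (@inner_der k S)).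
- exact: sigma_bilinear.
- exact: inner_bilinear.
move=> a c {}x {}y hx hy; apply/lfunP.
apply: homog_ext => [||d z hz]; try exact: lin_lfun.
rewrite (sigmaE hx hy hz) (inner_ccE _ hx hy).
rewrite (cc_comm CS hy hz) mulsZ (cliffordE _ hx hz).
rewrite (cc_comm CS hx hz) mulsZ (cliffordE _ hy hz).
rewrite [smul y x](cc_comm CS hy hx) mulsZ.
apply: coord_eq => l; rewrite !linearE /=.
by case: a {hx}; case: c {hy}; case: d {hz} => /=; ring.
Qed.

(** With 1/2 = -1, the operator (1/2) b(x,y) - L_x L_y is -(L_x L_y + s L_y L_x) - L_x L_y where
    s = (-1)^{xy}, that is -2 L_x L_y - s L_y L_x, and -2 = 1. *)
Lemma tri_tE (x y : S) : tri_t x y = [ffun => inner_der x y].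
Proof.
have e : (2^-1 * bform x y) *: \1%VF - (lmul x \o lmul y)%VF = inner_der x y.
  apply: (@bilin_homog_ext k S S _
    (fun x y => (2^-1 * bform x y) *: \1%VF - (lmul x \o lmul y)%VF)
    (@inner_der k S)).
  - split=> z t u v /=; apply/lfunP => w.
      rewrite !(add_lfunE, opp_lfunE, scale_lfunE, comp_lfunE, id_lfunE, lmulE).
      rewrite (bform_bilinear S).1 lin_mull.
      by apply: coord_eq => l; rewrite !linearE /=; ring.
    rewrite !(add_lfunE, opp_lfunE, scale_lfunE, comp_lfunE, id_lfunE, lmulE).
    rewrite (bform_bilinear S).2 lin_mull lin_mulr.
    by apply: coord_eq => l; rewrite !linearE /=; ring.
  - exact: inner_bilinear.
  move=> a c {}x {}y hx hy; apply/lfunP => z.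
  rewrite !(add_lfunE, opp_lfunE, scale_lfunE, comp_lfunE, id_lfunE, lmulE) (inner_ccE _ hx hy).
  rewrite half_char3 mulN1r scaleNr -(cc_clifford CS z hx hy).
  apply: coord_eq => l; rewrite !linearE /=.
  by apply: (eq_mod3 (t := - coord (vbasis fullv) l (smul x (smul y z)))); ring.
rewrite /tri_t !rmul_lmul e sigma_inner; apply/ffunP => j; rewrite !ffunE.
by case: j => -[|[|[|]]].
Qed.

(** The Leibniz rule amounts to [[L_x, L_y], L_z] = L_{[L_x, L_y] z}.  The Clifford relation gives
    the left side as 2 (b(y,z) L_x - b(x,z) L_y) up to signs, and the formula for sigma
    gives the right side as -1 instead of 2 times the same operator. *)
Lemma inner_in_der a c (x y : S) : homog a x -> homog c y ->
  in_der (a (+) c) (inner_der x y).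
Proof.
move=> hx hy; have hD := inner_homog (cc_graded CS) hx hy.
split=> // p q z w hz hw.
rewrite -{2}sigma_inner (sigmaE hx hy hz) !(inner_ccE _ hx hy).
rewrite (cliffordE w hy hz) (cliffordE w hx hz).
rewrite !(mulsD, mulsN, mulsZ) (cliffordE _ hx hz) (cliffordE _ hy hz).
rewrite !(mulDs, mulNs, mulZs).
(* b(x,z) and b(y,z) vanish unless the degrees agree, which makes the signs match. *)
have e1 := cc_even CS hx hz; have e2 := cc_even CS hy hz.
apply: coord_eq => l; rewrite !(linearE, linearN) /=.
apply: (eq_mod3 (t := bform y z * coord (vbasis fullv) l (smul x w)
  - (-1) ^+ (c && p) * bform x z * coord (vbasis fullv) l (smul y w))).
by case: a e1 {hx hD} => e1; case: c e2 {hy} => e2; case: p e1 e2 {hz} => e1 e2 /=;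
  rewrite ?(e1 isT) ?(e2 isT); ring.
Qed.

Lemma inner_derv (x y : S) : (inner_der x y : 'End(S)) \in derv S.
Proof.
have [bl br] := inner_bilinear S.
rewrite -(hc_sum x) -(hc_sum y) (lin_add (bl _)) !(lin_add (br _)).
by rewrite !memvD //; apply: in_der_derv; apply: inner_in_der; apply: homog_hc.
Qed.

(** Apply D to the Clifford relation, and the relation again to the pairs (Dx, y) and (x, Dy):
    all that remains is the invariance of b times an arbitrary z. *)
Lemma der_osp i (D : end_superspace S) : (exists z : S, z != 0) -> in_der i D -> osp i D.
Proof.
move=> [z nz] [hD dD]; split=> // a c x y hx hy.
have hDx := (endhomogP i D).1 hD _ _ hx; have hDy := (endhomogP i D).1 hD _ _ hy.
suff: (bform ((D : 'End(S)) x) y + (-1) ^+ (i && a) * bform x ((D : 'End(S)) y)) *: z = 0.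
  by move/eqP; rewrite scaler_eq0 (negPf nz) orbF => /eqP.
clear nz.
move: z; have hP : linear (fun z : S =>
    (bform ((D : 'End(S)) x) y + (-1) ^+ (i && a) * bform x ((D : 'End(S)) y)) *: z).
  exact: lin_scalef.
have h0 : linear (fun z : S => 0 : S) by move=> t u v; rewrite scaler0 addr0.
apply: (homog_ext hP h0) => d z hz.
have := congr1 D (cc_clifford CS z hx hy).
rewrite (lin_add (lin_lfun _)) !(lin_scale (lin_lfun _)).
rewrite (dD _ _ _ _ hx (cc_graded CS hy hz)) (dD _ _ _ _ hy (cc_graded CS hx hz)).
rewrite (dD _ _ _ _ hx hz) (dD _ _ _ _ hy hz) !mulsD !mulsZ.
rewrite (cliffordE z hDx hy) (cliffordE z hx hDy) (cliffordE _ hx hy).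
have e := cc_even CS hx hy => /eqP; rewrite -subr_eq0 => /eqP h.
rewrite -[RHS]h; apply: coord_eq => l; rewrite !(linearE, linearN) /=.
clear - e; case: a e => e; case: c e => e; case: i => /=; rewrite ?(e isT); ring.
Qed.

End Composition.
End Char3.

(** * Inner derivations of a tensor product of composition superalgebras *)

Section CompositionTensor.
Variables (k : fieldType) (char3 : 3%N \in [pchar k]).
Variables (S S' : normed_superalgebra k).
Hypotheses (CS : comm_composition S) (CS' : comm_composition S').
Local Notation A := (tensor_superalgebra S S').

Lemma tri_t_bilinear (T : normed_superalgebra k) : comm_composition T ->
  bilinear_for *:%R *:%R (@tri_t k T).
Proof.
move=> CT; split=> z c x y /=; apply/ffunP => j.
  by rewrite !(tri_tE char3 CT) !ffunE (inner_bilinear T).1.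
by rewrite !(tri_tE char3 CT) !ffunE (inner_bilinear T).2.
Qed.

Lemma iota_triE a a' c c' x x' y y' :
  homog a x -> homog a' x' -> homog c y -> homog c' y' ->
  iota_tri (tens x x' : A) (tens y y') =
  ((-1) ^+ (a && a') * (-1) ^+ (a && c') * (-1) ^+ (c && c') * bform x' y')
     *: [ffun => inner_der x y].
Proof.
move=> hx hx' hy hy'; have [tl tr] := tri_t_bilinear CS.
have t0l z : tri_t 0 z = 0 := lin_zero (tl z).
have t0r z : tri_t z 0 = 0 := lin_zero (tr z).
rewrite /iota_tri tlift2_tens.
- rewrite (bigD1 a) //= [X in _ + X]big1 ?addr0 => [|b /negPf nb]; last first.
    by do 3!(rewrite big1 // => ? _); rewrite (hc_homog _ hx) nb t0l scaler0.
  rewrite (bigD1 a') //= [X in _ + X]big1 ?addr0 => [|b /negPf nb]; last first.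
    by do 2!(rewrite big1 // => ? _); rewrite (hc_homog _ hx') nb bform0l mulr0 scale0r.
  rewrite (bigD1 c) //= [X in _ + X]big1 ?addr0 => [|b /negPf nb]; last first.
    by do 1!(rewrite big1 // => ? _); rewrite (hc_homog _ hy) nb t0r scaler0.
  rewrite (bigD1 c') //= [X in _ + X]big1 ?addr0 => [|b /negPf nb]; last first.
    by rewrite (hc_homog _ hy') nb bform0r mulr0 scale0r.
  by rewrite -(tri_tE char3 CS) [hc a x]hx [hc a' x']hx' [hc c y]hy [hc c' y']hy'.
- move=> v v'; do 4!apply: bilin_sum => ?; apply: bilin_scaler => z p q.
    by rewrite hc_linear (bform_bilinear S').1.
  by rewrite hc_linear tl.
- move=> v v'; do 4!apply: bilin_sum => ?; apply: bilin_scaler => z p q.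
    by rewrite hc_linear (bform_bilinear S').2.
  by rewrite hc_linear tr.
Qed.

Lemma iota_tri'E a a' c c' x x' y y' :
  homog a x -> homog a' x' -> homog c y -> homog c' y' ->
  iota_tri' (tens x x' : A) (tens y y') =
  ((-1) ^+ (c && a') * bform x y) *: [ffun => inner_der x' y'].
Proof.
move=> hx hx' hy hy'; have [tl tr] := tri_t_bilinear CS'.
have t0l z : tri_t 0 z = 0 := lin_zero (tl z).
have t0r z : tri_t z 0 = 0 := lin_zero (tr z).
rewrite /iota_tri' tlift2_tens.
- rewrite (bigD1 a) //= [X in _ + X]big1 ?addr0 => [|b /negPf nb]; last first.
    by do 3!(rewrite big1 // => ? _); rewrite (hc_homog _ hx) nb bform0l mulr0 scale0r.
  rewrite (bigD1 a') //= [X in _ + X]big1 ?addr0 => [|b /negPf nb]; last first.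
    by do 2!(rewrite big1 // => ? _); rewrite (hc_homog _ hx') nb t0l scaler0.
  rewrite (bigD1 c) //= [X in _ + X]big1 ?addr0 => [|b /negPf nb]; last first.
    by do 1!(rewrite big1 // => ? _); rewrite (hc_homog _ hy) nb bform0r mulr0 scale0r.
  rewrite (bigD1 c') //= [X in _ + X]big1 ?addr0 => [|b /negPf nb]; last first.
    by rewrite (hc_homog _ hy') nb t0r scaler0.
  by rewrite -(tri_tE char3 CS') [hc a x]hx [hc a' x']hx' [hc c y]hy [hc c' y']hy'.
- move=> v v'; do 4!apply: bilin_sum => ?; apply: bilin_scalel => z p q.
    by rewrite hc_linear (bform_bilinear S).1.
  by rewrite hc_linear tl.
- move=> v v'; do 4!apply: bilin_sum => ?; apply: bilin_scalel => z p q.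
    by rewrite hc_linear (bform_bilinear S).2.
  by rewrite hc_linear tr.
Qed.

(** The two products are the half sum and half difference of b(x,y) z, their sum, and of
    [L_x, L_y] z, their difference; dividing by 2 is a change of sign. *)
Lemma clifford_split (T : normed_superalgebra k) a c (x y z : T) : comm_composition T ->
  homog a x -> homog c y ->
  smul x (smul y z) = - (bform x y *: z + (inner_der x y : 'End(T)) z) /\
  (-1) ^+ (a && c) *: smul y (smul x z) = - (bform x y *: z - (inner_der x y : 'End(T)) z).
Proof.
move=> CT hx hy; rewrite (inner_ccE CT z hx hy) -(cc_clifford CT z hx hy).
set P := smul x _.
split; apply: coord_eq => l; rewrite !(linearE, linearN) /=.
  apply: (eq_mod3 char3 (t := coord (vbasis fullv) l P)); ring.
by apply: (eq_mod3 char3 (t := (-1) ^+ (a && c) * coord (vbasis fullv) l (smul y (smul x z)))); ring.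
Qed.

(** On z (x) z' the commutator is a sign times P (x) P' - Q (x) Q', where P = -(B + T), Q = -(B - T) by
    [clifford_split], with B = b(x,y) z, T = [L_x, L_y] z, and likewise for P', Q'.  This is
    2 (B (x) T' + T (x) B'), and 2 = -1. *)
Lemma inner_tens a a' c c' (x y : S) (x' y' : S') :
  homog a x -> homog a' x' -> homog c y -> homog c' y' ->
  (inner_der (tens x x' : A) (tens y y') : 'End(A)) =
  - (Actl S' (((-1) ^+ (a && a') * (-1) ^+ (a && c') * (-1) ^+ (c && c') * bform x' y')
                 *: (inner_der x y : 'End(S)))
     + Actr S (((-1) ^+ (c && a') * bform x y) *: (inner_der x' y' : 'End(S')))).
Proof.
move=> hx hx' hy hy'.
have gA := tensor_graded (cc_graded CS) (cc_graded CS').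
have hD' := (inner_in_der char3 CS' hx' hy').1.
apply/lfunP; apply: tens_ext_homog => [||p p' z z' hz hz']; try exact: lin_lfun.
rewrite (innerE _ gA (homog_tens hx hx') (homog_tens hy hy')).
rewrite opp_lfunE add_lfunE (lin_scale (@Actl_linear _ S S')) (lin_scale (@Actr_linear _ S S')).
rewrite !scale_lfunE ActlE (ActrE _ hD' hz).
rewrite (tensor_mulE _ _ hy' hz) (tensor_mulE _ _ hx' hz) !mulsZ.
rewrite (tensor_mulE _ _ hx' (cc_graded CS hy hz)) (tensor_mulE _ _ hy' (cc_graded CS hx hz)).
have sK b (T : normed_superalgebra k) (u v : T) : (-1) ^+ b *: u = v -> u = (-1) ^+ b *: v.
  by move=> <-; rewrite scalerA -expr2 sqrr_sign scale1r.
have [-> /sK->] := clifford_split z CS hx hy.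
have [-> /sK->] := clifford_split z' CS' hx' hy'.
have e := cc_even CS hx hy; have e' := cc_even CS' hx' hy'.
rewrite !(tensZl, tensZr, tensNl, tensNr, tensDl, tensDr).
apply: coord_eq => l; rewrite !(linearE, linearN) /=.
apply: (eq_mod3 char3 (t := (-1) ^+ (c' && p) * (-1) ^+ (a' && (c (+) p)) *
  (bform x y * coord (vbasis fullv) l (tens z ((inner_der x' y' : 'End(S')) z'))
   + bform x' y' * coord (vbasis fullv) l (tens ((inner_der x y : 'End(S)) z) z')))).
move: (inner_der x y) (inner_der x' y') (bform x y) (bform x' y') e e'.
move=> D D' b b' e e'; clear hD' gA sK.
case: a e {hx}; case: c {hy} => e; try rewrite (e isT); clear e;
 case: a' e' {hx'}; case: c' {hy'} => e'; try rewrite (e' isT); clear e';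
 by case: p {hz} => /=; ring.
Qed.

Lemma iota_tri_bilinear : bilinear_for *:%R *:%R (@iota_tri k S S').
Proof. exact: tlift2_bilinear. Qed.
Lemma iota_tri'_bilinear : bilinear_for *:%R *:%R (@iota_tri' k S S').
Proof. exact: tlift2_bilinear. Qed.

(** The tri components of [iota_i(m), iota_i(n)], acting on S (x) S', are those of the bracket
    of a_i (x) m and a_i (x) n, since -2 b_q(a_i, a_i) = -1. *)
Lemma inner_iota (m n : A) : (inner_der m n : 'End(A)) =
  - (Actl S' (iota_tri m n 0) + Actr S (iota_tri' m n 0)).
Proof.
pose F (m n : A) : 'End(A) := inner_der m n.
pose G (m n : A) : 'End(A) := - (Actl S' (iota_tri m n 0) + Actr S (iota_tri' m n 0)).
have [Fl Fr] : bilinear_for *:%R *:%R F := inner_bilinear A.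
have [Gl Gr] : bilinear_for *:%R *:%R G.
  have [il ir] := iota_tri_bilinear; have [il' ir'] := iota_tri'_bilinear.
  split=> z c u v; rewrite /G /= ?il ?il' ?ir ?ir' ![(_ *: _ + _ : {ffun _}) 0]ffunE
    ![(_ *: _ : {ffun _}) 0]ffunE Actl_linear Actr_linear.
  by rewrite addrACA -scalerDr opprD -scalerN.
  by rewrite addrACA -scalerDr opprD -scalerN.
rewrite -/(F m n) -/(G m n).
apply: (tens_ext_homog (f := F^~ n) (g := G^~ n)); [exact: Fl | exact: Gl |].
move=> a a' x x' hx hx'.
apply: (tens_ext_homog (f := F _) (g := G _)); [exact: Fr | exact: Gr |].
move=> c c' y y' hy hy'.
rewrite /F /G (inner_tens hx hx' hy hy') (iota_triE hx hx' hy hy').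
by rewrite (iota_tri'E hx hx' hy hy') !ffunE.
Qed.

End CompositionTensor.

(** * Quaternion units among the trace zero matrices *)

Section TraceZero.
Variables (k : fieldType) (char3 : 3%N \in [pchar k]).
Local Notation Q0 := (Q0 k).
Local Notation Q := (subvs_of Q0).

Lemma in_Q0 (M : 'M[k]_2) : M \in Q0 <-> \tr M = 0.
Proof.
apply: mem_subspace; split=> [|a x y hx hy]; first exact: mxtrace0.
by rewrite mxtraceD mxtraceZ hx hy mulr0 addr0.
Qed.

Lemma mx2_eq (M N : 'M[k]_2) : M 0 0 = N 0 0 -> M 0 1 = N 0 1 -> M 1 0 = N 1 0 ->
  M 1 1 = N 1 1 -> M = N.
Proof.
move=> e00 e01 e10 e11; apply/matrixP => i j.
have h (l : 'I_2) : l = 0 \/ l = 1.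
  by case: l => -[|[|//]] lt; [left | right]; apply: val_inj.
by case: (h i) => ->; case: (h j) => ->.
Qed.

Lemma sum_I2 (F : 'I_2 -> k) : \sum_i F i = F 0 + F 1.
Proof. by rewrite !big_ord_recl big_ord0 addr0; congr (_ + F _); apply: val_inj. Qed.

Lemma det2 (M : 'M[k]_2) : \det M = M 0 0 * M 1 1 - M 0 1 * M 1 0.
Proof.
rewrite (expand_det_row M 0) sum_I2 /cofactor !det_mx11 !mxE /= !expr0 !expr1.
have -> : lift 0 0 = 1 :> 'I_2 by apply: val_inj.
have -> : lift 1 0 = 0 :> 'I_2 by apply: val_inj.
ring.
Qed.

Lemma Q0_entry (q : Q) : (vsval q : 'M_2) 1 1 = - (vsval q : 'M_2) 0 0.
Proof.
have := (in_Q0 (vsval q)).1 (subvsP q); rewrite /mxtrace sum_I2 => /eqP.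
by rewrite addrC addr_eq0 => /eqP.
Qed.

Lemma polarE (q r : Q) : polar_det (vsval q) (vsval r) =
  let a := vsval q : 'M_2 in let b := vsval r : 'M_2 in
  a 0 0 * b 0 0 - a 0 1 * b 1 0 - a 1 0 * b 0 1.
Proof.
rewrite /polar_det !det2 !mxE !Q0_entry /=.
apply: (eq_mod3 char3 (t := - (vsval q : 'M_2) 0 0 * (vsval r : 'M_2) 0 0)); ring.
Qed.

Lemma polar_linl (r : Q) : linear (fun q : Q => polar_det (vsval q) (vsval r) : k^o).
Proof.
move=> c x y; rewrite !polarE /= !mxE /GRing.scale /=; ring.
Qed.
Lemma polar_linr (r : Q) : linear (fun q : Q => polar_det (vsval r) (vsval q) : k^o).
Proof.
move=> c x y; rewrite !polarE /= !mxE /GRing.scale /=; ring.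
Qed.

Lemma val_Q0_bracket (q r : Q) : vsval (Q0_bracket q r) = vsval q *m vsval r - vsval r *m vsval q.
Proof.
rewrite /Q0_bracket vsprojK //; apply/in_Q0.
by rewrite linearB /= mxtrace_mulC subrr.
Qed.

Lemma Q0_bracket_bilinear : bilinear_for *:%R *:%R (@Q0_bracket k).
Proof.
split=> z c x y; apply: subvs_inj; rewrite !val_Q0_bracket /= !val_Q0_bracket.
  rewrite mulmxDl mulmxDr -scalemxAl -scalemxAr scalerBr opprD addrACA //.
by rewrite mulmxDl mulmxDr -scalemxAl -scalemxAr scalerBr opprD addrACA.
Qed.

(** Matrices of determinant 1, pairwise orthogonal for the polar form, hence
    anticommuting with square -1: quaternion units i, j and -ij.  The cyclic bracket
    [i, j] = 2ij = -ij holds because 2 = -1; the isotropy of 1 + 1 + 1 = 0 puts them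
    in the matrices over the prime field.  Entries are listed row by row. *)
Definition quat_mx (i : 'Z_3) : 'M[k]_2 :=
  \matrix_(r, c) nth 0 (nth [::] [:: [:: 0; -1; 1; 0]; [:: 1; 1; 1; -1]; [:: 1; -1; -1; -1]] i)
    (2 * r + c).

Definition quat (i : 'Z_3) : Q := vsproj Q0 (quat_mx i).

Lemma val_quat i : vsval (quat i) = quat_mx i.
Proof.
rewrite vsprojK //; apply/in_Q0; rewrite /mxtrace sum_I2 !mxE /=.
by case: i => -[|[|[|//]]] lt /=; rewrite ?addr0 ?subrr.
Qed.

Lemma Z3_cases (i : 'Z_3) : [\/ i = 0, i = 1 | i = 2].
Proof.
by case: i => -[|[|[|//]]] lt; [apply: Or31 | apply: Or32 | apply: Or33]; apply: val_inj.
Qed.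

Lemma quat_bracket i : Q0_bracket (quat i) (quat (i + 1)) = quat (i + 2).
Proof.
apply: subvs_inj; rewrite val_Q0_bracket !val_quat.
by case: (Z3_cases i) => ->; apply: mx2_eq; rewrite !mxE !sum_I2 !mxE /=;
  (try by apply: (eq_mod3 char3 (t := 0)); ring);
  (try by apply: (eq_mod3 char3 (t := 1)); ring);
  apply: (eq_mod3 char3 (t := -1)); ring.
Qed.

Lemma Q0_bracketC (q r : Q) : Q0_bracket q r = - Q0_bracket r q.
Proof. by apply: subvs_inj; rewrite linearN /= !val_Q0_bracket opprB. Qed.

Lemma Q0_bracketqq (q : Q) : Q0_bracket q q = 0.
Proof. by apply: subvs_inj; rewrite linear0 val_Q0_bracket subrr. Qed.

Lemma polar_quat i j : polar_det (vsval (quat i)) (vsval (quat j)) = if i == j then 2 else 0.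
Proof.
rewrite polarE /= !val_quat !mxE /=.
by case: (Z3_cases i) => ->; case: (Z3_cases j) => -> /=;
  (try by apply: (eq_mod3 char3 (t := 0)); ring);
  (try by apply: (eq_mod3 char3 (t := 1)); ring);
  apply: (eq_mod3 char3 (t := -1)); ring.
Qed.

Lemma sum_Z3 (V : nmodType) (F : 'Z_3 -> V) : \sum_i F i = F 0 + F 1 + F 2.
Proof.
by rewrite !big_ord_recl big_ord0 addr0 addrA; congr (F _ + F _ + F _); apply: val_inj.
Qed.

Lemma quat_coord (q : Q) :
  q = \sum_i - polar_det (vsval (quat i)) (vsval q) *: quat i.
Proof.
apply: subvs_inj; rewrite sum_Z3 !linearD !linearZ /= !polarE /= !val_quat.
apply: mx2_eq; rewrite ?Q0_entry !mxE /=.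
- by apply: (eq_mod3 char3 (t := (vsval q : 'M_2) 0 0)); ring.
- by apply: (eq_mod3 char3 (t := - (vsval q : 'M_2) 1 0)); ring.
- by apply: (eq_mod3 char3 (t := - (vsval q : 'M_2) 0 1)); ring.
- by apply: (eq_mod3 char3 (t := - (vsval q : 'M_2) 0 0)); ring.
Qed.

End TraceZero.

(** * From triality to the Tits-Kantor-Koecher construction *)

Section Triality.
Variables (k : fieldType) (S : normed_superalgebra k).

(** The subspace on which [tri_proj] is the identity. *)
Definition tri_space := sub_vspace (W := pow3_superspace (end_superspace S)) (@in_tri k S).

(** The form of triality that makes g(S,S') comparable with a Tits-Kantor-Koecher
    superalgebra: an element of tri(S) is one derivation of S, repeated three times. *)
Definition tri_diagonal := forall w : {ffun 'Z_3 -> 'End(S)},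
  w \in tri_space <-> exists2 d, d \in derv S & w = [ffun => d].

Lemma tri_fun_derv (d : tri S) j : tri_diagonal -> tri_fun d j \in derv S.
Proof. by move=> TS; rewrite /tri_fun; have [e he ->] := (TS _).1 (subvsP d); rewrite ffunE. Qed.

Lemma tri_fun_const (d : tri S) j : tri_diagonal -> tri_fun d j = tri_fun d 0.
Proof. by move=> TS; rewrite /tri_fun; have [e he ->] := (TS _).1 (subvsP d); rewrite !ffunE. Qed.

Lemma tri_fun_inj (d e : tri S) : tri_diagonal -> tri_fun d 0 = tri_fun e 0 -> d = e.
Proof.
move=> TS de; apply: subvs_inj; apply/ffunP => j; rewrite -!/(tri_fun _ _).
by rewrite !(tri_fun_const _ j TS).
Qed.

(** [tri_proj] and [der_proj] are the identity only on the subspaces they project onto, hence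
    the membership hypotheses here and below. *)
Lemma tri_funK d : tri_diagonal -> d \in derv S -> tri_fun (tri_proj [ffun => d]) 0 = d.
Proof.
move=> TS hd; rewrite /tri_fun vsprojK ?ffunE //.
by apply/TS; exists d.
Qed.

Lemma tri_fun_hc i (d : tri S) : tri_fun (hc i d) 0 = hc i (tri_fun d 0 : end_superspace S).
Proof. by rewrite /tri_fun val_sub_hc ?ffunE //; exact: in_tri_subspace. Qed.

Lemma tri_fun_bracket (d e : tri S) : tri_diagonal ->
  tri_fun (tri_bracket d e) 0 = scomm (tri_fun d 0 : end_superspace S) (tri_fun e 0).
Proof.
move=> TS; rewrite -[RHS](tri_funK TS); last by apply: scomm_derv; apply: tri_fun_derv.
congr (tri_fun (tri_proj _) 0); apply/ffunP => j; rewrite !ffunE.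
by rewrite (tri_fun_const d j) // (tri_fun_const e j).
Qed.

Lemma theta_const (d : 'End(S)) n : iter n (@theta k S) [ffun => d] = [ffun => d].
Proof.
elim: n => //= n ->; apply/ffunP => j; rewrite !ffunE.
by case: j => -[|[|[|]]].
Qed.

Lemma tri_fun_theta w n : tri_diagonal -> w \in tri_space -> tri_fun (tri_proj (iter n (@theta k S) w)) 0 = w 0.
Proof. by move=> TS /TS [d hd ->]; rewrite theta_const tri_funK // ffunE. Qed.

End Triality.

Section TKK.
Variables (k : fieldType) (char3 : 3%N \in [pchar k]) (H : superalgebra k).
Local Notation QH := (tensor_superspace (even_superspace (subvs_of (Q0 k))) H).

Lemma tkk_mulE a x b y :
  tkk_mul (tens a x : QH) (tens b y : QH) = tens (Q0_bracket a b) (smul x y).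
Proof.
have [ql qr] := Q0_bracket_bilinear k.
rewrite /tkk_mul tlift2_tens //.
- move=> v v'; apply: (bilin_comp (F := @tens k _ H) (g := fun u => Q0_bracket u v)
    (h := fun u => smul u v')); [exact: tens_bilinear | exact: ql | exact: lin_mull].
- move=> v v'; apply: (bilin_comp (F := @tens k _ H) (g := fun u => Q0_bracket v u)
    (h := fun u => smul v' u)); [exact: tens_bilinear | exact: qr | exact: lin_mulr].
Qed.

Lemma tkk_derE a x b y :
  tkk_der (tens a x : QH) (tens b y : QH) =
  - (2 * polar_det (vsval a) (vsval b)) *: inner_der x y.
Proof.
have [il ir] := inner_bilinear H.
rewrite /tkk_der tlift2_tens //.
- move=> v v'; have [l r] := bilin_scalel (-2) (polar_linl char3 v) (il v').
  by split=> z c u w; [have := l z c u w | have := r z c u w]; rewrite /= !mulNr.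
- move=> v v'; have [l r] := bilin_scalel (-2) (polar_linr char3 v) (ir v').
  by split=> z c u w; [have := l z c u w | have := r z c u w]; rewrite /= !mulNr.
Qed.

End TKK.

Section Isomorphism.
Variables (k : fieldType) (char3 : 3%N \in [pchar k]).
Variables (S S' : normed_superalgebra k).
Hypotheses (CS : comm_composition S) (CS' : comm_composition S').
Hypotheses (TS : tri_diagonal S) (TS' : tri_diagonal S').
Local Notation A := (tensor_superalgebra S S').
Local Notation g := (g_superalgebra S S').
Local Notation tkk := (tkk_superalgebra A).
Local Notation quat := (@quat k).

Hypothesis der_surj : forall D, D \in derv A -> exists d d',
  [/\ d \in derv S, d' \in derv S' & D = Actl S' d + Actr S d'].
Hypothesis der_inj : forall d d', d \in derv S -> d' \in derv S' ->
  Actl S' d + Actr S d' = 0 -> d = 0 /\ d' = 0.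

Lemma iota_tri_mem (m n : A) : iota_tri m n \in tri_space S.
Proof.
have [il ir] := iota_tri_bilinear S S'.
apply: (tens_mem (f := fun m => iota_tri m n)) => [|a a' x x' hx hx']; first exact: il.
apply: (tens_mem (f := fun n => iota_tri (tens x x' : A) n)) => [|c c' y y' hy hy']; first exact: ir.
rewrite (iota_triE char3 CS hx hx' hy hy'); apply: memvZ.
by apply/TS; eexists; last by []; apply: inner_derv.
Qed.

Lemma iota_tri_mem' (m n : A) : iota_tri' m n \in tri_space S'.
Proof.
have [il ir] := iota_tri'_bilinear S S'.
apply: (tens_mem (f := fun m => iota_tri' m n)) => [|a a' x x' hx hx']; first exact: il.
apply: (tens_mem (f := fun n => iota_tri' (tens x x' : A) n)) => [|c c' y y' hy hy']; first exact: ir.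
rewrite (iota_tri'E char3 CS' hx hx' hy hy'); apply: memvZ.
by apply/TS'; eexists; last by []; apply: inner_derv.
Qed.

(** By [tri_diagonal] the component of index 0 stands for all three. *)
Definition tri_act (d : tri S * tri S') : 'End(A) :=
  Actl S' (tri_fun d.1 0) + Actr S (tri_fun d.2 0).

Lemma tri_act_linear : linear tri_act.
Proof.
move=> c x y; rewrite /tri_act /=.
rewrite [tri_fun (_ + _) 0](tri_fun_linear 0 c x.1 y.1).
rewrite [tri_fun (_ + _) 0](tri_fun_linear 0 c x.2 y.2).
by rewrite Actl_linear Actr_linear scalerDr addrACA.
Qed.

Lemma tri_act_derv d : tri_act d \in derv A.
Proof.
by rewrite memvD // ?Actl_derv ?Actr_derv ?tri_fun_derv //; exact: cc_graded.
Qed.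

Lemma tri_act_hc i d :
  tri_act (hc i (d : prod_superspace (tri S) (tri S'))) = hc i (tri_act d : end_superspace A).
Proof. by rewrite /tri_act !tri_fun_hc hcD Actl_hc Actr_hc. Qed.

Definition iota_quat (m : {ffun 'Z_3 -> A}) : tensor (subvs_of (Q0 k)) A :=
  \sum_i tens (quat i) (m i).

Lemma iota_quat_linear : linear iota_quat.
Proof.
move=> c m n; rewrite /iota_quat scaler_sumr -big_split; apply: eq_bigr => i _ /=.
by rewrite !ffunE lin_tensr.
Qed.

Local Notation Q0H := (tensor_superspace (even_superspace (subvs_of (Q0 k))) A).

Lemma iota_quat_hc i m :
  iota_quat (hc i (m : pow3_superspace A)) = hc i (iota_quat m : Q0H).
Proof.
rewrite /iota_quat (lin_bigsum (hc_linear i)); apply: eq_bigr => j _.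
by rewrite ffunE [RHS]tensor_hc_tens sum_bool [X in _ + X]tens0l addr0.
Qed.

Definition g_to_tkk (X : g) : tkk :=
  (iota_quat X.2, der_proj (tri_act X.1)).

Lemma g_to_tkk_linear : linear g_to_tkk.
Proof.
move=> c X Y; congr (_, _); first exact: iota_quat_linear.
by rewrite /= tri_act_linear /der_proj linearP.
Qed.

Lemma g_to_tkk_hc i X : g_to_tkk (hc i X) = hc i (g_to_tkk X).
Proof.
congr (_, _); first exact: iota_quat_hc.
apply: subvs_inj; rewrite val_sub_hc; last exact: in_der_subspace.
by rewrite !vsprojK ?tri_act_hc // -?tri_act_hc; apply: tri_act_derv.
Qed.

(** The cyclic table of the quaternion units reproduces the indices
    of [iota_{i-2}, iota_{i-1}] in iota_i. *)
Lemma tkk_mul_quat (m n : {ffun 'Z_3 -> A}) : tkk_mul (iota_quat m) (iota_quat n) =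
  iota_quat [ffun i => (smul (m (i - 2)) (n (i - 1)) : A) - smul (m (i - 1)) (n (i - 2))].
Proof.
have [ql qr] : bilinear_for *:%R *:%R (@tkk_mul k A) by exact: tlift2_bilinear.
have b01 := quat_bracket char3 0; have b12 := quat_bracket char3 1.
have b20 := quat_bracket char3 2.
rewrite (_ : 0 + 1 = 1) in b01; last exact: val_inj.
rewrite (_ : 0 + 2 = 2) in b01; last exact: val_inj.
rewrite (_ : 1 + 1 = 2) in b12; last exact: val_inj.
rewrite (_ : 1 + 2 = 0) in b12; last exact: val_inj.
rewrite (_ : 2 + 1 = 0) in b20; last exact: val_inj.
rewrite (_ : 2 + 2 = 1) in b20; last exact: val_inj.
rewrite /iota_quat !sum_Z3 !ffunE.
rewrite (_ : 0 - 2 = 1); last exact: val_inj.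
rewrite (_ : 0 - 1 = 2); last exact: val_inj.
rewrite (_ : 1 - 2 = 2); last exact: val_inj.
rewrite (_ : 1 - 1 = 0); last exact: val_inj.
rewrite (_ : 2 - 2 = 0); last exact: val_inj.
rewrite (_ : 2 - 1 = 1); last exact: val_inj.
rewrite !(lin_add (ql _)) !(lin_add (qr _)) !tkk_mulE !Q0_bracketqq b01 b12 b20.
rewrite [Q0_bracket (quat 1) (quat 0)]Q0_bracketC [Q0_bracket (quat 2) (quat 1)]Q0_bracketC.
rewrite [Q0_bracket (quat 0) (quat 2)]Q0_bracketC b01 b12 b20.
rewrite !(lin_zero (lin_tensl _)) !(lin_add (lin_tensr _)) !tensNl !tensNr.
by apply: coord_eq => l; rewrite !(linearE, linearN) /=; ring.
Qed.

Lemma tkk_der_quat (m n : {ffun 'Z_3 -> A}) :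
  tkk_der (iota_quat m) (iota_quat n) = - \sum_i inner_der (m i) (n i).
Proof.
have [ql qr] : bilinear_for *:%R *:%R (@tkk_der k A) by exact: tlift2_bilinear.
rewrite /iota_quat (lin_bigsum (ql _)) -sumrN; apply: eq_bigr => i _.
rewrite (lin_bigsum (qr _)) (bigD1 i) //= big1 => [|j nij].
  rewrite (tkk_derE char3) (polar_quat char3) eqxx addr0 (two_char3 char3) mulrNN mulr1.
  by rewrite scaleN1r.
by rewrite (tkk_derE char3) (polar_quat char3) eq_sym (negPf nij) mulr0 oppr0 scale0r.
Qed.

(** This identifies the second term of the bracket of g(S,S'), defined by superanticommutativity,
    with the product of A in the order produced by [tkk_mul]. *)
Lemma sflip_supercomm (T : superalgebra k) (m n : T) : supercomm T ->
  sflip (@smul k T) m n = smul m n.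
Proof.
move=> cT.
apply: (@bilin_homog_ext k T T _ (sflip (@smul k T)) (@smul k T)).
- exact/sflip_bilinear/smul_bilinear.
- exact: smul_bilinear.
move=> a c x y hx hy; rewrite (sflip_homog (smul_bilinear T) hy hx) (cT _ _ _ _ hx hy).
by rewrite andbC.
Qed.

Lemma der_act_quat (d : tri S * tri S') (m : {ffun 'Z_3 -> A}) :
  der_act (der_proj (tri_act d)) (iota_quat m : Q0H) = iota_quat [ffun i => tri_act d (m i)].
Proof.
rewrite /der_act /iota_quat (lin_bigsum (@tlift_linear _ _ _ _ _)); apply: eq_bigr => i _.
rewrite ffunE tlift_tens ?der_funK ?tri_act_derv //.
apply: (bilin_comp (F := @tens k _ A) (g := id)) => //; first exact: tens_bilinear.
exact: lin_lfun.
Qed.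

Lemma g_crossE (X Y : g) : g_cross X Y =
  [ffun i => tri_act X.1 (Y.2 i)] + [ffun i => smul (X.2 (i - 2) : A) (Y.2 (i - 1))].
Proof.
apply/ffunP => i; rewrite !ffunE /tri_act add_lfunE (tri_fun_const _ i TS) (tri_fun_const _ i TS').
by rewrite /Actl /Actr !linfunE_lin //; exact: tlift_linear.
Qed.

Lemma g_to_tkkM X Y : g_to_tkk (smul X Y) = smul (g_to_tkk X) (g_to_tkk Y).
Proof.
congr (_, _); last first.
  rewrite /= -linearD /=; congr vsproj.
  rewrite !der_funK ?tri_act_derv // tkk_der_quat.
  have tl (T : normed_superalgebra k) : linear (fun d : tri T => tri_fun d 0) := @tri_fun_linear k T 0.
  rewrite /tri_act /= (lin_add (tl S)) (lin_add (tl S')) !tri_fun_bracket //.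
  rewrite (lin_bigsum (tl S)) (lin_bigsum (tl S')).
  (* The inner derivations on the right match the terms t_{x,y} on the left. *)
  have -> : - \sum_i inner_der (X.2 i : A) (Y.2 i : A) =
     Actl S' (\sum_i iota_tri (X.2 i) (Y.2 i) 0) + Actr S (\sum_i iota_tri' (X.2 i) (Y.2 i) 0).
    rewrite (lin_bigsum (@Actl_linear _ _ _)) (lin_bigsum (@Actr_linear _ _ _)) -big_split -sumrN.
    by apply: eq_bigr => i _; rewrite (inner_iota char3 CS CS') opprK.
  under eq_bigr => i _ do rewrite (tri_fun_theta _ TS (iota_tri_mem _ _)).
  under [X in _ + Actr S (_ + X) = _]eq_bigr => i _ do rewrite (tri_fun_theta _ TS' (iota_tri_mem' _ _)).
  have [sl sr] := scomm_bilinear A.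
  rewrite (lin_add (sl _)) !(lin_add (sr _)) !scomm_Actl !scomm_Actr scomm_Actlr scomm_Actrl.
  rewrite (lin_add (@Actl_linear _ _ _)) (lin_add (@Actr_linear _ _ _)) addr0 add0r.
  by rewrite addrACA; exact: addrC.
have iqD m n : iota_quat (m + n) = iota_quat m + iota_quat n := lin_add iota_quat_linear m n.
(* GA and GM are the parts of the bracket given by the action of tri and by the product. *)
pose GA (U V : g) : {ffun 'Z_3 -> A} := [ffun i => tri_act U.1 (V.2 i)].
pose GM (U V : g) : {ffun 'Z_3 -> A} := [ffun i => smul (U.2 (i - 2) : A) (V.2 (i - 1))].
have cE U V : g_cross U V = GA U V + GM U V := g_crossE U V.
have fE : sflip (@g_cross k S S') X Y = sflip GA X Y + sflip GM X Y.
  rewrite -big_split; apply: eq_bigr => a _; rewrite -big_split; apply: eq_bigr => c _ /=.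
  by rewrite cE scalerDr.
have gM : GM X Y - sflip GM X Y =
    [ffun i => smul (X.2 (i - 2) : A) (Y.2 (i - 1)) - smul (X.2 (i - 1) : A) (Y.2 (i - 2))].
  apply/ffunP => i; rewrite !ffunE; congr (_ - _).
  rewrite -(@sflip_supercomm A (X.2 (i - 1)) (Y.2 (i - 2)) (tensor_supercomm (cc_comm CS) (cc_comm CS'))).
  rewrite sum_ffunE; apply: eq_bigr => a _; rewrite sum_ffunE; apply: eq_bigr => c _.
  by rewrite !ffunE.
have gA : sflip (@der_act k A) (iota_quat X.2) (der_proj (tri_act Y.1)) = iota_quat (sflip GA X Y).
  rewrite (lin_bigsum iota_quat_linear); apply: eq_bigr => a _.
  rewrite (lin_bigsum iota_quat_linear); apply: eq_bigr => c _.
  rewrite (lin_scale iota_quat_linear); congr (_ *: _).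
  have -> : hc a (der_proj (tri_act Y.1)) = (g_to_tkk (hc a Y)).2 by rewrite g_to_tkk_hc.
  have -> : hc c (iota_quat X.2 : Q0H) = (g_to_tkk (hc c X)).1 by rewrite g_to_tkk_hc.
  exact: der_act_quat.
rewrite [(smul X Y).2]/(g_cross X Y - sflip (@g_cross k S S') X Y) cE fE.
rewrite [tkk_mul _ _]tkk_mul_quat [der_act _ _]der_act_quat [sflip (@der_act k A) _ _]gA -gM.
have alg (V : zmodType) (p q r t : V) : p + q - (r + t) = (q - t) + (p - r).
  by rewrite opprD addrACA addrC.
apply: (etrans (congr1 iota_quat (alg _ (GA X Y) (GM X Y) (sflip GA X Y) (sflip GM X Y)))).
by rewrite !iqD !(lin_opp iota_quat_linear).
Qed.

Lemma g_to_tkk_inj X : g_to_tkk X = 0 -> X = 0.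
Proof.
case: X => [[d d'] m] [e1 e2].
have m0 : m = 0.
  (* Contracting with a_j recovers - m_j, by orthogonality. *)
  pose c (j : 'Z_3) (q : subvs_of (Q0 k)) : k := polar_det (vsval (quat j)) (vsval q).
  have cL j : linear (c j : _ -> k^o) by exact: polar_linr.
  have bL j : bilinear_for *:%R *:%R (fun (q : subvs_of (Q0 k)) (u : A) => c j q *: u).
    split=> z t u v /=; last by rewrite scalerDr !scalerA mulrC.
    by rewrite cL scalerDl scalerA.
  apply/ffunP => j; rewrite [RHS]ffunE; apply: (neg_char3 char3).
  have := congr1 (tlift (fun q (u : A) => c j q *: u)) e1.
  rewrite (lin_zero (@tlift_linear _ _ _ _ _)) /iota_quat (lin_bigsum (@tlift_linear _ _ _ _ _)).
  rewrite (bigD1 j) //= big1 => [|i nij].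
    rewrite tlift_tens // /c (polar_quat char3) eqxx addr0 (two_char3 char3) scaleN1r.
    by move=> /eqP; rewrite oppr_eq0 => /eqP ->; rewrite oppr0.
  by rewrite tlift_tens // /c (polar_quat char3) eq_sym (negPf nij) scale0r.
have e3 : tri_act (d, d') = 0.
  by rewrite -(der_funK (tri_act_derv _)) e2 /der_fun linear0.
have [d0 d'0] := der_inj (tri_fun_derv d 0 TS) (tri_fun_derv d' 0 TS') e3.
have z (T : normed_superalgebra k) : tri_fun (0 : tri T) 0 = 0 := lin_zero (@tri_fun_linear k T 0).
rewrite m0; congr (_, _, _); apply: tri_fun_inj => //; by rewrite z.
Qed.

Lemma g_to_tkk_surj Y : exists X, g_to_tkk X = Y.
Proof.
case: Y => [y D].
have [d [d' [hd hd' e]]] := der_surj (subvsP D).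
have [m <-] : exists m, iota_quat m = y.
  rewrite (tens_decomp y) /tlift.
  pose P (t : tensor (subvs_of (Q0 k)) A) := exists m, iota_quat m = t.
  have PD u v : P u -> P v -> P (u + v).
    by move=> [m <-] [n <-]; exists (m + n); rewrite (lin_add iota_quat_linear).
  have PZ c u : P u -> P (c *: u).
    by move=> [m <-]; exists (c *: m); rewrite (lin_scale iota_quat_linear).
  have P0 : P 0 by exists 0; rewrite (lin_zero iota_quat_linear).
  apply: (big_ind P) => // i _; apply: (big_ind P) => // j _; apply: PZ.
  move: (_`_i) (_`_j) => q x; rewrite (quat_coord char3 q).
  exists [ffun i => - polar_det (vsval (quat i)) (vsval q) *: x].
  rewrite (lin_bigsum (lin_tensl x)); apply: eq_bigr => l _.
  by rewrite ffunE tensZl tensZr.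
exists ((tri_proj [ffun => d], tri_proj [ffun => d']), m); congr (_, _).
by apply: subvs_inj; rewrite vsprojK ?tri_act_derv // /tri_act /= !tri_funK.
Qed.

Theorem g_tkk_iso : superalgebra_iso g tkk.
Proof.
exists g_to_tkk; split.
- exact: g_to_tkk_linear.
- apply: lin_surj_bij; [exact: g_to_tkk_linear | exact: g_to_tkk_inj | exact: g_to_tkk_surj].
- exact: g_to_tkk_hc.
- exact: g_to_tkkM.
Qed.

End Isomorphism.

(** * The superalgebra S_{1,2} *)

Section S12.
Variables (k : fieldType) (char3 : 3%N \in [pchar k]) (V : vectType k).
Variables (form : {biscalar V}) (u0 v0 : V).
Hypothesis form_alt : forall v, form v v = 0.
Hypothesis form_uv : form u0 v0 = 1.
Hypothesis form_span : forall v, v = form v v0 *: u0 + form u0 v *: v0.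
Local Notation S := (S12 form).

Lemma form_anti v w : form v w = - form w v.
Proof.
have := form_alt (v + w); rewrite linearDl !linearDr /= !form_alt add0r addr0 => /eqP.
by rewrite addr_eq0 => /eqP.
Qed.

Lemma form_det v w : form v w = form v v0 * form u0 w - form u0 v * form w v0.
Proof.
rewrite {1}(form_span v) {1}(form_span w) linearDl !linearDr /= !linearZl_LR !linearZr_LR /=.
rewrite !form_alt form_uv [form v0 u0]form_anti form_uv /GRing.scale /=.
by rewrite !mulr0 add0r addr0 !mulrN !mulr1.
Qed.

(** The left side is alternating in three vectors of a space of dimension 2. *)
Lemma form_cyclic u v w : form u v *: w + form v w *: u + form w u *: v = 0.
Proof.
have H (a b c d e f : k) : (a * d - b * c) *: (e *: u0 + f *: v0) +
    (c * f - d * e) *: (a *: u0 + b *: v0) + (e * b - f * a) *: (c *: u0 + d *: v0) = 0.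
  by apply: coord_eq => l; rewrite !linearE /=; ring.
have := H (form u v0) (form u0 u) (form v v0) (form u0 v) (form w v0) (form u0 w).
by rewrite -!form_span -!form_det.
Qed.

Lemma form_nondeg v : (forall w, form v w = 0) -> v = 0.
Proof. by move=> h; rewrite (form_span v) h form_anti h oppr0 !scale0r addr0. Qed.

Lemma S12_mulE (x y : S) :
  smul x y = (x.1 * y.1 + form x.2 y.2, - (x.1 *: y.2 + y.1 *: x.2)).
Proof.
have cE (z : S) : @bconj k (B12 form) (1, 0) z = (z.1, - z.2).
  rewrite /bconj /= /B12_bform /= linear0r; congr (_, _); last by rewrite /= scaler0 sub0r.
  have h (t : k) : (2 * t * 1 + 0) * 1 - t = t by ring.
  exact: h.
transitivity (B12_mul form (@bconj k (B12 form) (1, 0) x) (@bconj k (B12 form) (1, 0) y)).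
  by [].
rewrite !cE /B12_mul /=.
by rewrite linearNl linearNr opprK !scalerN opprD.
Qed.

Lemma S12_even (x : S) : homog false x -> exists a : k^o, x = (a, 0).
Proof. by move=> <-; exists x.1. Qed.
Lemma S12_odd (x : S) : homog true x -> exists v : V, x = (0, v).
Proof. by move=> <-; exists x.2. Qed.
Lemma S12_homog_even (a : k^o) : @homog k S false (a, 0). Proof. by []. Qed.
Lemma S12_homog_odd (v : V) : @homog k S true (0, v). Proof. by []. Qed.

Lemma S12_mul00 (a b : k^o) : smul ((a, 0) : S) ((b, 0) : S) = (a * b, 0).
Proof. by rewrite S12_mulE /= linear0r !scaler0 !addr0 oppr0. Qed.
Lemma S12_mul01 (a : k^o) (v : V) : smul ((a, 0) : S) ((0, v) : S) = (0, - (a *: v)).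
Proof. by rewrite S12_mulE /= linear0l mulr0 scaler0 !addr0. Qed.
Lemma S12_mul10 (a : k^o) (v : V) : smul ((0, v) : S) ((a, 0) : S) = (0, - (a *: v)).
Proof. by rewrite S12_mulE /= linear0r mul0r scale0r !add0r. Qed.
Lemma S12_mul11 (v w : V) : smul ((0, v) : S) ((0, w) : S) = (form v w, 0).
Proof. by rewrite S12_mulE /= mul0r add0r !scale0r addr0 oppr0. Qed.

Lemma S12_bform00 (a b : k^o) : bform ((a, 0) : S) ((b, 0) : S) = - (a * b).
Proof. by rewrite /= /B12_bform /= linear0r addr0 (two_char3 char3) mulN1r mulNr. Qed.
Lemma S12_bform01 (a : k^o) (v : V) : bform ((a, 0) : S) ((0, v) : S) = 0.
Proof. by rewrite /= /B12_bform /= linear0l mulr0 addr0. Qed.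
Lemma S12_bform10 (a : k^o) (v : V) : bform ((0, v) : S) ((a, 0) : S) = 0.
Proof. by rewrite /= /B12_bform /= linear0r mulr0 mul0r addr0. Qed.
Lemma S12_bform11 (v w : V) : bform ((0, v) : S) ((0, w) : S) = form v w.
Proof. by rewrite /= /B12_bform /= mulr0 add0r. Qed.

Lemma S12_composition : comm_composition S.
Proof.
split.
- move=> a c x y; case: a => [/S12_odd[v ->]|/S12_even[a ->]];
    case: c => [/S12_odd[w ->]|/S12_even[b ->]].
  + by rewrite S12_mul11.
  + by rewrite S12_mul10.
  + by rewrite S12_mul01.
  + by rewrite S12_mul00.
- move=> a c x y; case: a => [/S12_odd[v ->]|/S12_even[a ->]];
    case: c => [/S12_odd[w ->]|/S12_even[b ->]].
  + by rewrite !S12_mul11 form_anti expr1 scaleN1r; congr (_, _); rewrite /= oppr0.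
  + by rewrite S12_mul10 S12_mul01 scale1r.
  + by rewrite S12_mul10 S12_mul01 scale1r.
  + by rewrite !S12_mul00 scale1r mulrC.
- move=> a c x y z hx hy; move: z.
  apply: (homog_ext (f := fun z : S => smul x (smul y z) + _ *: smul y (smul x z))
                    (g := fun z : S => bform x y *: z)).
  + apply: lin_addf; first by move=> t z w; rewrite !lin_mulr.
    by apply: lin_scalef => t z w; rewrite !lin_mulr.
  + exact: lin_scalef.
  move=> b z.
  case: a hx => [/S12_odd[u ->]|/S12_even[a ->]]; case: c hy => [/S12_odd[v ->]|/S12_even[c ->]];
    case: b => [/S12_odd[w ->]|/S12_even[b ->]];
    rewrite ?S12_bform11 ?S12_bform01 ?S12_bform10 ?S12_bform00 ?(S12_mul11, S12_mul10, S12_mul01, S12_mul00).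
  + congr (_, _); rewrite /= ?scaler0 ?addr0 // expr1 scaleN1r opprK.
    apply/eqP; rewrite eq_sym addrC -subr_eq0 opprB addrCA addrA [form u w]form_anti.
    by rewrite scaleNr opprK [X in X + _]addrC; apply/eqP/form_cyclic.
  + congr (_, _); rewrite /= ?scaler0 ?addr0 // expr1 !linearNr !linearZr_LR /= [form v u]form_anti.
    have h1 (p t : k) : - (p * t) + -1 * (- (p * (- t))) = t * p.
      by apply: (eq_mod3 char3 (t := - (p * t))); ring.
    exact: h1.
  + congr (_, _); rewrite /= ?scaler0 ?addr0 ?scale0r // expr0 linearNr linearZr_LR /=.
    by rewrite scale1r addNr.
  + congr (_, _); rewrite /= ?scaler0 ?addr0 ?scale0r //.
    by rewrite expr0 scale1r scalerN opprK scalerA addNr.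
  + congr (_, _); rewrite /= ?scaler0 ?addr0 ?scale0r // expr0 linearNr linearZr_LR /=.
    by rewrite scale1r subrr.
  + congr (_, _); rewrite /= ?scaler0 ?addr0 ?scale0r //.
    by rewrite expr0 scale1r scalerN opprK scalerA subrr.
  + congr (_, _); rewrite /= ?scaler0 ?addr0 // expr0 scale1r !scalerN !opprK !scalerA.
    by rewrite [c * a]mulrC (double_char3 char3) scaleNr.
  + congr (_, _); rewrite /= ?scaler0 ?addr0 //.
    have h1 (p q t : k) : p * (q * t) + 1 * (q * (p * t)) = - (p * q) * t.
      by apply: (eq_mod3 char3 (t := p * q * t)); ring.
    exact: h1.
- move=> a c x y; case: a => [/S12_odd[v ->]|/S12_even[a ->]];
    case: c => [/S12_odd[w ->]|/S12_even[b ->]] //.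
  + by rewrite S12_bform10.
  + by rewrite S12_bform01.
Qed.

Local Notation one := ((1, 0) : S).

Lemma S12_one_neq0 : exists z : S, z != 0.
Proof. by exists one; apply/eqP => -[/eqP]; rewrite oner_eq0. Qed.

Lemma S12_split (a : k^o) (v : V) : ((a, v) : S) = a *: one + ((0, v) : S).
Proof. by congr (_, _); rewrite /= ?scaler0 ?add0r // addr0 [_ *: _]mulr1. Qed.

(** d(1) is a multiple c of 1, and b(1,1) = 2 forces c = 0: only an element of sp(V)
    is left. *)
Lemma S12_osp_even (d : end_superspace S) : osp false d ->
  exists f : V -> V, [/\ linear f, forall a v, (d : 'End(S)) (a, v) = (0, f v)
  & forall v w, form (f v) w + form v (f w) = 0].
Proof.
move=> [hd od].
have [c dc] := S12_even ((endhomogP _ _).1 hd _ _ (S12_homog_even 1)).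
have dv v : (d : 'End(S)) (0, v) = (0, ((d : 'End(S)) (0, v)).2).
  by have [w ->] := S12_odd ((endhomogP _ _).1 hd _ _ (S12_homog_odd v)).
have c0 : c = 0.
  have := od _ _ _ _ (S12_homog_even 1) (S12_homog_even 1).
  rewrite dc !S12_bform00 mulr1 !mul1r (double_char3 char3 (- c : k^o)) opprK //.
exists (fun v => ((d : 'End(S)) (0, v)).2); split=> [t u v|a v|v w].
  have -> : ((0, t *: u + v) : S) = t *: ((0, u) : S) + ((0, v) : S).
    by congr (_, _); rewrite /= scaler0 addr0.
  by rewrite linearP.
  by rewrite S12_split linearP /= dc c0 dv; congr (_, _); rewrite /= ?scaler0 ?addr0 ?add0r.
have := od _ _ _ _ (S12_homog_odd v) (S12_homog_odd w).
by rewrite dv (dv w) !S12_bform11 mul1r.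
Qed.

(** The odd part of osp(S) is V, through the value w = d(1); invariance of b determines the
    action on V. *)
Lemma S12_osp_odd (d : end_superspace S) : osp true d ->
  exists w : V, forall (a : k^o) v, (d : 'End(S)) (a, v) = (form w v, a *: w).
Proof.
move=> [hd od].
have [w dw] := S12_odd ((endhomogP _ _).1 hd _ _ (S12_homog_even 1)).
exists w => a v; rewrite S12_split linearP /= dw.
have [c dc] := S12_even ((endhomogP _ _).1 hd _ _ (S12_homog_odd v)).
have := od _ _ _ _ (S12_homog_odd v) (S12_homog_even 1).
rewrite dc dw S12_bform00 S12_bform11 mulr1 expr1 mulN1r => /eqP; rewrite -opprD oppr_eq0.
rewrite addr_eq0 -form_anti => /eqP ->.
by congr (_, _); rewrite /= ?scaler0 ?addr0 ?add0r.
Qed.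

(** An element of sp(V) kills 1 and preserves the form; for the odd element given by w in V,
    the Leibniz rule at u, v is the identity <u|v>w + <v|w>u + <w|u>v = 0. *)
Lemma S12_osp_der i (d : end_superspace S) : osp i d -> in_der i d.
Proof.
move=> od; split; first exact: od.1.
move=> a c x y; case: i od => od.
  have [w dE] := S12_osp_odd od.
  case: a => [/S12_odd[u ->]|/S12_even[a ->]]; case: c => [/S12_odd[v ->]|/S12_even[b ->]];
  rewrite ?(S12_mul11, S12_mul10, S12_mul01, S12_mul00) !dE ?linear0r ?scale0r.
  + rewrite S12_mul01 S12_mul10 expr1 scaleN1r; congr (_, _); rewrite /= ?oppr0 ?addr0 // opprK.
    apply/eqP; rewrite -subr_eq0 opprD opprK addrA addrAC.
    have := form_cyclic u v w; rewrite [form v w]form_anti scaleNr => <-.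
    by rewrite addrAC.
  + rewrite S12_mul00 S12_mul11 expr1 scaleN1r; congr (_, _); rewrite /= ?oppr0 ?addr0 //.
    rewrite linearNr !linearZr_LR /=  [form u w]form_anti.
    have h (p t : k) : - (p * t) = t * p - p * - t.
      by apply: (eq_mod3 char3 (t := - (p * t))); ring.
    exact: h.
  + rewrite S12_mul11 S12_mul00 expr0 scale1r; congr (_, _); rewrite /= ?oppr0 ?addr0 //.
    rewrite linearNr !linearZr_LR !linearZl_LR /=.
    have h (p t : k) : - (p * t) = p * t + p * t.
      by apply: (eq_mod3 char3 (t := - (p * t))); ring.
    exact: h.
  + rewrite S12_mul01 S12_mul10 expr0 scale1r; congr (_, _); rewrite /= ?addr0 //.
    by rewrite !scalerA [b * a]mulrC (double_char3 char3) opprK.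
have [f [fL dE fE]] := S12_osp_even od.
case: a => [/S12_odd[u ->]|/S12_even[a ->]]; case: c => [/S12_odd[v ->]|/S12_even[b ->]];
  rewrite ?(S12_mul11, S12_mul10, S12_mul01, S12_mul00) !dE ?linear0r ?scale0r.
  + rewrite S12_mul11 S12_mul11 scale1r (lin_zero fL); congr (_, _); rewrite /= ?addr0 //.
  + by rewrite S12_mul10 (lin_zero fL) S12_mul10 scale0r oppr0 scaler0 addr0 (lin_opp fL) (lin_scale fL).
  + by rewrite S12_mul01 (lin_zero fL) S12_mul01 scale0r oppr0 scale1r add0r (lin_opp fL) (lin_scale fL).
  + by rewrite S12_mul10 S12_mul01 (lin_zero fL) !scaler0 oppr0 scaler0 addr0.
Qed.

Lemma S12_der_osp i (d : end_superspace S) : in_der i d -> osp i d.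
Proof. exact: (der_osp S12_composition S12_one_neq0). Qed.

(** An even triple has equal components by the triality relation at 1, v and v, 1.  An odd one
    is given by vectors v, v1, v2: the relation at u, u with u in V gives <v2 - v1|u> u = 0, hence
    v1 = v2, and the relation at 1, 1 gives v = - v1 - v2 = v1. *)
Lemma S12_in_tri i (w : {ffun 'Z_3 -> 'End(S)}) : in_tri i w ->
  in_der i (w 0 : end_superspace S) /\ w = [ffun => w 0].
Proof.
move=> [ow tw]; split; first exact: S12_osp_der (ow 0).
suff [e1 e2] : w 1 = w 0 /\ w 2 = w 0.
  by apply/ffunP => j; rewrite ffunE; case: (Z3_cases j) => ->.
case: i ow tw => ow tw.
  have [v d0] := S12_osp_odd (ow 0); have [v1 d1] := S12_osp_odd (ow 1).
  have [v2 d2] := S12_osp_odd (ow 2).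
  have v12 : v1 = v2.
    apply/eqP; rewrite eq_sym -subr_eq0; apply/eqP/form_nondeg => u.
    have [->|nu] := eqVneq u 0; first by rewrite linear0r.
    have := tw _ _ _ _ (S12_homog_odd u) (S12_homog_odd u).
    rewrite S12_mul11 form_alt d0 d1 d2 !scale0r S12_mul01 S12_mul10 linear0r => -[_].
    rewrite expr1 scaleN1r opprK addrC -scalerBl -linearBl => /eqP.
    by rewrite eq_sym scaler_eq0 (negPf nu) orbF => /eqP.
  have v01 : v = v1.
    have := tw _ _ _ _ (S12_homog_even 1) (S12_homog_even 1).
    rewrite S12_mul00 d0 d1 d2 !linear0r S12_mul01 S12_mul10 expr0 scale1r v12 => -[_].
    by rewrite mulr1 !scale1r (double_char3 char3) opprK.
  split; apply/lfunP => -[a u]; rewrite ?d0 ?d1 ?d2 -?v12 v01 //.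
have [f0 [f0L d0 _]] := S12_osp_even (ow 0); have [f1 [f1L d1 _]] := S12_osp_even (ow 1).
have [f2 [f2L d2 _]] := S12_osp_even (ow 2).
split; apply/lfunP => -[a u]; rewrite ?d0 ?d1 ?d2; congr (_, _).
  have := tw _ _ _ _ (S12_homog_odd u) (S12_homog_even 1).
  rewrite S12_mul10 d0 d1 d2 (lin_zero f2L) S12_mul10 S12_mul10 scale0r oppr0 scaler0 addr0 !scale1r.
  by rewrite (lin_opp f0L) => /(congr1 snd) /oppr_inj ->.
have := tw _ _ _ _ (S12_homog_even 1) (S12_homog_odd u).
rewrite S12_mul01 d0 d1 d2 (lin_zero f1L) S12_mul01 S12_mul01 scale0r oppr0 add0r !scale1r.
by rewrite (lin_opp f0L) => /(congr1 snd) /oppr_inj ->.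
Qed.

Lemma S12_tri_diagonal : tri_diagonal S.
Proof.
have tP := sub_vspaceP (W := pow3_superspace (end_superspace S)) (@in_tri_subspace k S).
move=> w; split=> [/tP tw|[d dd ->]].
  exists (w 0).
    rewrite -(hc_sum (w 0 : end_superspace S)) memvD //.
      by have [h _] := S12_in_tri (tw false); rewrite ffunE in h; apply: (in_der_derv h).
    by have [h _] := S12_in_tri (tw true); rewrite ffunE in h; apply: (in_der_derv h).
  apply/ffunP => j; rewrite ffunE.
  rewrite -(hc_sum (w j : end_superspace S)) -(hc_sum (w 0 : end_superspace S)).
  have E i : hc i (w j : end_superspace S) = hc i (w 0 : end_superspace S).
    by have [_ /ffunP/(_ j)] := S12_in_tri (tw i); rewrite !ffunE.
  by rewrite !E.
apply/tP => i; have di := derv_hc i dd.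
have -> : hc i ([ffun=> d] : pow3_superspace (end_superspace S)) = [ffun => hc i (d : end_superspace S)].
  by apply/ffunP => j; rewrite !ffunE.
split=> [j|a c x y hx hy]; first by rewrite ffunE; apply: S12_der_osp.
by rewrite !ffunE; apply: (di.2 a c).
Qed.

End S12.

(** * Derivations of the tensor square of S_{1,2} *)

Section TensorSquare.
Variables (k : fieldType) (char3 : 3%N \in [pchar k]) (V : vectType k).
Variables (form : {biscalar V}) (u0 v0 : V).
Hypothesis form_alt : forall v, form v v = 0.
Hypothesis form_uv : form u0 v0 = 1.
Hypothesis form_span : forall v, v = form v v0 *: u0 + form u0 v *: v0.
Local Notation S := (S12 form).
Local Notation A := (tensor_superalgebra S S).
Local Notation one := ((1, 0) : S).
Local Notation E := (tens one one : A).
Let CS := S12_composition char3 form_alt form_uv form_span.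
Let gA : graded A := tensor_graded (cc_graded CS) (cc_graded CS).
Let cA : supercomm A := tensor_supercomm (cc_comm CS) (cc_comm CS).

Lemma one_homog : homog false one. Proof. by []. Qed.

Lemma S12_one_mul p (x : S) : homog p x -> smul one x = (-1) ^+ p *: x.
Proof.
case: p => [/S12_odd[v ->]|/S12_even[a ->]].
  by rewrite S12_mul01 expr1 scaleN1r scale1r; congr (_, _); rewrite /= oppr0.
by rewrite S12_mul00 expr0 scale1r mul1r.
Qed.

Lemma S12_mul_one p (x : S) : homog p x -> smul x one = (-1) ^+ p *: x.
Proof.
by move=> hx; rewrite (cc_comm CS hx one_homog) andbF scale1r (S12_one_mul hx).
Qed.

(** 1 (x) 1 acts as the parity operator because 1 does so on S. *)
Lemma E_mul a (X : A) : homog a X -> smul E X = (-1) ^+ a *: X.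
Proof.
move: X; apply: (tens_homog_ext (f := fun X => smul E (X : A)) (g := fun X => _ *: X)).
- exact: (@lin_mulr k A E).
- exact: lin_scalef.
move=> p q x y hx hy <-; rewrite (tensor_mulE _ _ one_homog hx) (S12_one_mul hx) (S12_one_mul hy).
by rewrite tensZl tensZr !scalerA; congr (_ *: _); case: p {hx}; case: q {hy} => /=; ring.
Qed.

Lemma mul_E a (X : A) : homog a X -> smul X E = (-1) ^+ a *: X.
Proof.
move=> hX; rewrite (cA hX (homog_tens one_homog one_homog)) andbF scale1r.
exact: E_mul.
Qed.

(** These contractions with the coordinate on k1 read off the two components of an
    odd tensor. *)
Definition contrl (m : A) : S := tlift (fun x y : S => x.1 *: y) m.
Definition contrr (m : A) : S := tlift (fun x y : S => y.1 *: x) m.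

Lemma contrl_linear : linear contrl. Proof. exact: tlift_linear. Qed.
Lemma contrr_linear : linear contrr. Proof. exact: tlift_linear. Qed.

Lemma contrlE x y : contrl (tens x y) = x.1 *: y.
Proof.
rewrite /contrl tlift_tens //; split=> z c u v /=; last by rewrite scalerDr !scalerA mulrC.
by rewrite scalerDl scalerA.
Qed.

Lemma contrrE x y : contrr (tens x y) = y.1 *: x.
Proof.
rewrite /contrr tlift_tens //; split=> z c u v /=; first by rewrite scalerDr !scalerA mulrC.
by rewrite scalerDl scalerA.
Qed.

Lemma contr_homog a (m : A) : homog a m -> homog a (contrl m) /\ homog a (contrr m).
Proof.
move=> hm; split.
  move: m hm; apply: (tens_homog_ext (f := fun m => hc a (contrl m)) (g := contrl)).
  - by move=> c u v; rewrite contrl_linear hc_linear.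
  - exact: contrl_linear.
  move=> p q x y hx hy <-; rewrite contrlE; case: p hx => [/S12_odd[v ->]|_].
    by rewrite [_ *: y]scale0r hc0.
  exact: homogZ.
move: m hm; apply: (tens_homog_ext (f := fun m => hc a (contrr m)) (g := contrr)).
- by move=> c u v; rewrite contrr_linear hc_linear.
- exact: contrr_linear.
move=> p q x y hx hy <-; rewrite contrrE; case: q hy => [/S12_odd[v ->]|_].
  by rewrite [_ *: x]scale0r hc0.
by rewrite addbF; apply: homogZ.
Qed.

Lemma scalar_one (a : k^o) : ((a, 0) : S) = a *: one.
Proof. by rewrite (S12_split form a 0); exact: addr0. Qed.

(** An odd tensor has an even factor, hence is in V (x) 1 + 1 (x) V. *)
Lemma odd_tens (m : A) : homog true m -> m = tens (contrr m) one + tens one (contrl m).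
Proof.
move: m; apply: (tens_homog_ext (f := id)
  (g := fun m => tens (contrr m) one + tens one (contrl m))) => //.
  apply: lin_addf => c u v; first by rewrite contrr_linear lin_tensl.
  by rewrite contrl_linear lin_tensr.
move=> p q x y hx hy; rewrite contrlE contrrE.
case: p hx => [/S12_odd[v ->]|/S12_even[a ->]]; case: q hy => [/S12_odd[w ->]|/S12_even[b ->]] // _.
  by rewrite [X in tens one X]scale0r tens0r addr0 [in LHS](scalar_one b) tensZr tensZl.
by rewrite [X in tens X one]scale0r tens0l add0r [in LHS](scalar_one a) tensZr tensZl.
Qed.

Lemma inner_split (m n : A) : exists d d', [/\ d \in derv S, d' \in derv S &
  (inner_der m n : 'End(A)) = Actl S d + Actr S d'].
Proof.
have TS := S12_tri_diagonal char3 form_alt form_uv form_span.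
have [d hd e] := (TS _).1 (iota_tri_mem char3 CS TS m n).
have [d' hd' e'] := (TS _).1 (iota_tri_mem' char3 CS TS m n).
exists (- d), (- d'); split; rewrite ?memvN //.
rewrite (inner_iota char3 CS CS) e e' !ffunE opprD.
by rewrite (lin_opp (@Actl_linear _ _ _)) (lin_opp (@Actr_linear _ _ _)).
Qed.

(** D commutes with the parity operator L_E because D(E) = 0, and anticommutes with it
    because D is odd. *)
Lemma odd_der_0 (D : end_superspace A) : in_der true D -> (D : 'End(A)) E = 0 -> D = 0 :> 'End(A).
Proof.
move=> [hD dD] DE; apply/lfunP; apply: homog_ext => [||a X hX]; try exact: lin_lfun.
rewrite zero_lfunE; apply: (neg_char3 char3).
have := dD _ _ _ _ (homog_tens one_homog one_homog) hX.
rewrite DE mul0s add0r scale1r (E_mul hX) (E_mul ((endhomogP _ _).1 hD _ _ hX)).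
rewrite (lin_scale (lin_lfun _)); case: a {hX} => /=; rewrite !expr1 ?expr0 ?scaleN1r ?scale1r //.
Qed.

(** For X = D(E), [L_X, L_E] E = X E - E (X E) = - 2 X = X, so that the difference
    kills E. *)
Lemma odd_der_inner (D : end_superspace A) : in_der true D ->
  D = inner_der ((D : 'End(A)) E : A) E :> 'End(A).
Proof.
move=> dD; have hE := homog_tens one_homog one_homog.
have hX := (endhomogP _ _).1 dD.1 _ _ hE; set X := (D : 'End(A)) E in hX *.
apply/eqP; rewrite -subr_eq0; apply/eqP; apply: odd_der_0.
  have [d [d' [hd hd' e]]] := inner_split X E.
  have hI : in_der true (inner_der (X : A) E).
    rewrite -(inner_homog gA hX hE); apply: derv_hc.
    by rewrite e memvD // ?Actl_derv ?Actr_derv //; exact: cc_graded CS.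
  rewrite addrC -scaleN1r; exact: (in_der_subspace _ _).2.
rewrite add_lfunE opp_lfunE (innerE _ gA hX hE) !(E_mul hE) (mul_E hX) !expr0 !scale1r.
rewrite mulsZ (E_mul hX) (mul_E hX) !expr1 !scaleN1r opprK.
by rewrite -opprD (double_char3 char3) opprK subrr.
Qed.

(** Contractions with <z|.>, which separate u (x) b(w) from w (x) b(u) for z = w. *)
Definition forml z (m : A) : S := tlift (fun x y : S => form z x.2 *: y) m.
Definition formr z (m : A) : S := tlift (fun x y : S => form z y.2 *: x) m.

Lemma formlE z x y : forml z (tens x y) = form z x.2 *: y.
Proof.
rewrite /forml tlift_tens //; split=> w c u v /=; last by rewrite scalerDr !scalerA mulrC.
by rewrite linearPr scalerDl scalerA.
Qed.

Lemma formrE z x y : formr z (tens x y) = form z y.2 *: x.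
Proof.
rewrite /formr tlift_tens //; split=> w c u v /=; first by rewrite scalerDr !scalerA mulrC.
by rewrite linearPr scalerDl scalerA.
Qed.

Lemma even_der_E (D : end_superspace A) : in_der false D -> (D : 'End(A)) E = 0.
Proof.
move=> [hD dD]; have hE := homog_tens one_homog one_homog; apply: (neg_char3 char3).
have := dD _ _ _ _ hE hE.
rewrite (E_mul hE) (E_mul ((endhomogP _ _).1 hD _ _ hE)) (mul_E ((endhomogP _ _).1 hD _ _ hE)).
by rewrite !expr0 !scale1r (double_char3 char3).
Qed.

Lemma form_kill (W : vectType k) (f : V -> W) : (forall u w, form w u *: f w = 0) ->
  forall w, w != 0 -> f w = 0.
Proof.
move=> h w nw; apply: contraNeq nw => nf; apply/eqP/(form_nondeg form_alt form_span) => u.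
by have /eqP := h u w; rewrite scaler_eq0 (negPf nf) orbF => /eqP.
Qed.

(** D(u (x) 1) is odd, say a(u) (x) 1 + 1 (x) b(u).  As (u (x) 1)(w (x) 1) = <u|w> E is killed by D, the
    component in V (x) V of the Leibniz rule reads u (x) b(w) = w (x) b(u); contracting the left
    factor with <w|.> gives <w|u> b(w) = 0 for all u, hence b = 0. *)
Lemma even_der_left (D : end_superspace A) : in_der false D ->
  forall x, (D : 'End(A)) (tens x one) = tens (contrr ((D : 'End(A)) (tens x one))) one.
Proof.
move=> dD; have DE := even_der_E dD; have [hD lD] := dD.
have hu (u : V) := homog_tens (S12_homog_odd form u) one_homog.
pose O u := (D : 'End(A)) (tens ((0, u) : S) one) : A.
have hO u : homog true (O u) := (endhomogP _ _).1 hD _ _ (hu u).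
have Oe u : O u = tens (contrr (O u)) one + tens one (contrl (O u)) := odd_tens (hO u).
pose al u := (contrr (O u)).2; pose be u := (contrl (O u)).2.
have alE u : contrr (O u) = (0, al u) by have [w e] := S12_odd (contr_homog (hO u)).2; rewrite /al e.
have beE u : contrl (O u) = (0, be u) by have [w e] := S12_odd (contr_homog (hO u)).1; rewrite /be e.
have bk u w : form w u *: be w = 0.
  have := lD _ _ _ _ (hu u) (hu w).
  rewrite (tensor_mulE _ _ one_homog (S12_homog_odd form w)) S12_mul11 S12_mul00 scale1r.
  rewrite -/(O u) -/(O w) (Oe u) (Oe w) !alE !beE mulDs mulsD.
  rewrite (tensor_mulE _ _ one_homog (S12_homog_odd form w)) (tensor_mulE _ _ one_homog one_homog).
  rewrite (tensor_mulE _ _ (S12_homog_odd form (be u)) (S12_homog_odd form w)).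
  rewrite (tensor_mulE _ _ one_homog (S12_homog_odd form (al w))).
  rewrite !(S12_mul11, S12_mul10, S12_mul01, S12_mul00) !scale1r mul1r (scalar_one (form u w)) tensZl.
  rewrite (lin_scale (lin_lfun _)) DE scaler0 => /(congr1 (forml w)).
  have fL : linear (forml w) by exact: tlift_linear.
  rewrite !(lin_add fL) !(lin_scale fL) (lin_zero fL) !formlE /= !linear0r !linearNr /= form_alt.
  rewrite oppr0 !scale0r !scaler0 !add0r => /(congr1 snd) /=.
  by rewrite scaleNr scalerN opprK => <-.
have be0 w : be w = 0.
  have [->|nw] := eqVneq w 0; last exact: (form_kill bk nw).
  by rewrite /be /O tens0l !linear0 (lin_zero contrl_linear).
apply: (homog_ext (f := fun x : S => (D : 'End(A)) (tens x one) : A)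
  (g := fun x : S => tens (contrr ((D : 'End(A)) (tens x one))) one : A)).
- by move=> c x y; rewrite lin_tensl linearP.
- by move=> c x y; rewrite lin_tensl linearP contrr_linear lin_tensl.
move=> p x; case: p => [/S12_odd[u ->]|/S12_even[a ->]].
  by rewrite -/(O u) {1}Oe beE be0 tens0r addr0.
by rewrite scalar_one tensZl (lin_scale (lin_lfun _)) DE scaler0 (lin_zero contrr_linear) tens0l.
Qed.

(** The same argument with the two factors exchanged. *)
Lemma even_der_right (D : end_superspace A) : in_der false D ->
  forall x, (D : 'End(A)) (tens one x) = tens one (contrl ((D : 'End(A)) (tens one x))).
Proof.
move=> dD; have DE := even_der_E dD; have [hD lD] := dD.
have hu (u : V) := homog_tens one_homog (S12_homog_odd form u).
pose O u := (D : 'End(A)) (tens one ((0, u) : S)) : A.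
have hO u : homog true (O u) := (endhomogP _ _).1 hD _ _ (hu u).
have Oe u : O u = tens (contrr (O u)) one + tens one (contrl (O u)) := odd_tens (hO u).
pose al u := (contrr (O u)).2; pose be u := (contrl (O u)).2.
have alE u : contrr (O u) = (0, al u) by have [w e] := S12_odd (contr_homog (hO u)).2; rewrite /al e.
have beE u : contrl (O u) = (0, be u) by have [w e] := S12_odd (contr_homog (hO u)).1; rewrite /be e.
have ak u w : form w u *: al w = 0.
  have := lD _ _ _ _ (hu u) (hu w).
  rewrite (tensor_mulE _ _ (S12_homog_odd form u) one_homog) S12_mul11 S12_mul00 scale1r.
  rewrite -/(O u) -/(O w) (Oe u) (Oe w) !alE !beE mulDs mulsD.
  rewrite (tensor_mulE _ _ (S12_homog_odd form (be u)) one_homog) (tensor_mulE _ _ one_homog one_homog).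
  rewrite (tensor_mulE _ _ (S12_homog_odd form u) (S12_homog_odd form (al w))).
  rewrite (tensor_mulE _ _ (S12_homog_odd form u) one_homog).
  rewrite !(S12_mul11, S12_mul10, S12_mul01, S12_mul00) !scale1r mul1r (scalar_one (form u w)) tensZr.
  rewrite (lin_scale (lin_lfun _)) DE scaler0 => /(congr1 (formr w)).
  have fL : linear (formr w) by exact: tlift_linear.
  rewrite !(lin_add fL) !(lin_scale fL) (lin_zero fL) !formrE /= !linear0r !linearNr /= form_alt.
  rewrite oppr0 !scale0r !addr0 add0r => /(congr1 snd) /=.
  by rewrite expr1 scaleN1r scaleNr scalerN !opprK => /eqP; rewrite eq_sym oppr_eq0 => /eqP.
have al0 w : al w = 0.
  have [->|nw] := eqVneq w 0; last exact: (form_kill ak nw).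
  by rewrite /al /O tens0r !linear0 (lin_zero contrr_linear).
apply: (homog_ext (f := fun x : S => (D : 'End(A)) (tens one x) : A)
  (g := fun x : S => tens one (contrl ((D : 'End(A)) (tens one x))) : A)).
- by move=> c x y; rewrite lin_tensr linearP.
- by move=> c x y; rewrite lin_tensr linearP contrl_linear lin_tensr.
move=> p x; case: p => [/S12_odd[u ->]|/S12_even[a ->]].
  by rewrite -/(O u) {1}Oe alE al0 tens0l add0r.
by rewrite scalar_one tensZr (lin_scale (lin_lfun _)) DE scaler0 (lin_zero contrl_linear) tens0r.
Qed.

(** The restrictions to S (x) 1 and 1 (x) S are derivations of S, and they determine D because
    x (x) y is, up to sign, the product of x (x) 1 and 1 (x) y. *)
Lemma even_der_split (D : end_superspace A) : in_der false D -> exists d d' : end_superspace S,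
  [/\ in_der false d, in_der false d' & (D : 'End(A)) = Actl S d + Actr S d'].
Proof.
move=> dD; have Dl := even_der_left dD; have Dr := even_der_right dD; have [hD lD] := dD.
pose d : end_superspace S := linfun (fun x : S => contrr ((D : 'End(A)) (tens x one))).
pose d' : end_superspace S := linfun (fun x : S => contrl ((D : 'End(A)) (tens one x))).
have dE x : (d : 'End(S)) x = contrr ((D : 'End(A)) (tens x one)).
  by rewrite linfunE_lin // => c u v; rewrite lin_tensl linearP contrr_linear.
have d'E x : (d' : 'End(S)) x = contrl ((D : 'End(A)) (tens one x)).
  by rewrite linfunE_lin // => c u v; rewrite lin_tensr linearP contrl_linear.
have {}Dl x : (D : 'End(A)) (tens x one) = tens ((d : 'End(S)) x) one by rewrite dE -Dl.
have {}Dr x : (D : 'End(A)) (tens one x) = tens one ((d' : 'End(S)) x) by rewrite d'E -Dr.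
have hd : homog false d.
  apply/endhomogP => a x hx; rewrite dE addbF.
  have := (contr_homog ((endhomogP _ _).1 hD _ _ (homog_tens hx one_homog))).2.
  by rewrite !addbF.
have hd' : homog false d'.
  apply/endhomogP => a x hx; rewrite d'E addbF.
  have := (contr_homog ((endhomogP _ _).1 hD _ _ (homog_tens one_homog hx))).1.
  by rewrite !addbF addFb.
have cl x : contrl (tens one x) = x by rewrite contrlE scale1r.
have cr x : contrr (tens x one) = x by rewrite contrrE scale1r.
exists d, d'; split.
- split=> // a c x y hx hy.
  have := lD _ _ _ _ (homog_tens hx one_homog) (homog_tens hy one_homog).
  rewrite (tensor_mulE _ _ one_homog hy) S12_mul00 mul1r !scale1r !Dl.
  rewrite (tensor_mulE _ _ one_homog hy) (tensor_mulE _ _ one_homog ((endhomogP _ _).1 hd _ _ hy)).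
  rewrite S12_mul00 mul1r !scale1r -tensDl => /(congr1 contrr).
  by rewrite !cr.
- split=> // a c x y hx hy.
  have := lD _ _ _ _ (homog_tens one_homog hx) (homog_tens one_homog hy).
  have hdx := (endhomogP _ _).1 hd' _ _ hx.
  rewrite (tensor_mulE _ _ hx one_homog) S12_mul00 mul1r andbF !scale1r !Dr.
  rewrite (tensor_mulE _ _ hdx one_homog) (tensor_mulE _ _ hx one_homog).
  rewrite S12_mul00 mul1r !andbF !scale1r -tensDr => /(congr1 contrl).
  by rewrite !cl.
apply/lfunP; apply: tens_ext_homog => [||p q x y hx hy]; try exact: lin_lfun.
have sK (b : bool) (U : lmodType k) (v : U) : (-1) ^+ b *: ((-1) ^+ b *: v) = v.
  by rewrite scalerA -expr2 sqrr_sign scale1r.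
have ex p' (x' : S) (y' : S) : homog p' x' -> homog q y' ->
    smul (tens x' one : A) (tens one y') = (-1) ^+ p' *: ((-1) ^+ q *: tens x' y').
  move=> hx' hy'; rewrite (tensor_mulE _ _ one_homog one_homog) scale1r.
  by rewrite (S12_mul_one hx') (S12_one_mul hy') tensZl tensZr.
have exy : tens x y = (-1) ^+ q *: ((-1) ^+ p *: smul (tens x one : A) (tens one y)).
  by rewrite (ex _ _ _ hx hy) sK sK.
have hdx := (endhomogP _ _).1 hd _ _ hx; have hdy := (endhomogP _ _).1 hd' _ _ hy.
rewrite {1}exy !(lin_scale (lin_lfun _)).
rewrite (lD _ _ _ _ (homog_tens hx one_homog) (homog_tens one_homog hy)).
rewrite scale1r Dl Dr add_lfunE ActlE (ActrE _ hd' hx) scale1r.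
rewrite addbF in hdx; rewrite addbF in hdy.
by rewrite (ex _ _ _ hdx hy) (ex _ _ _ hx hdy) !scalerDr !sK.
Qed.

Lemma S12_der_surj (D : 'End(A)) : D \in derv A -> exists d d',
  [/\ d \in derv S, d' \in derv S & D = Actl S d + Actr S d'].
Proof.
move=> dD; have dt := derv_hc true dD; have df := derv_hc false dD.
have [d1 [d1' [h1 h1' e1]]] := inner_split ((hc true (D : end_superspace A) : 'End(A)) E) E.
have [d2 [d2' [h2 h2' e2]]] := even_der_split df.
exists (d2 + d1), (d2' + d1').
split; try (by apply: memvD => //; apply: in_der_derv; eassumption).
rewrite (lin_add (@Actl_linear _ _ _)) (lin_add (@Actr_linear _ _ _)).
by rewrite addrACA -e1 -e2 -(odd_der_inner dt) [RHS](hc_sum (D : end_superspace A)).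
Qed.

(** Evaluate at 1 (x) 1: d(1) (x) 1 + 1 (x) d'(1) = 0 with d(1) in V, so d'(1) = 0.  Then
    evaluating at x (x) 1 gives d = 0. *)
Lemma S12_der_inj d d' : d \in derv S -> d' \in derv S ->
  Actl S d + Actr S d' = 0 -> d = 0 /\ d' = 0.
Proof.
move=> dd dd' e.
have H i : hc i (d : end_superspace S) = 0 /\ hc i (d' : end_superspace S) = 0.
  have := congr1 (fun f : end_superspace A => hc i f) e.
  rewrite hcD Actl_hc Actr_hc hc0.
  move: (derv_hc i dd) (derv_hc i dd').
  move: (hc i (d : end_superspace S)) (hc i (d' : end_superspace S)) => f f' df df' {}e.
  have ff (x y : S) : Actl S f (tens x y) + Actr S f' (tens x y) = 0.
    by rewrite -add_lfunE e zero_lfunE.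
  have [w fw] : exists w, (f : 'End(S)) one = (0, w).
    case: i df df' => df df'.
      have [w fE] := S12_osp_odd char3 form_alt (S12_der_osp char3 form_alt form_uv form_span df).
      by exists w; rewrite fE linear0r scale1r.
    have [g [gL fE _]] := S12_osp_even char3 (S12_der_osp char3 form_alt form_uv form_span df).
    by exists (g 0); rewrite fE.
  have fw' : (f' : 'End(S)) one = 0.
    have := ff one one; rewrite ActlE (ActrE _ df'.1 one_homog) andbF scale1r.
    move=> /(congr1 contrl); rewrite (lin_add contrl_linear) (lin_zero contrl_linear) !contrlE fw.
    by rewrite [X in X + _]scale0r scale1r add0r.
  have f0 : f = 0 :> 'End(S).
    apply/lfunP; apply: homog_ext => [||p x hx]; try exact: lin_lfun.
    have := ff x one; rewrite ActlE (ActrE _ df'.1 hx) fw' tens0r scaler0 addr0.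
    by move=> /(congr1 contrr); rewrite (lin_zero contrr_linear) contrrE scale1r zero_lfunE.
  split=> //; apply/lfunP => x; have := ff one x.
  rewrite ActlE (ActrE _ df'.1 one_homog) andbF scale1r f0 zero_lfunE tens0l add0r.
  by move=> /(congr1 contrl); rewrite (lin_zero contrl_linear) contrlE scale1r zero_lfunE.
split; first by rewrite -(hc_sum (d : end_superspace S)) !(H _).1 addr0.
by rewrite -(hc_sum (d' : end_superspace S)) !(H _).2 addr0.
Qed.

End TensorSquare.

(** * Isomorphic superalgebras *)

Section Isomorphisms.
Variable k : fieldType.

Definition iso_pair (A B : superalgebra k) (f : A -> B) (g : B -> A) :=
  [/\ linear f, cancel f g, cancel g f, forall i x, f (hc i x) = hc i (f x)
    & forall x y, f (smul x y) = smul (f x) (f y)].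

Lemma iso_pair_sym A B f g : @iso_pair A B f g -> iso_pair g f.
Proof.
move=> [fL fK gK fh fM]; split=> //.
- by move=> a x y; apply: (can_inj fK); rewrite fL !gK.
- by move=> i x; apply: (can_inj fK); rewrite fh !gK.
- by move=> x y; apply: (can_inj fK); rewrite fM !gK.
Qed.

Lemma iso_pairP A B : superalgebra_iso A B -> exists f g, @iso_pair A B f g.
Proof. by move=> [f [fL [g fK gK] fh fM]]; exists f, g. Qed.

Lemma superalgebra_iso_trans (A B C : superalgebra k) :
  superalgebra_iso A B -> superalgebra_iso B C -> superalgebra_iso A C.
Proof.
move=> [f [fL fB fh fM]] [g [gL gB gh gM]]; exists (fun x => g (f x)); split.
- by move=> a x y; rewrite fL gL.
- exact: bij_comp.
- by move=> i x; rewrite fh gh.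
- by move=> x y; rewrite fM gM.
Qed.

Lemma iso_homog A B f g a x : @iso_pair A B f g -> homog a x -> homog a (f x).
Proof. by move=> [_ _ _ fh _] hx; rewrite /homog -fh hx. Qed.

Section Tensor.
Variables (A B A' B' : superalgebra k) (f : A -> B) (g : B -> A) (f' : A' -> B') (g' : B' -> A').
Hypotheses (fg : iso_pair f g) (fg' : iso_pair f' g').

Definition tens_map (m : tensor A A') : tensor B B' := tlift (fun x y => tens (f x) (f' y)) m.

Lemma tens_map_linear : linear tens_map. Proof. exact: tlift_linear. Qed.

Lemma tens_mapE x y : tens_map (tens x y) = tens (f x) (f' y).
Proof.
rewrite /tens_map tlift_tens //; case: fg fg' => [fL _ _ _ _] [fL' _ _ _ _].
by apply: bilin_comp => //; exact: tens_bilinear.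
Qed.

Lemma tens_mapM (m n : tensor_superalgebra A A') :
  tens_map (smul m n) = smul (tens_map m : tensor_superalgebra B B') (tens_map n).
Proof.
have tL := tens_map_linear.
apply: (tens_ext_homog (f := fun m => tens_map (smul (m : tensor_superalgebra A A') n))
  (g := fun m => smul (tens_map m : tensor_superalgebra B B') (tens_map n))).
- by move=> c u v; rewrite lin_mull tL.
- by move=> c u v; rewrite tL lin_mull.
move=> p q x y hx hy.
apply: (tens_ext_homog (f := fun n => tens_map (smul (tens x y : tensor_superalgebra A A') n))
  (g := fun n => smul (tens_map (tens x y) : tensor_superalgebra B B') (tens_map n))).
- by move=> c u v; rewrite lin_mulr tL.
- by move=> c u v; rewrite tL lin_mulr.
move=> p' q' x' y' hx' hy'.
rewrite (tensor_mulE _ _ hy hx') (lin_scale tL) !tens_mapE.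
rewrite (tensor_mulE _ _ (iso_homog fg' hy) (iso_homog fg hx')).
by case: fg fg' => [_ _ _ _ ->] [_ _ _ _ ->].
Qed.

Lemma tens_map_hc i (m : tensor_superspace A A') :
  tens_map (hc i m) = hc i (tens_map m : tensor_superspace B B').
Proof.
have tL := tens_map_linear.
apply: (tens_ext_homog (f := fun m => tens_map (hc i (m : tensor_superspace A A')))
  (g := fun m => hc i (tens_map m : tensor_superspace B B'))).
- by move=> c u v; rewrite hc_linear tL.
- by move=> c u v; rewrite tL hc_linear.
move=> p q x y hx hy; rewrite tens_mapE (hc_homog _ (homog_tens hx hy)).
rewrite (hc_homog _ (homog_tens (iso_homog fg hx) (iso_homog fg' hy))).
by case: ifP; rewrite ?tens_mapE ?(lin_zero tL).
Qed.
End Tensor.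

Lemma tensor_iso (A B A' B' : superalgebra k) : superalgebra_iso A B -> superalgebra_iso A' B' ->
  superalgebra_iso (tensor_superalgebra A A') (tensor_superalgebra B B').
Proof.
move=> /iso_pairP [f [g fg]] /iso_pairP [f' [g' fg']].
have [gf gf'] := (iso_pair_sym fg, iso_pair_sym fg').
exists (tens_map f f'); split.
- exact: tens_map_linear.
- exists (tens_map g g').
    apply: (tens_ext (f := fun m => tens_map g g' (tens_map f f' m)) (g := id)) => //.
      by move=> c u v; rewrite !tens_map_linear.
    move=> x y; rewrite (tens_mapE fg fg') (tens_mapE gf gf').
    by case: fg fg' => [_ -> _ _ _] [_ -> _ _ _].
  apply: (tens_ext (f := fun m => tens_map f f' (tens_map g g' m)) (g := id)) => //.
    by move=> c u v; rewrite !tens_map_linear.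
  move=> x y; rewrite (tens_mapE gf gf') (tens_mapE fg fg').
  by case: fg fg' => [_ _ -> _ _] [_ _ -> _ _].
- by move=> i x; apply: (tens_map_hc fg fg').
- by move=> x y; apply: (tens_mapM fg fg').
Qed.

Section Conjugation.
Variables (A B : superalgebra k) (f : A -> B) (g : B -> A).
Hypothesis fg : iso_pair f g.

Definition conj_end (D : 'End(A)) : 'End(B) := linfun (fun y : B => f (D (g y))).

Lemma conj_endE D y : conj_end D y = f (D (g y)).
Proof.
have [fL _ _ _ _] := fg; have [gL _ _ _ _] := iso_pair_sym fg.
by rewrite /conj_end linfunE_lin // => c u v; rewrite gL linearP fL.
Qed.

Lemma conj_end_linear : linear conj_end.
Proof.
move=> c D D'; apply/lfunP => y; rewrite add_lfunE scale_lfunE !conj_endE add_lfunE scale_lfunE.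
by have [fL _ _ _ _] := fg; rewrite fL.
Qed.

Lemma conj_end_homog i (D : end_superspace A) : homog i D -> homog (V := end_superspace B) i (conj_end D).
Proof.
move=> hD; apply/endhomogP => a y hy; rewrite conj_endE.
by apply: (iso_homog fg); apply: (endhomogP _ _).1 hD _ _ _; apply: (iso_homog (iso_pair_sym fg)).
Qed.

Lemma conj_end_hc i (D : end_superspace A) :
  hc i (conj_end D : end_superspace B) = conj_end (hc i D).
Proof.
rewrite -{1}(hc_sum D) (lin_add conj_end_linear) hcD.
rewrite !(hc_homog _ (conj_end_homog (homog_hc _ _))).
by case: i; rewrite ?addr0 ?add0r.
Qed.

Lemma conj_end_derv (D : 'End(A)) : D \in derv A -> conj_end D \in derv B.
Proof.
move=> dD; apply/dervP => i; rewrite conj_end_hc; have [hD lD] := derv_hc i dD.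
have [fL fK gK fh fM] := fg; have [gL _ _ gh gM] := iso_pair_sym fg.
split; first exact: conj_end_homog.
move=> a c x y hx hy; rewrite !conj_endE gM.
rewrite (lD _ _ _ _ (iso_homog (iso_pair_sym fg) hx) (iso_homog (iso_pair_sym fg) hy)).
by rewrite (lin_add fL) (lin_scale fL) !fM !gK.
Qed.

Lemma conj_end_scomm (D D' : end_superspace A) :
  conj_end (scomm D D') = scomm (conj_end D : end_superspace B) (conj_end D').
Proof.
have [fL fK gK fh fM] := fg.
apply: (@bilin_homog_ext k (end_superspace A) (end_superspace A) _
  (fun D D' => conj_end (scomm (D : end_superspace A) D'))
  (fun D D' => scomm (conj_end D : end_superspace B) (conj_end D'))).
- apply: (bilin_post (g := conj_end)); [exact: scomm_bilinear | exact: conj_end_linear].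
- apply: (bilin_comp (g := conj_end) (h := conj_end)); [exact: scomm_bilinear | exact: conj_end_linear..].
move=> a b {}D {}D' hD hD'; apply/lfunP => y.
rewrite (scommE _ (conj_end_homog hD) (conj_end_homog hD')) !conj_endE !fK (scommE _ hD hD').
by rewrite (lin_add fL) (lin_opp fL) (lin_scale fL).
Qed.

Lemma conj_end_inner (x y : A) : conj_end (inner_der x y) = inner_der (f x) (f y).
Proof.
have [fL fK gK fh fM] := fg.
have e z : conj_end (lmul z) = lmul (f z).
  by apply/lfunP => w; rewrite conj_endE !lmulE fM gK.
by rewrite conj_end_scomm !e.
Qed.
End Conjugation.

Section TKKMap.
Variables (char3 : 3%N \in [pchar k]) (A B : superalgebra k) (f : A -> B) (g : B -> A).
Hypothesis fg : iso_pair f g.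
Hypothesis inner_derA : forall x y : A, (inner_der x y : 'End(A)) \in derv A.
Local Notation QA := (tensor_superspace (even_superspace (subvs_of (Q0 k))) A).
Local Notation QB := (tensor_superspace (even_superspace (subvs_of (Q0 k))) B).

Definition tkk_hmap (C D : superalgebra k) (h : C -> D)
    (m : tensor (subvs_of (Q0 k)) C) : tensor (subvs_of (Q0 k)) D :=
  tlift (fun a x => tens a (h x)) m.

Lemma tkk_hmap_linear C D h : linear (@tkk_hmap C D h). Proof. exact: tlift_linear. Qed.

Lemma tkk_hmapE (C D : superalgebra k) (h : C -> D) a x : linear h ->
  tkk_hmap h (tens a x) = tens a (h x).
Proof.
move=> hL; rewrite /tkk_hmap tlift_tens //.
apply: (bilin_comp (g := id)) => //; exact: tens_bilinear.
Qed.

Let fL : linear f. Proof. by case: fg. Qed.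
Let hL := tkk_hmap_linear f.

Definition tkk_map (X : tkk_superalgebra A) : tkk_superalgebra B :=
  (tkk_hmap f X.1, der_proj (conj_end f g (der_fun X.2))).

Lemma tkk_hmap_hc i (m : QA) : tkk_hmap f (hc i m) = hc i (tkk_hmap f m : QB).
Proof.
apply: (tens_ext (f := fun m => tkk_hmap f (hc i (m : QA)))
  (g := fun m => hc i (tkk_hmap f m : QB))).
- by move=> c u v; rewrite hc_linear hL.
- by move=> c u v; rewrite hL hc_linear.
move=> a x; rewrite tkk_hmapE // ![hc _ _]tensor_hc_tens !sum_bool.
rewrite [X in _ + X]tens0l [X in _ = _ + X]tens0l !addr0 tkk_hmapE //.
by case: fg => _ _ _ -> _.
Qed.

Lemma tkk_map_hc i X : tkk_map (hc i X) = hc i (tkk_map X).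
Proof.
congr (_, _); first exact: tkk_hmap_hc.
have e (C : superalgebra k) (d : der C) : der_fun (hc i d) = hc i (der_fun d : end_superspace C).
  by rewrite /der_fun val_sub_hc //; exact: in_der_subspace.
apply: subvs_inj; rewrite -!/(der_fun _) !e !der_funK ?(conj_end_hc fg) //.
  exact/(conj_end_derv fg)/der_fun_derv.
by rewrite -e; exact/(conj_end_derv fg)/der_fun_derv.
Qed.

Lemma tkk_map_linear : linear tkk_map.
Proof.
move=> c X Y; congr (_, _); first exact: hL.
have vL : linear (@der_fun k A) by move=> t u v; rewrite /der_fun (linearP (@vsval _ _ _)).
have -> : der_fun (c *: X + Y).2 = c *: der_fun X.2 + der_fun Y.2 := vL c X.2 Y.2.
by rewrite (conj_end_linear fg) /der_proj linearP.
Qed.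

Lemma tkk_map_act (d : der A) (m : QA) :
  tkk_hmap f (der_act d m) = der_act (der_proj (conj_end f g (der_fun d))) (tkk_hmap f m : QB).
Proof.
have [_ fK _ _ _] := fg.
have aE (C : superalgebra k) (e : der C) a x :
    der_act e (tens a x : tensor_superspace (even_superspace (subvs_of (Q0 k))) C) = tens a (der_fun e x).
  rewrite /der_act tlift_tens //; apply: (bilin_comp (g := id)) => //; first exact: tens_bilinear.
  exact: lin_lfun.
apply: (tens_ext (f := fun m => tkk_hmap f (der_act d (m : QA)))
  (g := fun m => der_act (der_proj (conj_end f g (der_fun d))) (tkk_hmap f m : QB))).
- by move=> c u v; rewrite -hL /der_act tlift_linear.
- by move=> c u v; rewrite hL /der_act tlift_linear.
move=> a x; rewrite aE !tkk_hmapE // aE der_funK ?(conj_endE fg) ?fK //.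
exact/(conj_end_derv fg)/der_fun_derv.
Qed.

Lemma tkk_map_mul (m n : QA) :
  tkk_hmap f (tkk_mul m n) = tkk_mul (tkk_hmap f m : QB) (tkk_hmap f n : QB).
Proof.
have [al ar] : bilinear_for *:%R *:%R (@tkk_mul k A) by exact: tlift2_bilinear.
have [bl br] : bilinear_for *:%R *:%R (@tkk_mul k B) by exact: tlift2_bilinear.
apply: (tens_ext (f := fun m => tkk_hmap f (tkk_mul (m : QA) n))
  (g := fun m => tkk_mul (tkk_hmap f m : QB) (tkk_hmap f n : QB))).
- by move=> c u v; rewrite -hL -al.
- by move=> c u v; rewrite hL -bl.
move=> a x; apply: (tens_ext (f := fun n => tkk_hmap f (tkk_mul (tens a x : QA) (n : QA)))
  (g := fun n => tkk_mul (tkk_hmap f (tens a x) : QB) (tkk_hmap f n : QB))).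
- by move=> c u v; rewrite -hL -ar.
- by move=> c u v; rewrite hL -br.
by move=> b y; rewrite tkk_mulE !tkk_hmapE // tkk_mulE; case: fg => _ _ _ _ ->.
Qed.

Lemma tkk_map_der (m n : QA) :
  conj_end f g (tkk_der m n) = tkk_der (tkk_hmap f m : QB) (tkk_hmap f n : QB).
Proof.
have cL := conj_end_linear fg.
have [al ar] : bilinear_for *:%R *:%R (@tkk_der k A) by exact: tlift2_bilinear.
have [bl br] : bilinear_for *:%R *:%R (@tkk_der k B) by exact: tlift2_bilinear.
apply: (tens_ext (f := fun m => conj_end f g (tkk_der (m : QA) n))
  (g := fun m => tkk_der (tkk_hmap f m : QB) (tkk_hmap f n : QB) : 'End(B))).
- by move=> c u v; rewrite -cL -al.
- by move=> c u v; rewrite hL -bl.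
move=> a x; apply: (tens_ext (f := fun n => conj_end f g (tkk_der (tens a x : QA) (n : QA)))
  (g := fun n => tkk_der (tkk_hmap f (tens a x) : QB) (tkk_hmap f n : QB) : 'End(B))).
- by move=> c u v; rewrite -cL -ar.
- by move=> c u v; rewrite hL -br.
move=> b y; rewrite !tkk_hmapE // !(tkk_derE char3).
by rewrite (lin_scale cL) (conj_end_inner fg).
Qed.

Lemma tkk_der_derv (m n : QA) : (tkk_der m n : 'End(A)) \in derv A.
Proof.
have [al ar] : bilinear_for *:%R *:%R (@tkk_der k A) by exact: tlift2_bilinear.
apply: (tens_mem (f := fun m => tkk_der (m : QA) n : 'End(A))) => [|p q a x _ _]; first exact: al.
apply: (tens_mem (f := fun n => tkk_der (tens a x : QA) (n : QA) : 'End(A))) => [|p' q' b y _ _]; first exact: ar.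
by rewrite (tkk_derE char3) memvZ.
Qed.

Lemma tkk_mapM X Y : tkk_map (smul X Y) = smul (tkk_map X) (tkk_map Y).
Proof.
congr (_, _).
  rewrite /= (lin_add hL) tkk_map_mul (lin_add hL) (lin_opp hL) tkk_map_act.
  congr (_ + (_ - _)).
  rewrite (lin_bigsum hL); apply: eq_bigr => a _; rewrite (lin_bigsum hL); apply: eq_bigr => c _.
  rewrite (lin_scale hL) tkk_map_act tkk_hmap_hc; congr (_ *: der_act _ _).
  by have := congr1 snd (tkk_map_hc a Y).
have cL := conj_end_linear fg.
have pL (C : superalgebra k) : linear (@der_proj k C) by move=> c u v; rewrite /der_proj linearP.
have vL (C : superalgebra k) : linear (@der_fun k C) by move=> c u v; rewrite /der_fun (linearP (@vsval _ _ _)).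
have cd := conj_end_derv fg.
have -> : der_fun (smul X Y).2 =
    der_fun (der_proj (tkk_der X.1 Y.1)) + der_fun (der_bracket X.2 Y.2) := lin_add (vL A) _ _.
rewrite (lin_add cL) [LHS](lin_add (pL _)); congr (_ + _).
  by rewrite der_funK ?tkk_der_derv // tkk_map_der.
rewrite /der_bracket !der_funK ?(conj_end_scomm fg) //; try exact/cd/der_fun_derv.
by apply: scomm_derv; apply: der_fun_derv.
Qed.

End TKKMap.

(** The hypothesis makes the inner derivations genuine elements of der A, where [der_proj]
    commutes with conjugation. *)
Lemma tkk_iso (char3 : 3%N \in [pchar k]) (A B : superalgebra k) :
  (forall x y : A, (inner_der x y : 'End(A)) \in derv A) ->
  superalgebra_iso A B -> superalgebra_iso (tkk_superalgebra A) (tkk_superalgebra B).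
Proof.
move=> iA /iso_pairP [f [g fg]]; have gf := iso_pair_sym fg.
have K (C D : superalgebra k) (h : C -> D) (h' : D -> C) : iso_pair h h' ->
    cancel (tkk_map h h') (tkk_map h' h).
  move=> hh [m d]; have hh' := iso_pair_sym hh; have [hL hK _ _ _] := hh; have [hL' _ _ _ _] := hh'.
  congr (_, _).
    apply: (tens_ext (f := fun m => tkk_hmap h' (tkk_hmap h m)) (g := id)) => //.
      by move=> c u v; rewrite !tkk_hmap_linear.
    by move=> a x; rewrite !tkk_hmapE // hK.
  have dh := conj_end_derv hh (der_fun_derv d); have dh' := conj_end_derv hh' dh.
  apply: subvs_inj; rewrite -!/(der_fun _) /= (der_funK dh) (der_funK dh').
  by apply/lfunP => x; rewrite (conj_endE hh') (conj_endE hh) !hK.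
exists (tkk_map f g); split.
- exact: (tkk_map_linear fg).
- by exists (tkk_map g f); apply: K.
- exact: (tkk_map_hc fg).
- exact: (tkk_mapM char3 fg iA).
Qed.

End Isomorphisms.

(** * S_{1,2} and the tiny Kaplansky superalgebra *)

Lemma symplectic_basis (k : fieldType) (V : vectType k) (form : {biscalar V}) :
  \dim {:V} = 2%N -> (forall v : V, form v v = 0) -> (exists u v : V, form u v != 0) ->
  exists u0 v0 : V, form u0 v0 = 1 /\ forall v, v = form v v0 *: u0 + form u0 v *: v0.
Proof.
move=> dimV alt [u [w nz]]; pose v := (form u w)^-1 *: w; exists u, v.
have uv : form u v = 1 by rewrite linearZr_LR /=; exact: mulVf.
clearbody v; split=> // x.
have fr : free [:: u; v].
  rewrite free_cons seq1_free span_seq1; apply/andP; split.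
    apply/negP => /vlineP[c e]; have := uv.
    by rewrite e linearZl_LR /= alt mulr0 => /eqP; rewrite eq_sym oner_eq0.
  by apply/eqP => e; move: uv; rewrite e linear0r => /eqP; rewrite eq_sym oner_eq0.
have ba : basis_of fullv [:: u; v] by rewrite basisEfree fr subvf dimV.
have : x \in <<[:: u; v]>>%VS by rewrite (span_basis ba) memvf.
rewrite span_cons span_seq1 => /memv_addP[_ /vlineP[a ->] [_ /vlineP[b ->] ->]].
rewrite linearDl linearDr /= !linearZl_LR !linearZr_LR /= !alt uv !mulr0 addr0 add0r.
by rewrite !mulr1.
Qed.

Section K3.
Variables (k : fieldType) (char3 : 3%N \in [pchar k]) (V : vectType k).
Variables (form : {biscalar V}) (u0 v0 : V).
Hypothesis form_alt : forall v, form v v = 0.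
Hypothesis form_uv : form u0 v0 = 1.
Hypothesis form_span : forall v, v = form v v0 *: u0 + form u0 v *: v0.

(** Multiplication by 1 on V is -1, which is the 1/2 of K_3. *)
Lemma S12_K3 : superalgebra_iso (S12 form) (K3 k).
Proof.
pose f (x : S12 form) : K3 k := (x.1, (form x.2 v0, form u0 x.2)).
exists f; split.
- by move=> c [a v] [b w]; rewrite /f /= linearPl linearPr.
- exists (fun y : K3 k => (y.1, y.2.1 *: u0 + y.2.2 *: v0)) => [[a v]|[a [b c]]].
    by rewrite /f /= -form_span.
  rewrite /f /= !linearDl !linearDr /= !linearZl_LR !linearZr_LR /= form_uv !form_alt.
  by rewrite !mulr0 addr0 add0r !mulr1.
- by case=> -[a v]; rewrite /f /= /oe_hc /= ?linear0l ?linear0r.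
move=> [a v] [b w]; have e := S12_mulE ((a, v) : S12 form) ((b, w) : S12 form).
rewrite e /f /=.
rewrite [RHS]/(K3_mul (a, (form v v0, form u0 v)) (b, (form w v0, form u0 w))) /K3_mul /=.
rewrite (form_det form_alt form_uv form_span v w) (half_char3 char3).
have h (p q s t : k) : - (p * s + q * t) = -1 * (p * s + t * q) by ring.
congr (_, (_, _)) => //.
  by rewrite linearNl linearDl /= !linearZl_LR; exact: h.
by rewrite linearNr linearDr /= !linearZr_LR; exact: h.
Qed.
End K3.

Theorem theorem4p2 (k : fieldType) (char3 : 3%N \in [pchar k])
    (V : vectType k) (dimV : \dim {:V} = 2%N)
    (form : {biscalar V})
    (form_alternating : forall v : V, form v v = 0)
    (form_neq0 : exists u v : V, form u v != 0) :
  superalgebra_iso (g_superalgebra (S12 form) (S12 form)) (tkk_superalgebra (K9 k)).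
Proof.
have [u0 [v0 [uv span]]] := symplectic_basis dimV form_alternating form_neq0.
have CS := S12_composition char3 form_alternating uv span.
have TS := S12_tri_diagonal char3 form_alternating uv span.
have surj := S12_der_surj char3 form_alternating uv span.
have inj := S12_der_inj char3 form_alternating uv span.
apply: (superalgebra_iso_trans (g_tkk_iso char3 CS CS TS TS surj inj)).
have SK := S12_K3 char3 form_alternating uv span.
apply: (tkk_iso char3 _ (tensor_iso SK SK)) => x y.
have [d [d' [hd hd' ->]]] := inner_split char3 form_alternating uv span x y.
by rewrite memvD ?Actl_derv ?Actr_derv //; exact: cc_graded CS.
Qed.
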